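(* Let $\beta_1,\dots,\beta_N\ge1$ be the constants parameterizing the set $\widetilde{\mathcal K}_{\mathrm{stab},\mathcal S}$, let $\widetilde K_0\in\widetilde{\mathcal K}_{\mathrm{stab},\mathcal S}$, and consider the policy gradient iterates $\widetilde K_{n+1}=\widetilde K_n-\frac{\alpha}{N}\sum_{i=1}^N\nabla J^{(i)}(\widetilde K_n)$, $n\ge0$. Suppose that the step-size $\alpha>0$ satisfies $$\alpha<\min\left\{\frac1{4\max_{\mathcal T^{(i)}\in\mathcal S}L_i},\;\frac4{\max_{\mathcal T^{(i)}\in\mathcal S}\gamma_i}\right\},$$ and that, for every $\mathcal T^{(i)}\in\mathcal S$, $$\sup_{\widetilde K\in\widetilde{\mathcal K}_{\mathrm{stab},\mathcal S}}b_i(\widetilde K)\le\frac{\gamma_i}6\big(J^{(i)}(\widetilde K_0)-J^{(i)}(\widetilde K_\star^{(i)})\big).$$ Then $\widetilde K_n\in\widetilde{\mathcal K}_{\mathrm{stab},\mathcal S}$ for all $n\in\mathbb N$. Moreover, for each task $\mathcal T^{(i)}\in\mathcal S$, $$\limsup_{n\to\infty}\big(J^{(i)}(\widetilde K_n)-J^{(i)}(\widetilde K_\star^{(i)})\big)\le\limsup_{n\to\infty}\frac{3\|S_\star^{(i)}\|\,\|\Sigma_{\widetilde K_\star^{(i)}}^{(i)}\|\,b_i(\widetilde K_n)}{4\lambda_{\min}(\Sigma_\nu^{(i)})^2\lambda_{\min}(R^{(i)})}.$$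
   Context: $\|\cdot\|$ is the spectral norm, $\|\cdot\|_F$ the Frobenius norm. **Tasks.** An LQG task is a tuple $\mathcal T^{(i)}=(A^{(i)},B^{(i)},C^{(i)},W^{(i)},V^{(i)},Q^{(i)},R^{(i)})$ defining $x_{t+1}^{(i)}=A^{(i)}x_t^{(i)}+B^{(i)}u_t^{(i)}+w_t^{(i)}$, $y_t^{(i)}=C^{(i)}x_t^{(i)}+v_t^{(i)}$, $x_0^{(i)}=0$, with state in $\mathbb R^{n_x}$, input in $\mathbb R^{n_u}$, output in $\mathbb R^{n_y}$; the noises $w_t^{(i)}\sim\mathcal N(0,W^{(i)})$, $v_t^{(i)}\sim\mathcal N(0,V^{(i)})$ are i.i.d. in time, mutually independent, independent across tasks, $W^{(i)}\succeq0$, $V^{(i)}\succ0$; $Q^{(i)}\succeq0$, $R^{(i)}\succ0$. Each $(A^{(i)},B^{(i)})$ is controllable and $(A^{(i)},C^{(i)})$ observable. The cost is $J^{(i)}=\limsup_{T\to\infty}\frac1T\mathbb E\sum_{t=0}^{T-1}(y_t^{(i)\top}Q^{(i)}y_t^{(i)}+u_t^{(i)\top}R^{(i)}u_t^{(i)})$. The training set is $\mathcal S=\{\mathcal T^{(i)}\}_{i=1}^N$. **Lifted controllers.** Fix a history length $p\in\mathbb N$ and let $z_{t,p}^{(i)}\in\mathbb R^{p(n_u+n_y)}$ stack $u_{t-1}^{(i)},\dots,u_{t-p}^{(i)},y_t^{(i)},\dots,y_{t-p+1}^{(i)}$. $S_\star^{(i)}\in\mathbb R^{n_x\times p(n_u+n_y)}$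 is a fixed task-dependent matrix (determined by the task parameters, the Kalman gain and the optimal LQG gain) with $\widehat x_t^{(i)}=S_\star^{(i)}z_{t,p}^{(i)}$, where $\widehat x_t^{(i)}$ is the Kalman filter state estimate; $\dagger$ denotes the pseudoinverse. A lifted controller $\widetilde K\in\mathbb R^{n_u\times p(n_u+n_y)}$ defines the policy $u_t^{(i)}=\widetilde Kz_{t,p}^{(i)}$, corresponding to the gain $K=\widetilde KS_\star^{(i)\dagger}$ on the estimate; $J^{(i)}(\widetilde K)$ is the resulting cost. Let $A_{\widetilde K}^{(i)}:=A^{(i)}+B^{(i)}\widetilde KS_\star^{(i)\dagger}$, $\widetilde{\mathcal K}^{(i)}:=\{\widetilde K:\rho(A_{\widetilde K}^{(i)})<1\}$, $\widetilde{\mathcal K}_{\mathcal S}:=\bigcap_{i=1}^N\widetilde{\mathcal K}^{(i)}$, and let $\widetilde K_\star^{(i)}$ minimize $J^{(i)}$ over $\widetilde{\mathcal K}^{(i)}$ (the optimal lifted controller of task $i$). Given $\widetilde K_0\in\widetilde{\mathcal K}_{\mathcal S}$ (an available initial common stabilizing controller) and constants $\beta_1,\dots,\beta_N\ge1$, set $\widetilde{\mathcal K}_{\mathrm{stab}}^{(i)}:=\{\widetilde K\in\widetilde{\mathcal K}^{(i)}:J^{(i)}(\widetilde K)-J^{(i)}(\widetilde K_\star^{(i)})\le\beta_i(J^{(i)}(\widetilde K_0)-J^{(i)}(\widetilde K_\star^{(i)}))\}$ and $\widetilde{\mathcal K}_{\mathrm{stab},\mathcal S}:=\bigcap_{i=1}^N\widetilde{\mathcal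 K}_{\mathrm{stab}}^{(i)}$. **Gradient.** $\mathtt{dare}(A,B,Q,R)$ is the unique stabilizing solution $P$ of $P=Q+A^\top PA-A^\top PB(R+B^\top PB)^{-1}B^\top PA$. Let $\widetilde\Sigma^{(i)}=\mathtt{dare}(A^{(i)\top},C^{(i)\top},W^{(i)},V^{(i)})$, $L^{(i)}=\widetilde\Sigma^{(i)}C^{(i)\top}(C^{(i)}\widetilde\Sigma^{(i)}C^{(i)\top}+V^{(i)})^{-1}$, $\Sigma_\nu^{(i)}=L^{(i)}(C^{(i)}\widetilde\Sigma^{(i)}C^{(i)\top}+V^{(i)})L^{(i)\top}$, $\widetilde Q^{(i)}=C^{(i)\top}Q^{(i)}C^{(i)}$. For $\widetilde K\in\widetilde{\mathcal K}^{(i)}$, $P_{\widetilde K}^{(i)}$ and $\Sigma_{\widetilde K}^{(i)}$ are the unique solutions of $P=\widetilde Q^{(i)}+S_\star^{(i)\dagger\top}\widetilde K^\top R^{(i)}\widetilde KS_\star^{(i)\dagger}+A_{\widetilde K}^{(i)\top}PA_{\widetilde K}^{(i)}$ and $\Sigma=\Sigma_\nu^{(i)}+A_{\widetilde K}^{(i)}\Sigma A_{\widetilde K}^{(i)\top}$. Put $E_{\widetilde K}^{(i)}:=2\big((R^{(i)}+B^{(i)\top}P_{\widetilde K}^{(i)}B^{(i)})\widetilde KS_\star^{(i)\dagger}+B^{(i)\top}P_{\widetilde K}^{(i)}A^{(i)}\big)$. The gradient is $\nabla J^{(i)}(\widetilde K)=E_{\widetilde K}^{(i)}\Sigma_{\widetilde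 K}^{(i)}S_\star^{(i)\dagger\top}$. **Standing properties (stated by the paper as standard).** For $\widetilde K,\widetilde K'\in\widetilde{\mathcal K}_{\mathrm{stab}}^{(i)}$: smoothness $\|\nabla J^{(i)}(\widetilde K)-\nabla J^{(i)}(\widetilde K')\|\le L_i\|\widetilde K-\widetilde K'\|$; boundedness $J^{(i)}(\widetilde K)\le\bar J_i<\infty$; gradient dominance $J^{(i)}(\widetilde K)-J^{(i)}(\widetilde K_\star^{(i)})\le\frac1{\gamma_i}\|\nabla J^{(i)}(\widetilde K)\|_F^2$ with $\gamma_i:=4\lambda_{\min}(\Sigma_\nu^{(i)})^2\lambda_{\min}(R^{(i)})/(\|\Sigma_{\widetilde K_\star^{(i)}}^{(i)}\|\|S_\star^{(i)}\|)$ (implicitly $\gamma_i>0$). **Bisimulation-based heterogeneity.** Let $F_{\widetilde K}^{(i)}=A_{\widetilde K}^{(i)}\otimes A_{\widetilde K}^{(i)}$, $C_{\widetilde K}^{(i)}=S_\star^{(i)\dagger}\otimes E_{\widetilde K}^{(i)}$, $\nu^{(i)}=\mathrm{vec}(\Sigma_\nu^{(i)})$, $F_{\widetilde K}^{(ij)}=\mathrm{diag}(F_{\widetilde K}^{(i)},F_{\widetilde K}^{(j)})$ (block diagonal), $C_{\widetilde K}^{(ij)}=[C_{\widetilde K}^{(i)}\;-C_{\widetilde K}^{(j)}]$, $\nu^{(ij)}=[\nu^{(i)\top}\;\nu^{(j)\top}]^\top$. For $\widetilde K\in\widetilde{\mathcal K}_{\mathrm{stab},\mathcal S}$ and $i\neq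 j$, let $M_{\widetilde K}^{(ij)}\in\mathbb S_+^{2n_x^2}$ and $\lambda_{\widetilde K}^{(ij)}\in(0,1)$ denote the minimizers of $\frac{(1+\eta^{-1})\,\nu^{(ij)\top}M\nu^{(ij)}}{\lambda-\eta(1-\lambda)}$ (with the optimal choice $\eta=\frac1{\sqrt{1-\lambda}}-1\in(0,\frac{\lambda}{1-\lambda})$) subject to $M\succeq C_{\widetilde K}^{(ij)\top}C_{\widetilde K}^{(ij)}$ and $F_{\widetilde K}^{(ij)\top}MF_{\widetilde K}^{(ij)}-M\preceq-\lambda M$. With $\eta_{\widetilde K}^{(ij)}:=\frac1{\sqrt{1-\lambda_{\widetilde K}^{(ij)}}}-1$, define $$b_{ij}(\widetilde K):=\frac{\big(1+(\eta_{\widetilde K}^{(ij)})^{-1}\big)\nu^{(ij)\top}M_{\widetilde K}^{(ij)}\nu^{(ij)}}{\lambda_{\widetilde K}^{(ij)}-\eta_{\widetilde K}^{(ij)}(1-\lambda_{\widetilde K}^{(ij)})},\qquad b_i(\widetilde K):=\frac1{N-1}\sum_{j\ne i}b_{ij}(\widetilde K).$$ *)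

(* Defs.v *)
From HB Require Import structures.
From mathcomp Require Import all_boot all_order all_algebra.
From mathcomp Require Import complex mxtens.
From mathcomp Require Import all_classical all_reals all_analysis.

Set Implicit Arguments.
Unset Strict Implicit.
Unset Printing Implicit Defensive.

Import Order.TTheory GRing.Theory Num.Theory.

Local Open Scope classical_set_scope.
Local Open Scope ring_scope.

Section LinearAlgebra.
Context {R : realType}.

Definition qform n (M : 'M[R]_n) (x : 'cV[R]_n) : R := (x^T *m M *m x) 0 0.

Definition psd n (M : 'M[R]_n) : Prop :=
  M^T = M /\ forall x : 'cV[R]_n, 0 <= qform M x.

Definition pd n (M : 'M[R]_n) : Prop :=
  M^T = M /\ forall x : 'cV[R]_n, x != 0 -> 0 < qform M x.

Definition loewner_le n (M M' : 'M[R]_n) : Prop := psd (M' - M).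

(* The topological norm that the library puts on matrices is the max norm; the
   Euclidean, spectral and Frobenius norms are therefore defined here. *)
Definition l2norm n (x : 'cV[R]_n) : R := Num.sqrt (\sum_i x i 0 ^+ 2).

Definition specnorm m n (M : 'M[R]_(m, n)) : R :=
  sup [set l2norm (M *m x) | x in [set x : 'cV[R]_n | l2norm x <= 1]].

Definition frobnorm m n (M : 'M[R]_(m, n)) : R :=
  Num.sqrt (\sum_i \sum_j M i j ^+ 2).

(* Smallest real eigenvalue; only used for symmetric matrices, all of whose
   eigenvalues are real. *)
Definition lambda_min n (M : 'M[R]_n) : R := inf [set a | eigenvalue M a].

(* Largest modulus of a complex eigenvalue. *)
Definition spectral_radius n (M : 'M[R]_n) : R :=
  sup [set Normc.normc z
      | z in [set z : R[i] | eigenvalue (map_mx (real_complex R) M) z]].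

(* Moore-Penrose pseudoinverse (the library's [pinvmx] is only a partial
   inverse). *)
Definition penrose m n (S : 'M[R]_(m, n)) (X : 'M[R]_(n, m)) : Prop :=
  [/\ S *m X *m S = S, X *m S *m X = X,
      (S *m X)^T = S *m X & (X *m S)^T = X *m S].

Definition mp_pinv m n (S : 'M[R]_(m, n)) : 'M[R]_(n, m) :=
  xget 0 [set X | penrose S X].

(* Column-stacking vectorization, indexed compatibly with [tensmx], so that
   [vec (A *m X *m B) = tensmx B^T A *m vec X]. *)
Definition vec m n (X : 'M[R]_(m, n)) : 'cV[R]_(n * m) :=
  \col_k X (mxtens_unindex k).2 (mxtens_unindex k).1.

Definition controllable nx nu (A : 'M[R]_nx) (B : 'M[R]_(nx, nu)) : Prop :=
  \rank (\mxrow_(k < nx) (A ^+ k *m B)) = nx.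

Definition observable nx ny (A : 'M[R]_nx) (C : 'M[R]_(ny, nx)) : Prop :=
  \rank (\mxcol_(k < nx) (C *m A ^+ k)) = nx.

Section Dare.
Context {nx nu : nat}.
Variables (A : 'M[R]_nx) (B : 'M[R]_(nx, nu)) (Q : 'M[R]_nx) (W : 'M[R]_nu).

Definition dare_gain (P : 'M[R]_nx) : 'M[R]_(nu, nx) :=
  - (invmx (W + B^T *m P *m B) *m B^T *m P *m A).

Definition stabilizing_dare_sol (P : 'M[R]_nx) : Prop :=
  [/\ psd P,
      P = Q + A^T *m P *m A
          - A^T *m P *m B *m invmx (W + B^T *m P *m B) *m B^T *m P *m A &
      spectral_radius (A + B *m dare_gain P) < 1].

Definition dare : 'M[R]_nx := xget 0 [set P | stabilizing_dare_sol P].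

End Dare.

End LinearAlgebra.

Section Probability.
Context {R : realType} {d : measure_display} {Om : measurableType d}.
Variable P : probability Om R.

(* The law N(0, s2). For s2 = 0 it is the Dirac mass at 0; the library's
   [normal_prob] is a different (junk) law when the standard deviation is 0. *)
Definition centered_gauss (s2 : R) : set R -> \bar R :=
  if s2 == 0 then \d_(0 : R) else normal_prob 0 (Num.sqrt s2).

Definition random_vector n (X : Om -> 'cV[R]_n) : Prop :=
  forall k, measurable_fun setT (fun om => X om k 0).

(* X ~ N(0, V), V possibly singular: every linear functional a^T X has the
   law N(0, a^T V a). *)
Definition gaussian_vector n (V : 'M[R]_n) (X : Om -> 'cV[R]_n) : Prop :=
  random_vector X /\
  forall (a : 'cV[R]_n) (B : set R), measurable B ->
    P [set om | B ((a^T *m X om) 0 0)] = centered_gauss (qform V a) B.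

Definition sigma_of n (X : Om -> 'cV[R]_n) : set (set Om) :=
  g_sigma_preimage (fun (k : 'I_n) om => X om k 0).

Definition mutually_independent (I : choiceType) (F : I -> set (set Om)) : Prop :=
  forall (s : seq I) (E : I -> set Om), uniq s ->
    (forall i, i \in s -> F i (E i)) ->
    P (\bigcap_(i in [set` s]) E i) = (\prod_(i <- s) P (E i))%E.

End Probability.

Record lqg_task (R : realType) (nx nu ny : nat) := LqgTask {
  tA : 'M[R]_nx;
  tB : 'M[R]_(nx, nu);
  tC : 'M[R]_(ny, nx);
  tW : 'M[R]_nx;
  tV : 'M[R]_ny;
  tQ : 'M[R]_ny;
  tR : 'M[R]_nu }.

Section Task.
Context {R : realType} {nx nu ny : nat}.
Variable T : lqg_task R nx nu ny.
Local Notation A := (tA T).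
Local Notation B := (tB T).
Local Notation C := (tC T).

Definition admissible_task : Prop :=
  [/\ psd (tW T), pd (tV T), psd (tQ T) & pd (tR T)] /\
  (controllable A B /\ observable A C).

Definition Qtilde : 'M[R]_nx := C^T *m tQ T *m C.

Definition Sigma_tilde : 'M[R]_nx := dare A^T C^T (tW T) (tV T).

Definition innov_cov : 'M[R]_ny := C *m Sigma_tilde *m C^T + tV T.

Definition kalman_gain : 'M[R]_(nx, ny) :=
  Sigma_tilde *m C^T *m invmx innov_cov.

Definition Sigma_nu : 'M[R]_nx := kalman_gain *m innov_cov *m kalman_gain^T.

Definition lqg_gain : 'M[R]_(nu, nx) :=
  dare_gain A B (tR T) (dare A B Qtilde (tR T)).

Section ClosedLoop.
Variables (w : nat -> 'cV[R]_nx) (v : nat -> 'cV[R]_ny) (K : 'M[R]_(nu, nx)).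

(* State and (stationary-gain) Kalman estimate, driven by u_t = K xhat_t; both
   start at the known initial state 0. *)
Fixpoint loop_state (t : nat) : 'cV[R]_nx * 'cV[R]_nx :=
  if t is t'.+1 then
    let: (x, xhat) := loop_state t' in
    let u := K *m xhat in
    let x' := A *m x + B *m u + w t' in
    let y' := C *m x' + v t'.+1 in
    let pred := A *m xhat + B *m u in
    (x', pred + kalman_gain *m (y' - C *m pred))
  else (0, 0).

Definition loop_x t := (loop_state t).1.
Definition loop_xhat t := (loop_state t).2.
Definition loop_u t : 'cV[R]_nu := K *m loop_xhat t.
Definition loop_y t : 'cV[R]_ny := C *m loop_x t + v t.

(* (u_{t-1}, ..., u_{t-p}, y_t, ..., y_{t-p+1}); meaningful for p <= t. *)
Definition history (p t : nat) : 'cV[R]_(p * nu + p * ny) :=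
  col_mx (vec (\matrix_(a < nu, k < p) loop_u (t.-1 - k)%N a 0))
         (vec (\matrix_(a < ny, k < p) loop_y (t - k)%N a 0)).

Definition stage_cost t : R :=
  qform (tQ T) (loop_y t) + qform (tR T) (loop_u t).

End ClosedLoop.

Section Stochastic.
Context {d : measure_display} {Om : measurableType d}.
Variables (P : probability Om R).
Variables (w : nat -> Om -> 'cV[R]_nx) (v : nat -> Om -> 'cV[R]_ny).

Definition lqg_cost (K : 'M[R]_(nu, nx)) : \bar R :=
  limn_esup (fun n : nat => ((n%:R^-1)%:E *
    'E_P[fun om => (\sum_(t < n) stage_cost (w ^~ om) (v ^~ om) K t)%R])%E).

(* xhat_t = S z_{t,p} along the optimal LQG closed loop, as soon as the history
   window is filled. The identity cannot be asked of every controller: the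
   estimate depends on the whole past, and the window determines it only
   through the relation u = K xhat for the gain K with which S was built. *)
Definition lifting_matrix (p : nat) (S : 'M[R]_(nx, p * nu + p * ny)) : Prop :=
  forall t, (p <= t)%N ->
    {ae P, forall om, loop_xhat (w ^~ om) (v ^~ om) lqg_gain t
                      = S *m history (w ^~ om) (v ^~ om) lqg_gain p t}.

End Stochastic.

Section Lifted.
Context {q : nat}.
Variable S : 'M[R]_(nx, q).
Implicit Type K : 'M[R]_(nu, q).

Definition gain_of K : 'M[R]_(nu, nx) := K *m mp_pinv S.

Definition A_cl K : 'M[R]_nx := A + B *m gain_of K.

Definition Kset : set 'M[R]_(nu, q) := [set K | spectral_radius (A_cl K) < 1].

Definition P_of K : 'M[R]_nx :=
  xget 0 [set P | P = Qtilde + (mp_pinv S)^T *m K^T *m tR T *m K *m mp_pinv S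
                      + (A_cl K)^T *m P *m A_cl K].

Definition Sigma_of K : 'M[R]_nx :=
  xget 0 [set Sg | Sg = Sigma_nu + A_cl K *m Sg *m (A_cl K)^T].

Definition E_of K : 'M[R]_(nu, nx) :=
  2%:R *: ((tR T + B^T *m P_of K *m B) *m K *m mp_pinv S + B^T *m P_of K *m A).

(* Closed form of the gradient of the lifted cost below, K being the variable
   (not a derivative taken from the library). *)
Definition gradJ K : 'M[R]_(nu, q) := E_of K *m Sigma_of K *m (mp_pinv S)^T.

Definition gamma_of Kstar : R :=
  4%:R * lambda_min Sigma_nu ^+ 2 * lambda_min (tR T)
  / (specnorm (Sigma_of Kstar) * specnorm S).

Definition F_of K : 'M[R]_(nx * nx) := tensmx (A_cl K) (A_cl K).

Definition C_of K : 'M[R]_(q * nu, nx * nx) := tensmx (mp_pinv S) (E_of K).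

(* Cost of the lifted controller K: since xhat = S z, the policy u = K z acts
   on the estimate through the gain K S^+. *)
Definition lifted_cost d (Om : measurableType d) (P : probability Om R)
    (w : nat -> Om -> 'cV[R]_nx) (v : nat -> Om -> 'cV[R]_ny) K : \bar R :=
  lqg_cost P w v (gain_of K).

End Lifted.

End Task.

Section Bisimulation.
Context {R : realType}.

Definition bisim_eta (lam : R) : R := (Num.sqrt (1 - lam))^-1 - 1.

Definition bisim_obj n (nu0 : 'cV[R]_n) (M : 'M[R]_n) (lam : R) : R :=
  (1 + (bisim_eta lam)^-1) * qform M nu0 / (lam - bisim_eta lam * (1 - lam)).

Definition bisim_feasible m n (F : 'M[R]_n) (C : 'M[R]_(m, n))
    (M : 'M[R]_n) (lam : R) : Prop :=
  [/\ psd M, 0 < lam < 1, loewner_le (C^T *m C) M &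
      loewner_le (F^T *m M *m F - M) (- (lam *: M))].

Definition bisim_minimizer m n (F : 'M[R]_n) (C : 'M[R]_(m, n))
    (nu0 : 'cV[R]_n) (M : 'M[R]_n) (lam : R) : Prop :=
  bisim_feasible F C M lam /\
  forall M' lam', bisim_feasible F C M' lam' ->
    bisim_obj nu0 M lam <= bisim_obj nu0 M' lam'.

End Bisimulation.

Section MultiTask.
Context {R : realType} {nx nu ny N q : nat}.
Variables (T : 'I_N -> lqg_task R nx nu ny) (S : 'I_N -> 'M[R]_(nx, q)).
Implicit Type K : 'M[R]_(nu, q).

Definition task_noise d (Om : measurableType d) (P : probability Om R)
    (w : 'I_N -> nat -> Om -> 'cV[R]_nx) (v : 'I_N -> nat -> Om -> 'cV[R]_ny)
    : Prop :=
  [/\ forall i t, gaussian_vector P (tW (T i)) (w i t),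
      forall i t, gaussian_vector P (tV (T i)) (v i t) &
      mutually_independent P (fun k : 'I_N * nat * bool =>
        if k.2 then sigma_of (w k.1.1 k.1.2) else sigma_of (v k.1.1 k.1.2))].

Section Stab.
Variables (J : 'I_N -> 'M[R]_(nu, q) -> \bar R).
Variables (Kstar : 'I_N -> 'M[R]_(nu, q)) (K0 : 'M[R]_(nu, q)) (beta : 'I_N -> R).

Definition gap i K : \bar R := (J i K - J i (Kstar i))%E.

Definition Kstab i : set 'M[R]_(nu, q) :=
  [set K | Kset (T i) (S i) K /\ (gap i K <= (beta i)%:E * gap i K0)%E].

Definition KstabS : set 'M[R]_(nu, q) := \bigcap_i Kstab i.

End Stab.

Definition F_pair i j K := block_mx (F_of (T i) (S i) K) 0 0 (F_of (T j) (S j) K).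

Definition C_pair i j K := row_mx (C_of (T i) (S i) K) (- C_of (T j) (S j) K).

Definition nu_pair i j := col_mx (vec (Sigma_nu (T i))) (vec (Sigma_nu (T j))).

Section Heterogeneity.
Variables (M : 'I_N -> 'I_N -> 'M[R]_(nu, q) -> 'M[R]_(nx * nx + nx * nx)).
Variables (lam : 'I_N -> 'I_N -> 'M[R]_(nu, q) -> R).

Definition b_pair i j K : R := bisim_obj (nu_pair i j) (M i j K) (lam i j K).

(* For N = 1 the sum is empty and the value is 0. *)
Definition b_task i K : R := (N.-1)%:R^-1 * \sum_(j | j != i) b_pair i j K.

End Heterogeneity.

Definition pg_step (alpha : R) K : 'M[R]_(nu, q) :=
  K - (alpha / N%:R) *: \sum_i gradJ (T i) (S i) K.

Definition pg_iter alpha K0 (n : nat) : 'M[R]_(nu, q) := iter n (pg_step alpha) K0.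

End MultiTask.

(* Main.v *)
Require Import Defs.
From HB Require Import structures.
From mathcomp Require Import all_boot all_order all_algebra.
From mathcomp Require Import complex mxtens.
From mathcomp Require Import all_classical all_reals all_analysis.
From mathcomp Require Import measurable_realfun.
From mathcomp Require Import ring lra.

Set Implicit Arguments.
Unset Strict Implicit.
Unset Printing Implicit Defensive.

Import Order.TTheory GRing.Theory Num.Theory.
Import numFieldNormedType.Exports.

Local Open Scope classical_set_scope.
Local Open Scope ring_scope.

(** The optimal filter makes the noise enter the cost of a gain [G] only through
    a constant, so that [J] is the constant plus [tr (P_G Sigma_nu)]: a smooth
    function of [G] on the set of stabilizing gains, with an explicit gradient
    and Hessian. Its sublevel sets stay away from the boundary of that set, since
    the gap to the optimum is [tr (Sigma_G D^T (R + B^T P* B) D)] with [D = G - G*],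
    which bounds [Sigma_G] and hence excludes a limit of spectral radius 1. A continuous
    induction along the segment from an iterate to its successor therefore keeps
    the segment inside the sublevel sets of all tasks as long as the quadratic
    upper bound does.

    The bisimulation matrix [M] is a Lyapunov function for the recursion of
    [vec Sigma], hence bounds the Frobenius distance between the gradients of two
    tasks, and by convexity the distance [e] between the averaged gradient [g] and
    the gradient [h] of one task: [|e|^2 <= b_i]. With [a L <= 1/4] one gets
    [<h, g> - |g|^2 / 8 >= |h|^2 / 2 - |e|^2 / 2], and gradient dominance turns the
    descent inequality into a contraction [gap' <= (1 - c) gap + 2 c b_i / gamma_i]
    with [c = a gamma_i / 4], whose fixed point lies below the admissible gap. A
    task with initial gap 0 is the degenerate case: it forces [e = 0] and [h = 0],
    so that the iterates are constant. *)

(** * Frobenius inner product and the two matrix norms *)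

Section Frobenius.
Context {R : realType}.

(** Smoothness is assumed in the spectral norm, whereas the descent inequality needs the Hessian in
    the direction [g] bounded by [L |g|_F^2]. Comparing the two norms directly would cost a factor
    of the dimension and spoil the step-size condition. The Hessian is self-adjoint for [dotm],
    which removes this factor; this is why it is computed explicitly. The regularity of each task is
    extracted from two assumptions. [gamma_i > 0] excludes the default value 0 of the filter
    covariance, so the Riccati equation has a stabilizing solution, and it makes [Sigma_nu] positive
    definite. The lifting identity then gives [S] full row rank, so that a vanishing lifted gradient
    forces [E = 0]. Smoothness and dominance are available only on the sublevel sets, so the segment
    between two iterates must stay inside while they are being used. An iterate may lie on the
    boundary ([K0] does when [beta_i = 1]); there the sign of the first derivative starts the
    induction. *)

Definition dotm m n (X Y : 'M[R]_(m, n)) : R := \tr (X^T *m Y).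

Lemma dotmE m n (X Y : 'M[R]_(m, n)) : dotm X Y = \sum_i \sum_j X i j * Y i j.
Proof.
rewrite /dotm /mxtrace exchange_big /=; apply: eq_bigr => j _.
by rewrite mxE; apply: eq_bigr => i _; rewrite mxE.
Qed.

Lemma dotmC m n (X Y : 'M[R]_(m, n)) : dotm X Y = dotm Y X.
Proof. by rewrite !dotmE; do 2![apply: eq_bigr => ? _]; rewrite mulrC. Qed.

Lemma dotmDl m n (X X' Y : 'M[R]_(m, n)) : dotm (X + X') Y = dotm X Y + dotm X' Y.
Proof. by rewrite /dotm linearD /= mulmxDl mxtraceD. Qed.

Lemma dotmDr m n (X X' Y : 'M[R]_(m, n)) : dotm Y (X + X') = dotm Y X + dotm Y X'.
Proof. by rewrite /dotm mulmxDr mxtraceD. Qed.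

Lemma dotmZl m n a (X Y : 'M[R]_(m, n)) : dotm (a *: X) Y = a * dotm X Y.
Proof. by rewrite /dotm linearZ /= -scalemxAl mxtraceZ. Qed.

Lemma dotmZr m n a (X Y : 'M[R]_(m, n)) : dotm X (a *: Y) = a * dotm X Y.
Proof. by rewrite dotmC dotmZl dotmC. Qed.

Lemma dotmNl m n (X Y : 'M[R]_(m, n)) : dotm (- X) Y = - dotm X Y.
Proof. by rewrite -scaleN1r dotmZl mulN1r. Qed.

Lemma dotmNr m n (X Y : 'M[R]_(m, n)) : dotm X (- Y) = - dotm X Y.
Proof. by rewrite dotmC dotmNl dotmC. Qed.

Lemma dotmBl m n (X X' Y : 'M[R]_(m, n)) : dotm (X - X') Y = dotm X Y - dotm X' Y.
Proof. by rewrite dotmDl dotmNl. Qed.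

Lemma dotmBr m n (X X' Y : 'M[R]_(m, n)) : dotm Y (X - X') = dotm Y X - dotm Y X'.
Proof. by rewrite dotmDr dotmNr. Qed.

Lemma dotm0l m n (Y : 'M[R]_(m, n)) : dotm 0 Y = 0.
Proof. by rewrite -[0](scale0r Y) dotmZl mul0r. Qed.

Lemma dotm0r m n (Y : 'M[R]_(m, n)) : dotm Y 0 = 0.
Proof. by rewrite dotmC dotm0l. Qed.

Lemma dotm_sumr m n I (r : seq I) (F : I -> 'M[R]_(m, n)) Y :
  dotm Y (\sum_(i <- r) F i) = \sum_(i <- r) dotm Y (F i).
Proof. by elim/big_ind2: _ => [|? ? ? ? <- <-|]; rewrite ?dotm0r ?dotmDr. Qed.

Lemma dotm_ge0 m n (X : 'M[R]_(m, n)) : 0 <= dotm X X.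
Proof. by rewrite dotmE; do 2![apply: sumr_ge0 => ? _]; rewrite -expr2 sqr_ge0. Qed.

Lemma dotm_entry m n (X : 'M[R]_(m, n)) i j : X i j ^+ 2 <= dotm X X.
Proof.
rewrite dotmE (bigD1 i) //= (bigD1 j) //= -expr2 -addrA lerDl.
by rewrite addr_ge0 ?sumr_ge0 // => *; rewrite ?sumr_ge0 // => *; rewrite -expr2 sqr_ge0.
Qed.

Lemma dotm_eq0 m n (X : 'M[R]_(m, n)) : dotm X X = 0 -> X = 0.
Proof.
move=> X0; apply/matrixP => i j; rewrite mxE; apply/eqP.
by rewrite -sqrf_eq0 eq_le sqr_ge0 -X0 dotm_entry.
Qed.

Lemma dotm_CS m n (X Y : 'M[R]_(m, n)) : dotm X Y ^+ 2 <= dotm X X * dotm Y Y.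
Proof.
have [Y0|Y0] := eqVneq Y 0; first by rewrite Y0 !dotm0r mulr0 expr0n.
have Ygt : 0 < dotm Y Y.
  by rewrite lt_def dotm_ge0 andbT; apply: contraNneq Y0 => /dotm_eq0 ->.
have := dotm_ge0 (dotm Y Y *: X - dotm X Y *: Y).
rewrite !(dotmBl, dotmBr, dotmZl, dotmZr) (dotmC Y X) => h.
rewrite -subr_ge0 -(pmulr_rge0 _ Ygt); move: h; rewrite -subr_ge0 => h.
by rewrite -subr_ge0; apply: le_trans h _; rewrite le_eqVlt; apply/orP; left; apply/eqP; ring.
Qed.

Lemma dotm_mull m n p (A : 'M[R]_(m, n)) (X : 'M[R]_(n, p)) Y :
  dotm (A *m X) Y = dotm X (A^T *m Y).
Proof. by rewrite /dotm trmx_mul mulmxA. Qed.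

Lemma dotm_mulr m n p (B : 'M[R]_(n, p)) (X : 'M[R]_(m, n)) Y :
  dotm (X *m B) Y = dotm X (Y *m B^T).
Proof. by rewrite /dotm trmx_mul -mulmxA mxtrace_mulC mulmxA. Qed.

Lemma dotm_tr m n (X Y : 'M[R]_(m, n)) : dotm X^T Y^T = dotm X Y.
Proof. by rewrite !dotmE exchange_big; do 2![apply: eq_bigr => ? _]; rewrite !mxE. Qed.

Lemma frobnorm_sqr m n (X : 'M[R]_(m, n)) : frobnorm X ^+ 2 = dotm X X.
Proof.
rewrite sqr_sqrtr; first by rewrite dotmE; do 2![apply: eq_bigr => ? _]; rewrite expr2.
by do 2![apply: sumr_ge0 => ? _]; rewrite sqr_ge0.
Qed.

Lemma l2norm_sqr n (x : 'cV[R]_n) : l2norm x ^+ 2 = dotm x x.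
Proof.
rewrite sqr_sqrtr; last by apply: sumr_ge0 => *; rewrite sqr_ge0.
by rewrite dotmE; apply: eq_bigr => i _; rewrite big_ord1 expr2.
Qed.

Lemma l2norm_ge0 n (x : 'cV[R]_n) : 0 <= l2norm x.
Proof. exact: sqrtr_ge0. Qed.

Lemma l2normE n (x : 'cV[R]_n) : l2norm x = Num.sqrt (dotm x x).
Proof. by rewrite -l2norm_sqr sqrtr_sqr ger0_norm // l2norm_ge0. Qed.

Lemma l2normZ n a (x : 'cV[R]_n) : l2norm (a *: x) = `|a| * l2norm x.
Proof. by rewrite !l2normE dotmZl dotmZr mulrA -expr2 sqrtrM ?sqr_ge0 // sqrtr_sqr. Qed.

Lemma frobnormE m n (X : 'M[R]_(m, n)) : frobnorm X = Num.sqrt (dotm X X).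
Proof. by rewrite -frobnorm_sqr sqrtr_sqr ger0_norm // sqrtr_ge0. Qed.

Lemma dotm_mulmx_le m n (X : 'M[R]_(m, n)) (x : 'cV[R]_n) :
  dotm (X *m x) (X *m x) <= dotm X X * dotm x x.
Proof.
rewrite dotmE [dotm X X]dotmE mulr_suml; apply: ler_sum => i _.
rewrite big_ord1; set r := row i X.
have -> : (X *m x) i 0 = dotm r^T x.
  by rewrite mxE dotmE; apply: eq_bigr => j _; rewrite big_ord1 !mxE.
apply: le_trans (_ : dotm r^T r^T * dotm x x <= _); first by rewrite -expr2 dotm_CS.
by rewrite dotm_tr [dotm r r]dotmE big_ord1; under eq_bigr do rewrite !mxE.
Qed.

Lemma specnorm_ub m n (M : 'M[R]_(m, n)) :
  ubound [set l2norm (M *m x) | x in [set x : 'cV[R]_n | l2norm x <= 1]] (frobnorm M).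
Proof.
move=> _ [x /= x1 <-]; rewrite l2normE frobnormE ler_sqrt ?dotm_ge0 //.
apply: le_trans (dotm_mulmx_le _ _) _; rewrite ler_piMr ?dotm_ge0 // -l2norm_sqr.
by rewrite expr_le1 // l2norm_ge0.
Qed.

(** [sup] is meaningful only on nonempty bounded sets; the Frobenius norm supplies the bound. *)
Lemma specnorm_sup m n (M : 'M[R]_(m, n)) :
  has_sup [set l2norm (M *m x) | x in [set x : 'cV[R]_n | l2norm x <= 1]].
Proof.
split; last by exists (frobnorm M); exact: specnorm_ub.
exists (l2norm (M *m 0)); exists 0 => //=.
by rewrite l2normE dotm0l sqrtr0.
Qed.

Lemma specnorm_ge_unit m n (M : 'M[R]_(m, n)) x :
  l2norm x <= 1 -> l2norm (M *m x) <= specnorm M.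
Proof. by move=> x1; apply: ub_le_sup; [exact: (specnorm_sup M).2|exists x]. Qed.

Lemma specnorm_le m n (M : 'M[R]_(m, n)) c :
  (forall x, l2norm x <= 1 -> l2norm (M *m x) <= c) -> specnorm M <= c.
Proof.
move=> h; apply: ge_sup; first exact: (specnorm_sup M).1.
by move=> _ [x /= x1 <-]; exact: h.
Qed.

Lemma specnorm_ge0 m n (M : 'M[R]_(m, n)) : 0 <= specnorm M.
Proof.
apply: le_trans (specnorm_ge_unit M (_ : l2norm 0 <= 1)); first exact: l2norm_ge0.
by rewrite l2normE dotm0l sqrtr0.
Qed.

Lemma specnorm_le_frob m n (M : 'M[R]_(m, n)) : specnorm M <= frobnorm M.
Proof. by apply: specnorm_le => x x1; apply: specnorm_ub; exists x. Qed.

(** Each column is the image of a unit vector. The factor [n] is harmless, because the power method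
    below absorbs it. *)
Lemma dotm_le_specnorm m n (M : 'M[R]_(m, n)) : dotm M M <= n%:R * specnorm M ^+ 2.
Proof.
have -> : dotm M M = \sum_j dotm (col j M) (col j M).
  rewrite dotmE exchange_big; apply: eq_bigr => j _.
  by rewrite dotmE; apply: eq_bigr => i _; rewrite big_ord1 !mxE.
rewrite mulr_natl -[X in _ *+ X]card_ord -sumr_const; apply: ler_sum => j _.
rewrite -l2norm_sqr ler_pXn2r ?nnegrE ?l2norm_ge0 ?specnorm_ge0 // colE.
apply: specnorm_ge_unit; rewrite l2normE dotmE (bigD1 j) //= big_ord1 mxE !eqxx mulr1.
rewrite big1 ?addr0 ?sqrtr1 // => i ij.
by rewrite big_ord1 mxE (negbTE ij) mulr0.
Qed.

End Frobenius.

(** * Quadratic forms and positive semidefinite matrices *)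

Section Quadratic.
Context {R : realType}.

Definition bform n (M : 'M[R]_n) (x y : 'cV[R]_n) : R := (x^T *m M *m y) 0 0.

Lemma bformE n (M : 'M[R]_n) x y : bform M x y = dotm x (M *m y).
Proof. by rewrite /bform /dotm mulmxA /mxtrace big_ord1. Qed.

Lemma qformE n (M : 'M[R]_n) x : qform M x = dotm x (M *m x).
Proof. exact: bformE. Qed.

Lemma bformC n (M : 'M[R]_n) x y : M^T = M -> bform M x y = bform M y x.
Proof. by move=> sM; rewrite !bformE dotmC dotm_mull sM. Qed.

Lemma qformDx n (M : 'M[R]_n) x y : M^T = M ->
  qform M (x + y) = qform M x + 2 * bform M x y + qform M y.
Proof.
move=> sM; rewrite !qformE mulmxDr !(dotmDl, dotmDr) -!bformE (bformC y x sM).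
by ring.
Qed.

Lemma qformZx n (M : 'M[R]_n) a x : qform M (a *: x) = a ^+ 2 * qform M x.
Proof. by rewrite !qformE -scalemxAr dotmZl dotmZr mulrA. Qed.

Lemma bformZl n (M : 'M[R]_n) a x y : bform M (a *: x) y = a * bform M x y.
Proof. by rewrite !bformE dotmZl. Qed.

Lemma qform0x n (M : 'M[R]_n) : qform M 0 = 0.
Proof. by rewrite qformE dotm0l. Qed.

Lemma qformD n (M M' : 'M[R]_n) x : qform (M + M') x = qform M x + qform M' x.
Proof. by rewrite !qformE mulmxDl dotmDr. Qed.

Lemma qformN n (M : 'M[R]_n) x : qform (- M) x = - qform M x.
Proof. by rewrite !qformE mulNmx dotmNr. Qed.

Lemma qformB n (M M' : 'M[R]_n) x : qform (M - M') x = qform M x - qform M' x.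
Proof. by rewrite qformD qformN. Qed.

Lemma qformZ n a (M : 'M[R]_n) x : qform (a *: M) x = a * qform M x.
Proof. by rewrite !qformE -scalemxAl dotmZr. Qed.

Lemma qform1 n (x : 'cV[R]_n) : qform 1%:M x = dotm x x.
Proof. by rewrite qformE mul1mx. Qed.

Lemma qform_congr m n (A : 'M[R]_(m, n)) (M : 'M[R]_m) x :
  qform (A^T *m M *m A) x = qform M (A *m x).
Proof. by rewrite !qformE -!mulmxA dotm_mull. Qed.

Lemma qform_sum n I (r : seq I) (F : I -> 'M[R]_n) x :
  qform (\sum_(i <- r) F i) x = \sum_(i <- r) qform (F i) x.
Proof.
elim/big_ind2: _ => [|? ? ? ? <- <-|//]; rewrite ?qformD //.
by rewrite qformE mul0mx dotm0r.
Qed.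

Lemma qform_tr_mul n m (A : 'M[R]_(m, n)) x : qform (A^T *m A) x = dotm (A *m x) (A *m x).
Proof. by rewrite -[A^T]mulmx1 qform_congr qform1. Qed.

Lemma psd_congr m n (A : 'M[R]_(m, n)) (M : 'M[R]_m) :
  psd M -> psd (A^T *m M *m A).
Proof.
move=> [sM pM]; split; first by rewrite !trmx_mul trmxK sM mulmxA.
by move=> x; rewrite qform_congr.
Qed.

Lemma psd_congr_tr m n (A : 'M[R]_(n, m)) (M : 'M[R]_m) :
  psd M -> psd (A *m M *m A^T).
Proof. by move=> /(psd_congr A^T); rewrite trmxK. Qed.

Lemma psdD n (M M' : 'M[R]_n) : psd M -> psd M' -> psd (M + M').
Proof.
move=> [sM pM] [sM' pM']; split; first by rewrite linearD /= sM sM'.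
by move=> x; rewrite qformD addr_ge0.
Qed.

Lemma pd_psd n (M : 'M[R]_n) : pd M -> psd M.
Proof.
move=> [sM pM]; split=> // x; have [->|x0] := eqVneq x 0; first by rewrite qform0x.
exact/ltW/pM.
Qed.

Lemma pd_addl n (M M' : 'M[R]_n) : psd M -> pd M' -> pd (M + M').
Proof.
move=> [sM pM] [sM' pM']; split; first by rewrite linearD /= sM sM'.
by move=> x x0; rewrite qformD; apply: ltr_wpDl; [exact: pM|exact: pM'].
Qed.

Lemma psd_CS n (M : 'M[R]_n) x y : psd M -> bform M x y ^+ 2 <= qform M x * qform M y.
Proof.
move=> [sM pM]; set a := qform M x; set b := bform M x y; set c := qform M y.
have key t : 0 <= a + 2 * (t * b) + t ^+ 2 * c.
  have := pM (x + t *: y); rewrite qformDx // qformZx.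
  by rewrite (bformC _ _ sM) bformZl (bformC _ _ sM).
have c0 : 0 <= c by exact: pM.
have [cz|cn0] := eqVneq c 0.
  have [bz|bn0] := eqVneq b 0; first by rewrite bz cz mulr0 expr0n.
  (* With [c = 0] the expression is affine in [t], and this [t] gives it the value -1. *)
  have := key (- (a + 1) / (2 * b)); rewrite cz mulr0 addr0.
  have -> : 2 * (- (a + 1) / (2 * b) * b) = - (a + 1) by field.
  by lra.
have := key (- b / c); rewrite mulrC.
have -> : (- b / c) * b = - (b ^+ 2) / c by field.
have -> : (- b / c) ^+ 2 * c = b ^+ 2 / c by field.
move=> h; have cgt : 0 < c by rewrite lt_def cn0.
rewrite -subr_ge0; have : 0 <= (a - b ^+ 2 / c) * c by apply: mulr_ge0 => //; lra.
by rewrite mulrBl divfK.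
Qed.

Lemma psd_qform0 n (M : 'M[R]_n) x : psd M -> qform M x = 0 -> M *m x = 0.
Proof.
move=> pM q0; apply: dotm_eq0; have := psd_CS (M *m x) x pM.
rewrite q0 mulr0 bformE => h; apply/eqP; rewrite -sqrf_eq0 eq_le h sqr_ge0 //.
Qed.

Lemma pd_unit n (M : 'M[R]_n) : pd M -> M \in unitmx.
Proof.
move=> [sM pM]; rewrite -row_free_unit -kermx_eq0; apply/eqP/row_matrixP => i.
rewrite row0; set u := row i _; apply/eqP; apply: contraT => u0.
have : u *m M = 0 by rewrite -row_mul mulmx_ker row0.
have u0' : u^T != 0 by rewrite -trmx0 (inj_eq trmx_inj).
by move=> uM; have := pM _ u0'; rewrite /qform trmxK uM mul0mx mxE ltxx.
Qed.

Lemma psd_unit_pd n (M : 'M[R]_n) : psd M -> M \in unitmx -> pd M.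
Proof.
move=> pM uM; split=> [|x x0]; first exact: pM.1.
rewrite lt_def pM.2 andbT; apply: contra_neq x0 => /(psd_qform0 pM) Mx.
by rewrite -[x](mulKmx uM) Mx mulmx0.
Qed.

(** The constant is the Frobenius norm plus 1; the 1 keeps it positive, so that later constants may
    divide by it. *)
Lemma qform_le n (M : 'M[R]_n) : exists2 c, 1 <= c & forall x, `|qform M x| <= c * dotm x x.
Proof.
exists (Num.sqrt (dotm M M) + 1); first by rewrite lerDr sqrtr_ge0.
move=> x; rewrite qformE mulrDl mul1r ler_wpDr ?dotm_ge0 //.
rewrite -(ger0_norm (mulr_ge0 (sqrtr_ge0 _) (dotm_ge0 x))) -ler_sqr ?nnegrE //.
rewrite !real_normK ?num_real //; apply: le_trans (dotm_CS _ _) _.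
rewrite exprMn sqr_sqrtr ?dotm_ge0 // [dotm x x ^+ 2]expr2 mulrCA.
by rewrite ler_wpM2l ?dotm_ge0 // dotm_mulmx_le.
Qed.

(** No eigenvalue is used: with [y = M^-1 x], Cauchy-Schwarz for the form [M] gives
    [|x|^4 <= (x^T M x) (x^T M^-1 x)], and an upper bound [C] for the inverse form yields the lower
    bound [1 / C]. *)
Lemma pd_lower n (M : 'M[R]_n) : pd M ->
  exists2 c, 0 < c & forall x, c * dotm x x <= qform M x.
Proof.
move=> pM; have uM := pd_unit pM; have [C C1 hC] := qform_le (invmx M).
have C0 : 0 < C by apply: lt_le_trans C1.
exists C^-1; first by rewrite invr_gt0.
move=> x; rewrite ler_pdivrMl //; have [->|x0] := eqVneq x 0.
  by rewrite dotm0l qform0x mulr0.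
have xx : 0 < dotm x x by rewrite lt_def dotm_ge0 andbT; apply: contra_neq x0 => /dotm_eq0.
rewrite -(ler_pM2l xx); set y := invmx M *m x.
have -> : dotm x x = bform M x y by rewrite bformE mulKVmx.
rewrite -expr2; apply: le_trans (psd_CS _ _ (pd_psd pM)) _.
rewrite mulrCA mulrA [X in _ <= X]mulrC [X in _ <= _ * X]mulrC.
apply: ler_wpM2l; first exact: (pd_psd pM).2.
rewrite {1}bformE mulKVmx //.
have -> : qform M y = qform (invmx M) x by rewrite !qformE mulKVmx // dotmC.
by rewrite mulrC; exact: le_trans (ler_norm _) (hC x).
Qed.

Lemma qform_delta n (M : 'M[R]_n) i : qform M (delta_mx i 0) = M i i.
Proof.
rewrite /qform trmx_delta -rowE -colE !mxE //.
Qed.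

Lemma tr_mul_cv n (x y : 'cV[R]_n) : x^T *m y = (dotm x y)%:M.
Proof. by rewrite [LHS]mx11_scalar /dotm /mxtrace big_ord1. Qed.

(* Peeling off the rank-one matrix that kills one more diagonal entry writes M
   as a sum of matrices y y^T. *)
Lemma psd_tr_mul_ge0 n (M N : 'M[R]_n) : psd M -> psd N -> 0 <= \tr (N *m M).
Proof.
move=> pM pN.
suff H k (M' : 'M[R]_n) : psd M' -> (forall i : 'I_n, (k <= i)%N -> M' i i = 0) ->
    0 <= \tr (N *m M').
  by apply: (H n) => // i; rewrite leqNgt ltn_ord.
elim: k M' => [|k IH] {M pM}M pM M0.
  suff -> : M = 0 by rewrite mulmx0 mxtrace0.
  apply/matrixP => i j; rewrite mxE.
  have := psd_CS (delta_mx i 0) (delta_mx j 0) pM.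
  rewrite !qform_delta M0 // mul0r bformE.
  have -> : dotm (delta_mx i (0 : 'I_1)) (M *m delta_mx j 0) = M i j.
    by rewrite /dotm trmx_delta -rowE -colE /mxtrace big_ord1 !mxE.
  by move=> h; apply/eqP; rewrite -sqrf_eq0 eq_le h sqr_ge0.
have [kn|kn] := ltnP k n; last first.
  by apply: IH => // i ki; have := leq_trans kn ki; rewrite leqNgt ltn_ord.
pose o := Ordinal kn; pose c := M o o; pose e : 'cV[R]_n := delta_mx o 0.
have c0 : 0 <= c by rewrite /c -qform_delta; exact: pM.2.
have [cz|cn0] := eqVneq c 0.
  apply: IH => // i; rewrite leq_eqVlt => /orP[/eqP ki|]; last exact: M0.
  by rewrite (_ : i = o) //; exact/val_inj.
pose y := M *m e; pose M' := M - c^-1 *: (y *m y^T).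
have qM' x : qform M' x = qform M x - c^-1 * bform M x e ^+ 2.
  rewrite qformB qformZ bformE -/y; congr (_ - _ * _).
  rewrite qformE dotmC -mulmxA.
  by rewrite tr_mul_cv mul_mx_scalar dotmZl expr2 (dotmC y).
have pM' : psd M'.
  split=> [|x].
    by rewrite /M' linearB linearZ /= trmx_mul trmxK pM.1.
  rewrite qM' subr_ge0 mulrC ler_pdivrMr ?lt_def ?cn0 //.
  apply: le_trans (psd_CS _ _ pM) _; by rewrite qform_delta.
have dM' i : M' i i = M i i - c^-1 * bform M (delta_mx i 0) e ^+ 2.
  by rewrite -!qform_delta qM'.
have -> : M = M' + c^-1 *: (y *m y^T) by rewrite subrK.
rewrite mulmxDr mxtraceD -scalemxAr mxtraceZ; apply: addr_ge0.
  apply: IH => // i; rewrite leq_eqVlt => /orP[/eqP ki|ki].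
    rewrite (_ : i = o); last exact/val_inj.
    by rewrite dM' -/e -/c -[bform M e e]/(qform M e) qform_delta -/c expr2 mulKf // subrr.
  apply/eqP; rewrite eq_le -{2}qform_delta pM'.2 andbT dM' M0 // sub0r oppr_le0.
  by rewrite mulr_ge0 ?invr_ge0 ?sqr_ge0.
apply: mulr_ge0; rewrite ?invr_ge0 // mulmxA mxtrace_mulC mulmxA.
by have := pN.2 y; rewrite /qform /mxtrace big_ord1.
Qed.

Lemma psd_tr_ge0 n (M : 'M[R]_n) : psd M -> 0 <= \tr M.
Proof.
by move=> pM; rewrite /mxtrace; apply: sumr_ge0 => i _; rewrite -qform_delta; exact: pM.2.
Qed.

(** This is [psd_tr_mul_ge0] applied to [|x|^2 I - x x^T], which is positive semidefinite by
    Cauchy-Schwarz. *)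
Lemma psd_qform_le_tr n (M : 'M[R]_n) x : psd M -> qform M x <= \tr M * dotm x x.
Proof.
move=> pM; rewrite -subr_ge0.
have p1 : psd (dotm x x *: 1%:M - x *m x^T).
  split; first by rewrite linearB linearZ /= trmx1 trmx_mul trmxK.
  move=> z; rewrite qformB qformZ qform1 subr_ge0.
  rewrite -[x *m x^T]/(x *m x^T) -{1}[x]trmxK qform_tr_mul.
  rewrite tr_mul_cv; apply: le_trans (dotm_CS x z).
  by rewrite dotmE !big_ord1 !mxE eqxx mulr1n expr2.
have := psd_tr_mul_ge0 p1 pM.
rewrite mulmxBr mxtraceD linearN /= -scalemxAr mulmx1 mxtraceZ mulrC.
suff -> : \tr (M *m (x *m x^T)) = qform M x by [].
by rewrite mulmxA mxtrace_mulC qformE /dotm mulmxA.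
Qed.

End Quadratic.

(** * Vectorization, and the discrete Lyapunov equation as a linear system *)

Section Vectorization.
Context {R : realType}.

Lemma sum_mxtens m n (F : 'I_(m * n) -> R) :
  \sum_k F k = \sum_(i < m) \sum_(j < n) F (mxtens_index (i, j)).
Proof.
rewrite pair_big /= (reindex (fun ij : 'I_m * 'I_n => mxtens_index ij)) /=.
  by apply: eq_bigr => -[].
by exists (@mxtens_unindex m n) => k _; rewrite ?mxtens_indexK ?mxtens_unindexK.
Qed.

Lemma vecE m n (X : 'M[R]_(m, n)) i j : vec X (mxtens_index (j, i)) 0 = X i j.
Proof. by rewrite mxE mxtens_indexK. Qed.

Definition devec m n (x : 'cV[R]_(n * m)) : 'M[R]_(m, n) :=
  \matrix_(i, j) x (mxtens_index (j, i)) 0.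

Lemma vecK m n : cancel (@vec R m n) (@devec m n).
Proof. by move=> X; apply/matrixP => i j; rewrite mxE vecE. Qed.

Lemma devecK m n : cancel (@devec m n) (@vec R m n).
Proof.
move=> x; apply/colP => k; rewrite -(mxtens_unindexK k).
by case: (mxtens_unindex k) => j i; rewrite vecE mxE.
Qed.

Lemma vecD m n (X Y : 'M[R]_(m, n)) : vec (X + Y) = vec X + vec Y.
Proof. by apply/colP => k; rewrite !mxE. Qed.

Lemma vecB m n (X Y : 'M[R]_(m, n)) : vec (X - Y) = vec X - vec Y.
Proof. by apply/colP => k; rewrite !mxE. Qed.

Lemma dotm_vec m n (X Y : 'M[R]_(m, n)) : dotm (vec X) (vec Y) = dotm X Y.
Proof.
rewrite !dotmE sum_mxtens exchange_big; do 2![apply: eq_bigr => ? _].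
by rewrite big_ord1 !vecE.
Qed.

Lemma vec_mul m n p r (A : 'M[R]_(m, n)) (X : 'M[R]_(n, p)) (B : 'M[R]_(p, r)) :
  vec (A *m X *m B) = tensmx B^T A *m vec X.
Proof.
apply/colP => k; rewrite -(mxtens_unindexK k).
case: (mxtens_unindex k) => j i; rewrite vecE [RHS]mxE sum_mxtens mxE.
apply: eq_bigr => l _; rewrite mxE mulr_suml; apply: eq_bigr => h _.
by rewrite tensmxE vecE !mxE; ring.
Qed.

Definition lyap_mx n (A : 'M[R]_n) : 'M[R]_(n * n) := 1%:M - tensmx A A.

(* Cramer's rule, so that the solution is visibly a rational function of the
   entries of [A] and [N]. *)
Definition lyap_sol n (A N : 'M[R]_n) : 'M[R]_n :=
  devec ((\det (lyap_mx A))^-1 *: (\adj (lyap_mx A) *m vec N)).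

Lemma lyap_mx_vec n (A X : 'M[R]_n) :
  lyap_mx A *m vec X = vec (X - A *m X *m A^T).
Proof. by rewrite vecB vec_mul trmxK mulmxBl mul1mx. Qed.

Lemma lyap_solP n (A N : 'M[R]_n) : lyap_mx A \in unitmx ->
  lyap_sol A N = N + A *m lyap_sol A N *m A^T.
Proof.
move=> uA; have /eqP := lyap_mx_vec A (lyap_sol A N).
rewrite devecK -scalemxAr mulmxA mul_mx_adj mul_scalar_mx scalerA mulVf; last first.
  by rewrite -unitfE -unitmxE.
rewrite scale1r => /eqP /(can_inj (@vecK n n)) h.
by apply/eqP; rewrite -subr_eq -h.
Qed.

End Vectorization.

(** * Pseudoinverse of a matrix of full row rank *)

Section Pseudoinverse.
Context {R : realType}.

(** [X = S^T (S S^T)^-1] satisfies the Penrose equations, so the choice in [mp_pinv] does not fall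
    back on its default; any [Y] with [S Y S = S] then satisfies [S Y = S Y S X = S X = 1]. *)
Lemma mp_pinv_full_row m n (S : 'M[R]_(m, n)) :
  (forall x : 'cV[R]_m, S^T *m x = 0 -> x = 0) -> S *m mp_pinv S = 1%:M.
Proof.
move=> Sinj; have pSS : pd (S *m S^T).
  split; first by rewrite trmx_mul trmxK.
  move=> x x0; rewrite -{1}[S]trmxK qform_tr_mul lt_def dotm_ge0 andbT.
  by apply: contra_neq x0 => /dotm_eq0 /Sinj.
have u := pd_unit pSS; pose X := S^T *m invmx (S *m S^T).
have SX : S *m X = 1%:M by rewrite mulmxA mulmxV.
have pX : penrose S X.
  split; rewrite ?SX ?mul1mx ?trmx1 //; first by rewrite -mulmxA SX mulmx1.
  by rewrite /X !trmx_mul trmx_inv trmxK trmx_mul trmxK mulmxA.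
have [h _ _ _] : penrose S (mp_pinv S) by exact: (xgetPex _ (ex_intro _ X pX)).
by rewrite -[LHS]mulmx1 -SX mulmxA h.
Qed.

End Pseudoinverse.

(** * Scalar affine recursions *)

Section ScalarRecursion.
Context {R : realType}.

Lemma affine_recursion_le (a : nat -> R) r c N : 0 <= r ->
  (forall t, (N <= t)%N -> a t.+1 <= r * a t + (1 - r) * c) ->
  forall k, a (N + k)%N <= c + r ^+ k * (a N - c).
Proof.
move=> r0 h; elim=> [|k IH]; first by rewrite addn0 expr0 mul1r addrC subrK.
rewrite addnS; apply: le_trans (h _ (leq_addr _ _)) _.
have := ler_wpM2l r0 IH; rewrite exprS; lra.
Qed.

Lemma affine_recursion_limit (a : nat -> R) r c e N : 0 <= r < 1 -> 0 < e ->
  (forall t, (N <= t)%N -> a t.+1 <= r * a t + (1 - r) * c) ->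
  \forall t \near \oo, a t <= c + e.
Proof.
move=> /andP[r0 r1] e0 h; have rc : r ^+ k @[k --> \oo] --> 0 by apply: cvg_expr; rewrite ger0_norm.
have M0 : 0 < `|a N - c| + 1 by rewrite ltr_wpDl.
have [K _ HK] := cvgr0_norm_lt _ rc _ (divr_gt0 e0 M0).
 exists (N + K)%N => // t /= Kt.
have Nt : (N <= t)%N := leq_trans (leq_addr _ _) Kt.
rewrite -(subnKC Nt); apply: le_trans (affine_recursion_le r0 h _) _.
rewrite lerD2l; apply: le_trans (ler_norm _) _.
have /HK : (K <= t - N)%N by rewrite leq_subRL.
rewrite normrM ltr_pdivlMr // => h'; apply/ltW; apply: le_lt_trans h'.
by rewrite ler_wpM2l // lerDl.
Qed.

(** Once [b] is below [(1 - r) e / 2], the recursion is affine with fixed point [e / 2], which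
    leaves [e / 2] for the transient. *)
Lemma perturbed_recursion_cvg0 (a b : nat -> R) r : 0 <= r < 1 ->
  (forall t, 0 <= a t) -> (forall t, a t.+1 <= r * a t + b t) ->
  b t @[t --> \oo] --> 0 -> a t @[t --> \oo] --> 0.
Proof.
move=> /andP[r0 r1] a0 h b0; apply/cvgrPdist_le => /= e e0.
have s0 : 0 < (1 - r) * (e / 2) by rewrite mulr_gt0 ?divr_gt0 ?subr_gt0.
have [N _ HN] := cvgr0_norm_le _ b0 _ s0.
have e20 : 0 < e / 2 by rewrite divr_gt0.
have [] := @affine_recursion_limit a r (e / 2) (e / 2) N _ e20.
- by rewrite r0.
- by move=> t Nt; apply: le_trans (h t) _; rewrite lerD2l; apply: le_trans (ler_norm _) (HN _ Nt).
- move=> M _ HM; exists M => // t /= /HM; rewrite sub0r normrN ger0_norm // => /le_trans; apply.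
  by lra.
Qed.

End ScalarRecursion.

(** * Powers of a matrix annihilated by a polynomial *)

Section Powers.
Context {R : realType}.
Local Notation C := R[i].

Definition mxcvg m n (u : nat -> 'M[R]_(m, n)) (l : 'M[R]_(m, n)) : Prop :=
  forall i j, u t i j @[t --> \oo] --> l i j.

Lemma normc_ge0 (z : C) : 0 <= Normc.normc z.
Proof. by case: z => a b; exact: sqrtr_ge0. Qed.

(** Takes the place of the Jordan form. With [p] the product over the remaining roots, [A^t p(A) B]
    satisfies a recursion with scalar factor [z] and perturbation [A^t (A - z) p(A) B], which tends
    to 0 by hypothesis; so the roots can be removed one at a time. *)
Lemma poly_annihilated_cvg0 n (A : 'M[C]_n.+1) (s : seq C) (B : 'M[C]_n.+1) :
  (forall z, z \in s -> Normc.normc z < 1) ->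
  (forall i j, Normc.normc ((A ^+ t * horner_mx A (\prod_(z <- s) ('X - z%:P)) * B) i j)
     @[t --> \oo] --> (0 : R)) ->
  forall i j, Normc.normc ((A ^+ t * B) i j) @[t --> \oo] --> (0 : R).
Proof.
elim: s B => [|z s IH] B sz h.
  by move=> i j; have := h i j; rewrite big_nil rmorph1; under eq_fun do rewrite mulr1.
apply: IH => [x xs|i j]; first by apply: sz; rewrite inE xs orbT.
have z1 : Normc.normc z < 1 by apply: sz; rewrite inE eqxx.
set p := \prod_(_ <- s) _; set a := fun t : nat => _.
apply: (perturbed_recursion_cvg0 (r := Normc.normc z)
  (b := fun t => Normc.normc ((A ^+ t * horner_mx A (('X - z%:P) * p) * B) i j))).
- by rewrite z1 andbT normc_ge0.
- by move=> t; exact: normc_ge0.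
- move=> t; rewrite /a -Normc.normcM addrC.
  have -> : (A ^+ t.+1 * horner_mx A p * B) i j =
      (A ^+ t * horner_mx A (('X - z%:P) * p) * B) i j + z * (A ^+ t * horner_mx A p * B) i j.
    rewrite rmorphM rmorphB /= horner_mx_X horner_mx_C.
    have -> : A ^+ t.+1 * horner_mx A p * B =
        A ^+ t * ((A - z%:M) * horner_mx A p) * B + z *: (A ^+ t * horner_mx A p * B).
      rewrite mulrBl mulrBr mulrBl !mulrA -exprSr.
      rewrite -[A ^+ t * z%:M]/(A ^+ t *m z%:M) mul_mx_scalar.
      by rewrite -!scalerAl subrK.
    by rewrite !mxE.
  exact: le_normcD.
- by have := h i j; rewrite big_cons.
Qed.

Definition schur n (A : 'M[R]_n) : Prop := forall i j, (A ^+ t) i j @[t --> \oo] --> (0 : R).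

End Powers.

(** * Spectral radius, convergence of powers and Lyapunov certificates *)

Section Stability.
Context {R : realType}.
Local Notation toC := (map_mx (real_complex R)).

Lemma mxexpS n (A : 'M[R]_n) t : A ^+ t.+1 = A *m A ^+ t.
Proof. by rewrite exprS. Qed.

Lemma mxexpSr n (A : 'M[R]_n) t : A ^+ t.+1 = A ^+ t *m A.
Proof. by rewrite exprSr. Qed.

Lemma trmx_exp n (A : 'M[R]_n) t : (A ^+ t)^T = A^T ^+ t.
Proof. by elim: t => [|t IH]; rewrite ?expr0 ?trmx1 // mxexpS trmx_mul IH mxexpSr. Qed.

Lemma schur_tr n (A : 'M[R]_n) : schur A -> schur A^T.
Proof. by move=> h i j; under eq_fun do rewrite -trmx_exp mxE; exact: h. Qed.

Lemma normc_real (x : R) : Normc.normc (real_complex R x) = `|x|.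
Proof. by rewrite /= expr0n addr0 sqrtr_sqr. Qed.

Lemma char_poly_roots n (A : 'M[R]_n) : exists rs : seq R[i],
  char_poly (toC A) = \prod_(z <- rs) ('X - z%:P) /\
  forall z, eigenvalue (toC A) z = (z \in rs).
Proof.
have [rs] := closed_field_poly_normal (char_poly (toC A)).
have /monicP -> := char_poly_monic (toC A); rewrite scale1r => E.
exists rs; split=> // z; by rewrite eigenvalue_root_char E root_prod_XsubC.
Qed.

(** By Cayley-Hamilton the product over all roots of the characteristic polynomial annihilates [A],
    so [poly_annihilated_cvg0] starts from the zero sequence. *)
Lemma eigenvalue_lt1_schur n (A : 'M[R]_n) :
  (forall z, eigenvalue (toC A) z -> Normc.normc z < 1) -> schur A.
Proof.
case: n A => [|n] A eA; first by move=> [].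
have [rs [E rsP]] := char_poly_roots A.
have h := @poly_annihilated_cvg0 R n (toC A) rs 1 _ _.
move=> i j; apply: norm_cvg0.
have E1 t : `|(A ^+ t) i j| = Normc.normc ((toC A ^+ t * 1) i j).
  by rewrite mulr1 -rmorphXn mxE normc_real.
under eq_fun do rewrite E1; apply: h => [z|k l]; first by rewrite -rsP => /eA.
rewrite -E Cayley_Hamilton; under eq_fun do rewrite mulr0 mul0r mxE Normc.normc0.
exact: cvg_cst.
Qed.

(** The set under the [sup] is bounded by the sum of the moduli of the roots of the characteristic
    polynomial, so the [sup] does dominate each modulus. *)
Lemma spectral_radius_eigenvalue n (A : 'M[R]_n) z :
  spectral_radius A < 1 -> eigenvalue (toC A) z -> Normc.normc z < 1.
Proof.
move=> A1 zA; apply: le_lt_trans A1; apply: ub_le_sup; last by exists z.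
have [rs [_ rsP]] := char_poly_roots A.
exists (\sum_(x <- rs) Normc.normc x) => _ [x /= + <-]; rewrite rsP => xrs.
rewrite (perm_big _ (perm_to_rem xrs)) big_cons lerDl.
by apply: sumr_ge0 => *; exact: normc_ge0.
Qed.

(** A quadratic Lyapunov function with contraction rate [r]: a real, quantitative form of stability
    that tolerates perturbations and whose rate bounds all eigenvalues at once. *)
Definition lyap_cert n (A : 'M[R]_n) : Prop := exists (Z : 'M[R]_n) (r : R),
  [/\ Z^T = Z, forall x, dotm x x <= qform Z x, 0 <= r < 1 &
      forall x, qform Z (A *m x) <= r * qform Z x].

(** A truncated sum of [(A^s)^T A^s] suffices, so no series has to converge: it telescopes to
    [Z(A x) = Z(x) - |x|^2 + |A^m x|^2], and [m] is taken so large that the last term is at most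
    [|x|^2 / 2]. *)
Lemma schur_lyap_cert n (A : 'M[R]_n) : schur A -> lyap_cert A.
Proof.
move=> sA.
have [m m0 hm] : exists2 m : nat, (0 < m)%N & dotm (A ^+ m) (A ^+ m) <= 2^-1.
  have h : dotm (A ^+ t) (A ^+ t) @[t --> \oo] --> (0 : R).
    under eq_fun do rewrite dotmE.
    have E : \sum_(i < n) \sum_(j < n) (0 * 0) = 0 :> R.
      by rewrite big1 // => *; rewrite big1 // => *; rewrite mul0r.
    suff : \sum_i \sum_j (A ^+ t) i j * (A ^+ t) i j @[t --> \oo] --> \sum_(i < n) \sum_(j < n) (0 * 0 : R).
      by rewrite E.
    by do 2![apply: cvg_big => [|? _]; first exact: add_continuous]; exact: cvgM.
  have [N _ HN] := cvgr0_norm_le _ h 2^-1 ltac:(by []).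
  (* The shift to [N.+1] makes [m] positive, so that the sum contains the term [|x|^2]. *)
  by exists N.+1 => //; apply: le_trans (ler_norm _) (HN _ (leqnSn _)).
pose Z := \sum_(s < m) (A ^+ s)^T *m A ^+ s.
have sZ : Z^T = Z.
  by rewrite linear_sum /=; apply: eq_bigr => s _; rewrite trmx_mul trmxK.
have qZ x : qform Z x = \sum_(s < m) dotm (A ^+ s *m x) (A ^+ s *m x).
  by rewrite qform_sum; apply: eq_bigr => s _; rewrite qform_tr_mul.
have Z1 x : dotm x x <= qform Z x.
  rewrite qZ; case: m m0 {hm Z sZ qZ} => // m _.
  rewrite big_ord_recl expr0 mul1mx lerDl; apply: sumr_ge0 => *; exact: dotm_ge0.
have [c c1 hc] := qform_le Z; have c0 : 0 < c by apply: lt_le_trans c1.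
(* [Z(x) <= c |x|^2] turns the loss [|x|^2 / 2] into a loss of at least [Z(x) / (2 c)]. *)
exists Z, (1 - (2 * c)^-1); split=> //.
  rewrite subr_ge0 ltrBlDr ltrDl invr_gt0 mulr_gt0 // andbT invf_le1 ?mulr_gt0 //.
  by lra.
move=> x; have -> : qform Z (A *m x) = qform Z x - dotm x x + dotm (A ^+ m *m x) (A ^+ m *m x).
  rewrite !qZ; case: m m0 {hm Z sZ qZ Z1 hc} => // m _.
  rewrite big_ord_recr [in RHS]big_ord_recl /= expr0 mul1mx.
  under eq_bigr do rewrite mulmxA -mxexpSr.
  by rewrite [in LHS]mulmxA -mxexpSr; ring.
have h1 : dotm (A ^+ m *m x) (A ^+ m *m x) <= 2^-1 * dotm x x.
  by apply: le_trans (dotm_mulmx_le _ _) _; rewrite ler_wpM2r ?dotm_ge0.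
have h2 : (2 * c)^-1 * qform Z x <= 2^-1 * dotm x x.
  rewrite invfM -mulrA ler_wpM2l ?invr_ge0 // mulrC ler_pdivrMr // mulrC.
  exact: le_trans (ler_norm _) (hc x).
by lra.
Qed.

Lemma lyap_cert_schur n (A : 'M[R]_n) : lyap_cert A -> schur A.
Proof.
move=> [Z [r [sZ Z1 /andP[r0 r1] hr]]].
have b t x : dotm (A ^+ t *m x) (A ^+ t *m x) <= r ^+ t * qform Z x.
  apply: le_trans (Z1 _) _; elim: t => [|t IH]; first by rewrite !expr0 mul1r mul1mx.
  by rewrite mxexpS -mulmxA exprS -mulrA; apply: le_trans (hr _) _; rewrite ler_wpM2l.
move=> i j; have rc : r ^+ k @[k --> \oo] --> 0 by apply: cvg_expr; rewrite ger0_norm.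
pose q := qform Z (delta_mx j 0).
have rq : r ^+ k * q @[k --> \oo] --> 0.
  by rewrite -[X in _ --> X](mul0r q); apply: cvgMl.
have e t : (A ^+ t) i j ^+ 2 <= r ^+ t * q.
  apply: le_trans (b t _); apply: le_trans (dotm_entry _ i 0).
  by rewrite -colE mxE.
apply/cvgrPdist_lt => /= eps e0; have [N _ HN] := cvgr0_norm_lt _ rq _ (exprn_gt0 2 e0).
exists N => // t /= Nt; rewrite sub0r normrN.
rewrite -(ltr_pXn2r (n := 2)) ?nnegrE ?(ltW e0) // real_normK ?num_real //.
exact: le_lt_trans (e t) (le_lt_trans (ler_norm _) (HN _ Nt)).
Qed.

(** For a left eigenvector [a + i b], the matrix [A^T] acts on the pair [(a, b)] as a rotation
    scaled by [|z|], so the cross terms cancel in [Z(A^T a) + Z(A^T b) = |z|^2 (Z(a) + Z(b))]. The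
    common bound [sqrt r] keeps the supremum strictly below 1. *)
Lemma lyap_cert_tr_spectral_radius n (A : 'M[R]_n) :
  lyap_cert A^T -> spectral_radius A < 1.
Proof.
move=> [Z [r [sZ Z1 /andP[r0 r1] hr]]].
have s1 : Num.sqrt r < 1 by rewrite -sqrtr1 ltr_sqrt.
apply: le_lt_trans s1; rewrite /spectral_radius.
(* Without eigenvalues (dimension 0) the [sup] of the empty set is 0. *)
have [->|/set0P ne] := eqVneq [set z | eigenvalue (toC A) z] set0.
  by rewrite image_set0 sup0 sqrtr_ge0.
apply: ge_sup => [|_ [z /eigenvalueP [v vA v0] <-]].
  by case: ne => z hz; exists (Normc.normc z), z.
pose a : 'cV[R]_n := \col_i complex.Re (v 0 i).
pose b : 'cV[R]_n := \col_i complex.Im (v 0 i).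
have vE i : v 0 i = Complex (a i 0) (b i 0) by rewrite !mxE; case: (v 0 i).
case: z vA => x y vA.
have key i : ((A^T *m a) i 0 = x * a i 0 - y * b i 0) /\ ((A^T *m b) i 0 = x * b i 0 + y * a i 0).
  have : (v *m toC A) 0 i = (Complex x y *: v) 0 i by rewrite vA.
  rewrite [RHS]mxE vE mxE.
  have -> : \sum_j v 0 j * toC A j i = Complex ((A^T *m a) i 0) ((A^T *m b) i 0).
    rewrite !mxE; elim/big_ind3: _ => [//|? ? ? ? ? ? -> -> //|k _].
    by rewrite vE !mxE; apply/eqP; rewrite eq_complex /=; apply/andP; split; apply/eqP; ring.
  by case=> -> ->.
have ea : A^T *m a = x *: a + (- y) *: b.
  by apply/colP => i; rewrite (key i).1 !mxE; ring.
have eb : A^T *m b = y *: a + x *: b.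
  by apply/colP => i; rewrite (key i).2 !mxE; ring.
have := lerD (hr a) (hr b); rewrite ea eb !qformDx // !qformZx !(bformZl, bformC (_ *: _) (_ *: _) sZ).
rewrite !(bformC _ (_ *: _) sZ) !bformZl => h.
have q0 : 0 < qform Z a + qform Z b.
  apply: lt_le_trans (lerD (Z1 a) (Z1 b)); rewrite lt_def addr_ge0 ?dotm_ge0 // andbT.
  apply: contra_neq v0 => /eqP; rewrite paddr_eq0 ?dotm_ge0 // => /andP[/eqP /dotm_eq0 a0 /eqP /dotm_eq0 b0].
  by apply/rowP => i; rewrite vE a0 b0 !mxE.
change (Num.sqrt (x ^+ 2 + y ^+ 2) <= Num.sqrt r).
rewrite ler_sqrt // -(ler_pM2r q0) [X in _ <= X]mulrDr; apply: le_trans h.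
by rewrite le_eqVlt; apply/orP; left; apply/eqP; ring.
Qed.

End Stability.

(** * Discrete Lyapunov equations with a stable matrix *)

Section Lyapunov.
Context {R : realType}.

Lemma qform_congr_tr m n (A : 'M[R]_(n, m)) (M : 'M[R]_m) x :
  qform (A *m M *m A^T) x = qform M (A^T *m x).
Proof. by rewrite -qform_congr trmxK. Qed.

Lemma spectral_radius_schur n (A : 'M[R]_n) : spectral_radius A < 1 -> schur A.
Proof. by move=> h; apply: eigenvalue_lt1_schur => z; exact: spectral_radius_eigenvalue. Qed.

Lemma schur_spectral_radius n (A : 'M[R]_n) : schur A -> spectral_radius A < 1.
Proof. by move=> /schur_tr /schur_lyap_cert /lyap_cert_tr_spectral_radius. Qed.

Lemma schurP n (A : 'M[R]_n) : spectral_radius A < 1 <-> schur A.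
Proof. by split; [exact: spectral_radius_schur | exact: schur_spectral_radius]. Qed.

Lemma mxcvg_mul m n p (u : nat -> 'M[R]_(m, n)) (v : nat -> 'M[R]_(n, p)) l k :
  mxcvg u l -> mxcvg v k -> mxcvg (fun t => u t *m v t) (l *m k).
Proof.
move=> hu hv i j; under eq_fun do rewrite mxE; rewrite mxE.
by apply: cvg_big => [|? _]; [exact: add_continuous | exact: cvgM].
Qed.

Lemma mxcvg_add m n (u v : nat -> 'M[R]_(m, n)) l k :
  mxcvg u l -> mxcvg v k -> mxcvg (fun t => u t + v t) (l + k).
Proof. by move=> hu hv i j; under eq_fun do rewrite mxE; rewrite mxE; exact: cvgD. Qed.

Lemma mxcvg_cst m n (l : 'M[R]_(m, n)) : mxcvg (fun=> l) l.
Proof. by move=> i j; exact: cvg_cst. Qed.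

Arguments mxcvg_cst {m n} l.

Lemma mxcvg_tr m n (u : nat -> 'M[R]_(m, n)) l :
  mxcvg u l -> mxcvg (fun t => (u t)^T) l^T.
Proof. by move=> hu i j; under eq_fun do rewrite mxE; rewrite mxE; exact: hu. Qed.

Lemma mxcvg_trace n (u : nat -> 'M[R]_n) l : mxcvg u l -> \tr (u t) @[t --> \oo] --> \tr l.
Proof. by move=> hu; apply: cvg_big => [|? _]; [exact: add_continuous | exact: hu]. Qed.

Lemma mxcvg_unique m n (u : nat -> 'M[R]_(m, n)) l k : mxcvg u l -> mxcvg u k -> l = k.
Proof.
move=> hl hk; apply/matrixP => i j.
by rewrite -(cvg_lim _ (hl i j)) // -(cvg_lim _ (hk i j)).
Qed.

Lemma schur_mxcvg n (A : 'M[R]_n) : schur A -> mxcvg (fun t => A ^+ t) 0.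
Proof. by move=> h i j; rewrite mxE; exact: h. Qed.

Lemma schur_congr_cvg0 n (A X : 'M[R]_n) : schur A ->
  mxcvg (fun t => A ^+ t *m X *m (A ^+ t)^T) 0.
Proof.
move=> h; have hA := schur_mxcvg h.
have := mxcvg_mul (mxcvg_mul hA (mxcvg_cst X)) (mxcvg_tr hA).
by rewrite mul0mx mul0mx.
Qed.

Lemma iter_congr n (A : 'M[R]_n) (D : nat -> 'M[R]_n) :
  (forall t, D t.+1 = A *m D t *m A^T) -> forall t, D t = A ^+ t *m D 0 *m (A ^+ t)^T.
Proof.
move=> hD; elim=> [|t IH]; first by rewrite expr0 mul1mx trmx1 mulmx1.
by rewrite hD IH mxexpS trmx_mul !mulmxA.
Qed.

Lemma lyap_homogeneous n (A X : 'M[R]_n) : schur A -> X = A *m X *m A^T -> X = 0.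
Proof.
move=> sA hX; have h := iter_congr (D := fun=> X) (fun=> hX).
have := schur_congr_cvg0 X sA; have -> : (fun t => A ^+ t *m X *m (A ^+ t)^T) = fun=> X.
  by apply/funext => t; rewrite -h.
by move=> /(mxcvg_unique (mxcvg_cst X)).
Qed.

Lemma lyap_uniq n (A N X Y : 'M[R]_n) : schur A ->
  X = N + A *m X *m A^T -> Y = N + A *m Y *m A^T -> X = Y.
Proof.
move=> sA hX hY; apply/eqP; rewrite -subr_eq0; apply/eqP/(lyap_homogeneous sA).
by rewrite mulmxBr mulmxBl {1}hX {1}hY opprD addrACA subrr add0r.
Qed.

(** A kernel vector is the vectorization of a solution of the homogeneous Lyapunov equation. The
    transposes only convert the left kernel [kermx] into a right kernel. *)
Lemma lyap_mx_unit n (A : 'M[R]_n) : schur A -> lyap_mx A \in unitmx.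
Proof.
move=> sA; rewrite -unitmx_tr -row_free_unit -kermx_eq0; apply/eqP/row_matrixP => i.
rewrite row0; set u := row i _.
have uM : u *m (lyap_mx A)^T = 0 by rewrite -row_mul mulmx_ker row0.
apply: trmx_inj; rewrite trmx0.
have : lyap_mx A *m u^T = 0 by rewrite -[lyap_mx A]trmxK -trmx_mul uM trmx0.
rewrite -[u^T]devecK lyap_mx_vec => h.
have /eqP : vec (devec u^T - A *m devec u^T *m A^T) = vec 0.
  by rewrite h; apply/colP => k; rewrite !mxE.
move=> /eqP /(can_inj (@vecK _ _ _)) /eqP; rewrite subr_eq0 => /eqP /(lyap_homogeneous sA) ->.
by apply/colP => k; rewrite !mxE.
Qed.

Lemma lyap_sol_eq n (A N : 'M[R]_n) : schur A ->
  lyap_sol A N = N + A *m lyap_sol A N *m A^T.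
Proof. by move=> /lyap_mx_unit; exact: lyap_solP. Qed.

Lemma lyap_solE n (A N X : 'M[R]_n) : schur A ->
  X = N + A *m X *m A^T -> X = lyap_sol A N.
Proof. by move=> sA hX; apply: (lyap_uniq sA hX); exact: lyap_sol_eq. Qed.

Lemma lyap_sol_sym n (A N : 'M[R]_n) : schur A -> N^T = N -> (lyap_sol A N)^T = lyap_sol A N.
Proof.
move=> sA sN; apply: lyap_solE => //; rewrite {1}lyap_sol_eq //.
by rewrite linearD /= !trmx_mul trmxK sN mulmxA.
Qed.

(** Along [(A^t)^T x] the form of the solution is nonincreasing in [t] and tends to 0, so its
    initial value is nonnegative. *)
Lemma lyap_sol_psd n (A N : 'M[R]_n) : schur A -> psd N -> psd (lyap_sol A N).
Proof.
move=> sA pN; set X := lyap_sol A N; have sX : X^T = X by apply: lyap_sol_sym; rewrite ?pN.1.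
split=> // x.
have le t : qform X ((A ^+ t)^T *m x) <= qform X x.
  elim: t => [|t IH]; first by rewrite expr0 trmx1 mul1mx.
  apply: le_trans IH; rewrite {2}/X lyap_sol_eq // -/X qformD.
  rewrite qform_congr_tr mulmxA -trmx_mul -mxexpSr lerDr.
  exact: pN.2.
have c := schur_congr_cvg0 X sA.
have := mxcvg_mul (mxcvg_mul (mxcvg_cst x^T) c) (mxcvg_cst x).
rewrite mulmx0 mul0mx => /(_ 0 0); rewrite mxE => cv.
rewrite -(cvg_lim _ cv) //; apply: limr_le; first by apply: cvgP cv.
by apply: nearW => t; have := le t; rewrite /qform trmx_mul trmxK !mulmxA.
Qed.

Lemma lyap_sol_ge n (A N : 'M[R]_n) x : schur A -> psd N ->
  qform N x <= qform (lyap_sol A N) x.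
Proof.
move=> sA pN; rewrite {1}lyap_sol_eq // qformD lerDl.
by rewrite qform_congr_tr; exact: (lyap_sol_psd sA pN).2.
Qed.

Lemma lyap_sol_pd n (A N : 'M[R]_n) : schur A -> pd N -> pd (lyap_sol A N).
Proof.
move=> sA pN; split; first by apply: lyap_sol_sym; rewrite ?pN.1.
by move=> x x0; apply: lt_le_trans (lyap_sol_ge x sA (pd_psd pN)); exact: pN.2.
Qed.

(** [(B A)^(t+1) = B (A B)^t A]. It exchanges the predictor and the filter form of the Kalman error
    dynamics. *)
Lemma schur_cyclic n m (A : 'M[R]_(n, m)) (B : 'M[R]_(m, n)) :
  schur (A *m B) -> schur (B *m A).
Proof.
move=> sAB.
have E t : (B *m A) ^+ t.+1 = B *m (A *m B) ^+ t *m A.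
  elim: t => [|t IH]; first by rewrite expr1 expr0 mulmx1.
  by rewrite mxexpS IH mxexpS !mulmxA.
have := mxcvg_mul (mxcvg_mul (mxcvg_cst B) (schur_mxcvg sAB)) (mxcvg_cst A).
rewrite mulmx0 mul0mx => h i j; rewrite -cvg_shiftS.
by under eq_fun do rewrite E; have := h i j; rewrite mxE.
Qed.

(** The right part of a left eigenvector is an eigenvector of [D], unless it vanishes, in which case
    the left part is an eigenvector of [A]. *)
Lemma schur_block_triangular m n (A : 'M[R]_m) (B : 'M[R]_(n, m)) (D : 'M[R]_n) :
  schur A -> schur D -> schur (block_mx A 0 B D).
Proof.
move=> /schurP sA /schurP sD; apply: eigenvalue_lt1_schur => z /eigenvalueP [v].
rewrite map_block_mx map_mx0 -[v]hsubmxK mul_row_block mulmx0 add0r scale_row_mx.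
move=> /eq_row_mx [e1 e2] v0.
have [r0|r0] := eqVneq (rsubmx v) 0.
  apply: (spectral_radius_eigenvalue sA); apply/eigenvalueP; exists (lsubmx v).
    by move: e1; rewrite r0 mul0mx addr0.
  by apply: contra_neq v0 => l0; rewrite l0 r0 row_mx0.
by apply: (spectral_radius_eigenvalue sD); apply/eigenvalueP; exists (rsubmx v).
Qed.

End Lyapunov.

(** * Entrywise differentiation along a real parameter *)

Section MatrixDerivative.
Context {R : realType}.

Definition drv (f : R -> R) (t : R) : Prop := derivable f t 1.

Definition mderiv m n (f : R -> 'M[R]_(m, n)) (t : R) (f' : 'M[R]_(m, n)) : Prop :=
  forall i j, is_derive t (1 : R) (fun s => f s i j : R) (f' i j).

Lemma drv_is_derive f t : drv f t -> exists d, is_derive t (1 : R) f d.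
Proof. by move=> h; exists ('D_1 f t); exact: DeriveDef. Qed.

Lemma is_derive_drv (f : R -> R) t (d : R) : is_derive t (1 : R) f d -> drv f t.
Proof. by case. Qed.

Lemma is_derive_inj (f : R -> R) t (d d' : R) :
  is_derive t (1 : R) f d -> is_derive t (1 : R) f d' -> d = d'.
Proof. by move=> [_ <-] [_ <-]. Qed.

Lemma is_derive_bigsum (I : Type) (r : seq I) (F : I -> R -> R) (F' : I -> R) t :
  (forall i, is_derive t (1 : R) (F i) (F' i)) ->
  is_derive t (1 : R) (fun s => \sum_(i <- r) F i s) (\sum_(i <- r) F' i).
Proof.
move=> h; elim: r => [|i r IH].
  by rewrite big_nil; under eq_fun do rewrite big_nil; exact: is_derive_cst.
by rewrite big_cons; under eq_fun do rewrite big_cons; exact: is_deriveD.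
Qed.

Lemma is_derive_mul (f g : R -> R) t (f' g' : R) :
  is_derive t (1 : R) f f' -> is_derive t (1 : R) g g' ->
  is_derive t (1 : R) (fun s => f s * g s) (f' * g t + f t * g').
Proof.
move=> hf hg; have := is_deriveM hf hg.
by rewrite addrC /GRing.scale /= [g t * f']mulrC.
Qed.

Lemma drv_cst c t : drv (fun=> c) t.
Proof. exact: is_derive_drv (is_derive_cst c t 1). Qed.

Lemma drv_mul f g t : drv f t -> drv g t -> drv (fun s => f s * g s) t.
Proof.
by move=> /drv_is_derive [a ha] /drv_is_derive [b hb]; exact: is_derive_drv (is_derive_mul ha hb).
Qed.

Lemma drv_sum (I : Type) (r : seq I) (F : I -> R -> R) t :
  (forall i, drv (F i) t) -> drv (fun s => \sum_(i <- r) F i s) t.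
Proof.
move=> h; apply: is_derive_drv (is_derive_bigsum r _) => i; exact: DeriveDef (h i) erefl.
Qed.

Lemma drv_prod (I : Type) (r : seq I) (F : I -> R -> R) t :
  (forall i, drv (F i) t) -> drv (fun s => \prod_(i <- r) F i s) t.
Proof.
move=> h; elim: r => [|i r IH].
  by under eq_fun do rewrite big_nil; exact: drv_cst.
by under eq_fun do rewrite big_cons; exact: (drv_mul (h i) IH).
Qed.

Lemma drv_continuous f t : drv f t -> {for t, continuous f}.
Proof. by move=> /derivable1_diffP /differentiable_continuous. Qed.

Definition mdrv m n (f : R -> 'M[R]_(m, n)) t : Prop := forall i j, drv (fun s => f s i j) t.

Lemma mderiv_mdrv m n (f : R -> 'M[R]_(m, n)) t f' : mderiv f t f' -> mdrv f t.
Proof. by move=> h i j; exact: is_derive_drv (h i j). Qed.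

Lemma mdrv_mderiv m n (f : R -> 'M[R]_(m, n)) t : mdrv f t -> exists f', mderiv f t f'.
Proof.
move=> h; exists (\matrix_(i, j) ('D_1 (fun s => f s i j : R) t)) => i j.
by rewrite mxE; exact: DeriveDef (h i j) erefl.
Qed.

Lemma mderiv_inj m n (f : R -> 'M[R]_(m, n)) t a b : mderiv f t a -> mderiv f t b -> a = b.
Proof. by move=> ha hb; apply/matrixP => i j; exact: is_derive_inj (ha i j) (hb i j). Qed.

Lemma mderiv_near m n (f g : R -> 'M[R]_(m, n)) t a :
  (\near t, f t = g t) -> mderiv f t a -> mderiv g t a.
Proof.
move=> fg h i j; apply: near_eq_is_derive (h i j).
by near=> s; rewrite (near fg s).
Unshelve. all: by end_near.
Qed.

Lemma mderiv_cst m n (c : 'M[R]_(m, n)) t : mderiv (fun=> c) t 0.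
Proof. by move=> i j; rewrite mxE; exact: is_derive_cst. Qed.

Lemma mderiv_add m n (f g : R -> 'M[R]_(m, n)) t f' g' :
  mderiv f t f' -> mderiv g t g' -> mderiv (fun s => f s + g s) t (f' + g').
Proof. by move=> hf hg i j; rewrite mxE; under eq_fun do rewrite mxE; exact: is_deriveD. Qed.

Lemma mderiv_mul m n p (f : R -> 'M[R]_(m, n)) (g : R -> 'M[R]_(n, p)) t f' g' :
  mderiv f t f' -> mderiv g t g' ->
  mderiv (fun s => f s *m g s) t (f' *m g t + f t *m g').
Proof.
move=> hf hg i j; rewrite !mxE -big_split /=; under eq_fun do rewrite mxE.
by apply: is_derive_bigsum => k; exact: is_derive_mul.
Qed.

Lemma mderiv_mull m n p (c : 'M[R]_(m, n)) (g : R -> 'M[R]_(n, p)) t g' :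
  mderiv g t g' -> mderiv (fun s => c *m g s) t (c *m g').
Proof. by move=> /(mderiv_mul (mderiv_cst c t)); rewrite mul0mx add0r. Qed.

Lemma mderiv_mulr m n p (c : 'M[R]_(n, p)) (f : R -> 'M[R]_(m, n)) t f' :
  mderiv f t f' -> mderiv (fun s => f s *m c) t (f' *m c).
Proof. by move=> /mderiv_mul /(_ (mderiv_cst c t)); rewrite mulmx0 addr0. Qed.

Lemma mderiv_tr m n (f : R -> 'M[R]_(m, n)) t f' :
  mderiv f t f' -> mderiv (fun s => (f s)^T) t f'^T.
Proof. by move=> hf i j; rewrite mxE; under eq_fun do rewrite mxE; exact: hf. Qed.

Lemma mderiv_scale m n a (f : R -> 'M[R]_(m, n)) t f' :
  mderiv f t f' -> mderiv (fun s => a *: f s) t (a *: f').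
Proof.
by move=> /(mderiv_mull a%:M); rewrite mul_scalar_mx; under eq_fun do rewrite mul_scalar_mx.
Qed.

Lemma mderiv_line m n (X D : 'M[R]_(m, n)) t : mderiv (fun s => X + s *: D) t D.
Proof.
move=> i j; under eq_fun do rewrite !mxE.
have h : is_derive t (1 : R) (fun s : R => s * D i j) (1 * D i j + t * 0).
  exact: is_derive_mul.
have := is_deriveD (is_derive_cst (X i j) t 1) h.
by rewrite mulr0 addr0 mul1r add0r.
Qed.

Lemma mderiv_trace n (f : R -> 'M[R]_n) t f' :
  mderiv f t f' -> is_derive t (1 : R) (fun s => \tr (f s) : R) (\tr f').
Proof. by move=> h; apply: is_derive_bigsum => i; exact: h. Qed.

Lemma mderiv_dotm m n (f : R -> 'M[R]_(m, n)) (D : 'M[R]_(m, n)) t f' :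
  mderiv f t f' -> is_derive t (1 : R) (fun s => dotm (f s) D : R) (dotm f' D).
Proof. by move=> h; apply: mderiv_trace; apply: mderiv_mulr; exact: mderiv_tr. Qed.

Lemma drv_det n (f : R -> 'M[R]_n) t : mdrv f t -> drv (fun s => \det (f s)) t.
Proof.
move=> h; rewrite /determinant; apply: drv_sum => s.
by apply: drv_mul; [exact: drv_cst | apply: drv_prod => i; exact: h].
Qed.

Lemma mdrv_minor m n (f : R -> 'M[R]_(m, n)) t k l :
  mdrv f t -> mdrv (fun s => row' k (col' l (f s))) t.
Proof. by move=> h i j; under eq_fun do rewrite !mxE; exact: h. Qed.

(** Only differentiability is drawn from Cramer's rule. The value of the derivative is found later
    by differentiating the Lyapunov equation, whose solution is unique. *)
Lemma mdrv_lyap_sol n (A N : R -> 'M[R]_n) t : mdrv A t -> mdrv N t ->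
  schur (A t) -> mdrv (fun s => lyap_sol (A s) (N s)) t.
Proof.
move=> hA hN sA; have hM : mdrv (fun s => lyap_mx (A s)) t.
  move=> k l; rewrite /drv.
  have [a ha] := drv_is_derive (hA (mxtens_unindex k).1 (mxtens_unindex l).1).
  have [b hb] := drv_is_derive (hA (mxtens_unindex k).2 (mxtens_unindex l).2).
  under eq_fun do rewrite !mxE.
  exact: is_derive_drv (is_deriveB (is_derive_cst _ _ _) (is_derive_mul ha hb)).
have du : \det (lyap_mx (A t)) != 0 by rewrite -unitfE -unitmxE lyap_mx_unit.
move=> i j; under eq_fun do rewrite !mxE.
apply: drv_mul; first by apply: derivableV => //; exact: drv_det.
apply: drv_sum => k; apply: drv_mul.
  under eq_fun do rewrite mxE; apply: drv_mul; first exact: drv_cst.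
  exact/drv_det/mdrv_minor.
by under eq_fun do rewrite mxE; exact: hN.
Qed.

End MatrixDerivative.

(** * Perturbation of stable matrices *)

Section Perturbation.
Context {R : realType}.

Lemma bform_CS2 n (X : 'M[R]_n) x y : psd X -> 2 * `|bform X x y| <= qform X x + qform X y.
Proof.
move=> pX; have x0 := pX.2 x; have y0 := pX.2 y.
have := psd_CS x y pX; rewrite -real_normK ?num_real //.
have := normr_ge0 (bform X x y); set b := `|_|; set p := qform X x; set r := qform X y.
move=> b0 h; rewrite -ler_sqr ?nnegrE ?mulr_ge0 ?addr_ge0 //.
have := sqr_ge0 (p - r); nra.
Qed.

(** [X / c] is a Lyapunov certificate for [A^T], the strict inequality providing the contraction. *)
Lemma schur_strict n (A X : 'M[R]_n) c : X^T = X -> 0 < c ->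
  (forall x, c * dotm x x <= qform X x) ->
  (forall x, c * dotm x x <= qform (X - A *m X *m A^T) x) -> schur A.
Proof.
move=> sX c0 h1 h2; rewrite -[A]trmxK; apply/schur_tr/lyap_cert_schur.
have [C C1 hC] := qform_le X; have C0 : 0 < C by apply: lt_le_trans C1.
(* The maximum with [c] keeps the rate [1 - c / max] nonnegative. *)
have m0 : 0 < Num.max C c by rewrite lt_max C0.
exists (c^-1 *: X), (1 - c / Num.max C c); split.
- by rewrite linearZ /= sX.
- by move=> x; rewrite qformZ mulrC ler_pdivlMr // mulrC.
- by rewrite subr_ge0 ltrBlDr ltrDl divr_gt0 // andbT ler_pdivrMr // mul1r le_max lexx orbT.
- move=> x; rewrite !qformZ mulrCA ler_wpM2l ?invr_ge0 ?(ltW c0) //.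
  have := h2 x; rewrite qformB qform_congr_tr => h.
  have : c / Num.max C c * qform X x <= c * dotm x x.
    rewrite -mulrA ler_wpM2l ?(ltW c0) // mulrC ler_pdivrMr // mulrC.
    apply: le_trans (le_trans (ler_norm _) (hC x)) _.
    by rewrite ler_wpM2r ?dotm_ge0 // le_max lexx.
  by lra.
Qed.

Lemma congr_perturb n (A A1 : 'M[R]_n) C : 0 <= C -> exists2 kap, 0 <= kap &
  forall X e x, psd X -> \tr X <= C -> `|e| <= 1 ->
  `|qform X ((A + e *: A1)^T *m x) - qform X (A^T *m x)| <= `|e| * kap * dotm x x.
Proof.
move=> C0; exists (C * (dotm A A + 2 * dotm A1 A1)).
  by rewrite mulr_ge0 // addr_ge0 ?mulr_ge0 ?dotm_ge0.
move=> X e x pX trX e1; rewrite linearD /= mulmxDl linearZ /= -scalemxAl.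
set u := A^T *m x; set v := A1^T *m x.
rewrite qformDx ?pX.1 // qformZx bformC ?pX.1 // bformZl bformC ?pX.1 //.
rewrite [X in `|X|](_ : _ = e * (2 * bform X u v + e * qform X v)); last by ring.
rewrite normrM -mulrA ler_wpM2l //.
have hu : qform X u <= C * (dotm A A * dotm x x).
  apply: le_trans (psd_qform_le_tr u pX) _; apply: ler_pM => //; [exact: psd_tr_ge0|exact: dotm_ge0|].
  by rewrite -(dotm_tr A); exact: dotm_mulmx_le.
have hv : qform X v <= C * (dotm A1 A1 * dotm x x).
  apply: le_trans (psd_qform_le_tr v pX) _; apply: ler_pM => //; [exact: psd_tr_ge0|exact: dotm_ge0|].
  by rewrite -(dotm_tr A1); exact: dotm_mulmx_le.
apply: le_trans (ler_normD _ _) _; rewrite !normrM (ger0_norm (pX.2 v)) (ger0_norm (x := 2)) //.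
have := bform_CS2 u v pX.
have : `|e| * qform X v <= qform X v by rewrite ler_piMl // pX.2.
by lra.
Qed.

(* Stability at [A + e A1] transfers to [A] and back, uniformly over the
   certificates [X] of bounded trace; this gives both openness of the set of
   stable matrices and closedness along bounded solutions. *)
Lemma schur_perturb n (A A1 : 'M[R]_n) c C : 0 < c -> 0 <= C -> exists2 e0, 0 < e0 &
  forall e, `|e| <= e0 -> forall X, psd X -> \tr X <= C ->
  (forall x, c * dotm x x <= qform X x) ->
  ((forall x, c * dotm x x <= qform (X - (A + e *: A1) *m X *m (A + e *: A1)^T) x) -> schur A) /\
  ((forall x, c * dotm x x <= qform (X - A *m X *m A^T) x) -> schur (A + e *: A1)).
Proof.
move=> c0 C0; have [k k0 hk] := congr_perturb A A1 C0.
(* The perturbation may cost [c / 2], half of the margin; the summand 1 guards against [k = 0]. *)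
exists (Num.min 1 (c / 2 / (k + 1))).
  by rewrite lt_min ltr01 !divr_gt0 // ltr_wpDl.
move=> e; rewrite le_min => /andP[e1 e2] X pX tX cX.
have c2 : 0 < c / 2 by rewrite divr_gt0.
have lo x : c / 2 * dotm x x <= qform X x.
  by apply: le_trans (cX x); rewrite ler_wpM2r ?dotm_ge0 //; lra.
have ek (x : 'cV[R]_n) : `|e| * k * dotm x x <= c / 2 * dotm x x.
  rewrite ler_wpM2r ?dotm_ge0 //; move: e2; rewrite ler_pdivlMr ?ltr_wpDl //.
  by apply: le_trans; rewrite ler_wpM2l //; lra.
have key x := le_trans (hk X e x pX tX e1) (ek x).
split=> h; apply: (schur_strict pX.1 c2 lo) => x; have := h x; have := key x;
  rewrite ler_norml !qformB !qform_congr_tr => /andP[]; lra.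
Qed.

(** The certificate is the Lyapunov solution with right-hand side the identity, whose margin is
    1. *)
Lemma schur_near n (A A1 : 'M[R]_n) t : schur (A + t *: A1) ->
  \forall s \near t, schur (A + s *: A1).
Proof.
move=> sA; set At := A + t *: A1 in sA; pose X := lyap_sol At 1%:M.
have p1 : psd (1%:M : 'M[R]_n).
  by split; [exact: trmx1 | move=> x; rewrite qform1 dotm_ge0].
have pX : psd X := lyap_sol_psd sA p1.
have X1 x : 1 * dotm x x <= qform X x.
  by rewrite mul1r -qform1; exact: lyap_sol_ge.
have [e0 e00 h] := schur_perturb At A1 ltr01 (psd_tr_ge0 pX).
apply/nbhs_ballP; exists e0 => //= s; rewrite /ball /= distrC => /ltW ts.
have [_] := h (s - t) ts X pX (lexx _) X1.
have -> : At + (s - t) *: A1 = A + s *: A1.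
  by rewrite /At -addrA -scalerDl subrKC.
apply=> x; rewrite mul1r {1}/X lyap_sol_eq // -/X addrK qform1 //.
Qed.

End Perturbation.

(** * Cost of a gain, its gradient and its Hessian *)

Section QuadraticCost.
Context {R : realType} {nx nu : nat}.
Context (A : 'M[R]_nx) (B : 'M[R]_(nx, nu)) (Qt : 'M[R]_nx) (Rm : 'M[R]_nu) (N : 'M[R]_nx).

Definition acl (G : 'M[R]_(nu, nx)) : 'M[R]_nx := A + B *m G.

(** [Sg] and [Pg] recast the chosen solutions [Sigma_of] and [P_of] as explicit functions of the
    gain, which can be differentiated. *)
Definition Sg G : 'M[R]_nx := lyap_sol (acl G) N.

Definition Pg G : 'M[R]_nx := lyap_sol (acl G)^T (Qt + G^T *m Rm *m G).

Definition Eg G : 'M[R]_(nu, nx) :=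
  2%:R *: ((Rm + B^T *m Pg G *m B) *m G + B^T *m Pg G *m A).

Definition cost G : R := \tr (Pg G *m N).

Lemma acl_line G D s : acl (G + s *: D) = acl G + s *: (B *m D).
Proof. by rewrite /acl mulmxDr -scalemxAr addrA. Qed.

Lemma schur_acl_near G D t : schur (acl (G + t *: D)) ->
  \forall s \near t, schur (acl (G + s *: D)).
Proof.
rewrite acl_line => /schur_near h; near=> s; rewrite acl_line; near: s.
exact: h.
Unshelve. all: by end_near.
Qed.

Lemma Sg_eq G : schur (acl G) -> Sg G = N + acl G *m Sg G *m (acl G)^T.
Proof. exact: lyap_sol_eq. Qed.

Lemma Pg_eq G : schur (acl G) ->
  Pg G = Qt + G^T *m Rm *m G + (acl G)^T *m Pg G *m acl G.
Proof. by move=> /schur_tr /lyap_sol_eq h; rewrite {1}/Pg h trmxK. Qed.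

Lemma EgE G : Eg G = 2%:R *: (Rm *m G + B^T *m Pg G *m acl G).
Proof. by rewrite /Eg /acl mulmxDl mulmxDr -addrA [in RHS](addrC (_ *m A)) !mulmxA. Qed.

(** The maps [X - a^T X a] and [Y - a Y a^T] are adjoint for the trace pairing, hence so are their
    inverses. *)
Lemma tr_adjoint (a U V : 'M[R]_nx) : schur a ->
  \tr (lyap_sol a^T U *m V) = \tr (U *m lyap_sol a V).
Proof.
move=> sa; set X := lyap_sol a^T U; set Y := lyap_sol a V.
have hX : X = U + a^T *m X *m a by rewrite {1}/X lyap_sol_eq ?trmxK //; exact: schur_tr.
have hY : Y = V + a *m Y *m a^T by rewrite {1}/Y lyap_sol_eq.
have -> : V = Y - a *m Y *m a^T by apply/eqP; rewrite -subr_eq opprK -hY.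
have -> : U = X - a^T *m X *m a by apply/eqP; rewrite -subr_eq opprK -hX.
rewrite mulmxBr mulmxBl !raddfB /=; congr (_ - _).
by rewrite mulmxA mxtrace_mulC !mulmxA.
Qed.

Hypotheses (sQ : Qt^T = Qt) (sR : Rm^T = Rm) (sN : N^T = N).

Lemma Sg_sym G : schur (acl G) -> (Sg G)^T = Sg G.
Proof. by move=> h; apply: lyap_sol_sym. Qed.

Lemma Pg_sym G : schur (acl G) -> (Pg G)^T = Pg G.
Proof.
move=> /schur_tr h; apply: lyap_sol_sym => //.
by rewrite linearD /= !trmx_mul trmxK sQ sR mulmxA.
Qed.

Lemma cost_Sg G : schur (acl G) -> cost G = \tr ((Qt + G^T *m Rm *m G) *m Sg G).
Proof. by move=> h; rewrite /cost /Pg tr_adjoint. Qed.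

(** Directional derivatives: differentiating a Lyapunov equation leaves the same operator with a new
    right-hand side. The factor [2^-1] in [dPg] compensates the 2 built into [Eg]. *)
Definition dSg G D : 'M[R]_nx :=
  lyap_sol (acl G) (B *m D *m Sg G *m (acl G)^T + acl G *m Sg G *m (B *m D)^T).

Definition dPg G D : 'M[R]_nx :=
  lyap_sol (acl G)^T (2^-1 *: (D^T *m Eg G + (Eg G)^T *m D)).

Definition dEg G D : 'M[R]_(nu, nx) :=
  2%:R *: (Rm *m D + B^T *m (dPg G D *m acl G + Pg G *m (B *m D))).

Definition hess G D : 'M[R]_(nu, nx) := dEg G D *m Sg G + Eg G *m dSg G D.

Lemma mderiv_acl G D t : mderiv (fun s => acl (G + s *: D)) t (B *m D).
Proof.
by have := mderiv_line (acl G) (B *m D) t; under [in X in _ -> X]eq_fun do rewrite acl_line.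
Qed.

Lemma mderiv_Sg G D t : schur (acl (G + t *: D)) ->
  mderiv (fun s => Sg (G + s *: D)) t (dSg (G + t *: D) D).
Proof.
move=> sG; have da := mderiv_acl G D t.
have [S' hS] : exists S', mderiv (fun s => Sg (G + s *: D)) t S'.
  apply/mdrv_mderiv/mdrv_lyap_sol => //; first exact: mderiv_mdrv da.
  exact: mderiv_mdrv (mderiv_cst N t).
(* The derivative exists and solves the differentiated equation; uniqueness identifies it. *)
suff <- : S' = dSg (G + t *: D) D by [].
apply: lyap_solE => //; apply: (mderiv_inj hS).
have := mderiv_add (mderiv_cst N t) (mderiv_mul (mderiv_mul da hS) (mderiv_tr da)).
rewrite add0r mulmxDl addrAC => h.
apply: mderiv_near h; near=> s; rewrite -Sg_eq //; near: s; exact: schur_acl_near.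
Unshelve. all: by end_near.
Qed.

(** Collects the terms of the differentiated equation of [Pg] in which [D] appears explicitly; they
    form half of [D^T E] plus its transpose. *)
Lemma dPg_algebra (G D E : 'M[R]_(nu, nx)) (P P' a : 'M[R]_nx) :
  P^T = P -> E = 2%:R *: (Rm *m G + B^T *m P *m a) ->
  D^T *m Rm *m G + G^T *m Rm *m D
    + (((B *m D)^T *m P + a^T *m P') *m a + a^T *m P *m (B *m D))
  = 2^-1 *: (D^T *m E + E^T *m D) + a^T *m P' *m a.
Proof.
move=> sP ->; rewrite scalerDr [(2%:R *: _)^T]linearZ /=.
rewrite -scalemxAr -scalemxAl !scalerA mulVf ?pnatr_eq0 // !scale1r.
rewrite mulmxDr [(Rm *m G + _)^T]linearD /= !trmx_mul trmxK sR sP !mulmxDl !mulmxA.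
rewrite -!addrA; congr (_ + _); rewrite addrCA; congr (_ + _).
by congr (_ + _); rewrite addrC.
Qed.

Lemma mderiv_Pg G D t : schur (acl (G + t *: D)) ->
  mderiv (fun s => Pg (G + s *: D)) t (dPg (G + t *: D) D).
Proof.
move=> sG; have da := mderiv_acl G D t; have dG := mderiv_line G D t.
have dC := mderiv_mul (mderiv_mul (mderiv_tr dG) (mderiv_cst Rm t)) dG.
have [P' hP] : exists P', mderiv (fun s => Pg (G + s *: D)) t P'.
  apply/mdrv_mderiv/mdrv_lyap_sol; last exact: schur_tr.
    exact: mderiv_mdrv (mderiv_tr da).
  exact: mderiv_mdrv (mderiv_add (mderiv_cst Qt t) dC).
suff <- : P' = dPg (G + t *: D) D by [].
apply: lyap_solE; first exact: schur_tr.
apply: (mderiv_inj hP).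
have h := mderiv_add (mderiv_add (mderiv_cst Qt t) dC)
  (mderiv_mul (mderiv_mul (mderiv_tr da) hP) da).
apply: mderiv_near (_ : mderiv _ _ _); last first.
  move: h; rewrite add0r mulmx0 addr0 (@dPg_algebra _ D (Eg (G + t *: D))).
  - by rewrite trmxK; apply.
  - exact: Pg_sym.
  - exact: EgE.
by near=> s; rewrite -Pg_eq //; near: s; exact: schur_acl_near.
Unshelve. all: by end_near.
Qed.

Lemma mderiv_Eg G D t : schur (acl (G + t *: D)) ->
  mderiv (fun s => Eg (G + s *: D)) t (dEg (G + t *: D) D).
Proof.
move=> sG; have dP := mderiv_Pg sG; have da := mderiv_acl G D t.
have h := mderiv_scale 2%:R (mderiv_add (mderiv_mull Rm (mderiv_line G D t))
  (mderiv_mul (mderiv_mull B^T dP) da)).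
rewrite /dEg mulmxDr !mulmxA; rewrite !mulmxA in h.
apply: mderiv_near h; near=> s; by rewrite EgE.
Unshelve. all: by end_near.
Qed.

Lemma mderiv_grad G D t : schur (acl (G + t *: D)) ->
  mderiv (fun s => Eg (G + s *: D) *m Sg (G + s *: D)) t (hess (G + t *: D) D).
Proof. by move=> sG; apply: mderiv_mul; [exact: mderiv_Eg | exact: mderiv_Sg]. Qed.

Lemma tr_sym_half (X W : 'M[R]_nx) : X^T = X -> \tr (2^-1 *: (W + W^T) *m X) = \tr (W *m X).
Proof.
move=> sX; rewrite -scalemxAl mxtraceZ mulmxDl mxtraceD.
have -> : \tr (W^T *m X) = \tr (W *m X).
  by rewrite -mxtrace_tr trmx_mul trmxK sX mxtrace_mulC.
by field.
Qed.

Lemma is_derive_cost G D t : schur (acl (G + t *: D)) ->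
  is_derive t (1 : R) (fun s => cost (G + s *: D) : R)
    (dotm (Eg (G + t *: D) *m Sg (G + t *: D)) D).
Proof.
move=> sG; have := mderiv_trace (mderiv_mulr N (mderiv_Pg sG)).
congr (is_derive _ _ _ _); rewrite /dPg tr_adjoint // -/(Sg _).
have -> : (Eg (G + t *: D))^T *m D = (D^T *m Eg (G + t *: D))^T by rewrite trmx_mul trmxK.
by rewrite tr_sym_half ?Sg_sym // -mulmxA -[\tr _]/(dotm _ _) dotmC.
Qed.

(** The contribution of [dPg] is moved by [tr_adjoint] onto [dSg G D2]; the last two summands then
    mirror each other, and the symmetry of the Hessian becomes visible. *)
Lemma hess_dotm G D D2 : schur (acl G) -> dotm (hess G D) D2 =
  2 * dotm ((Rm + B^T *m Pg G *m B) *m D *m Sg G) D2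
  + dotm (Eg G *m dSg G D2) D + dotm (Eg G *m dSg G D) D2.
Proof.
move=> sG; set a := acl G; set P := Pg G; set Sig := Sg G.
have sP : P^T = P by exact: Pg_sym.
have sS : Sig^T = Sig by exact: Sg_sym.
rewrite /hess dotmDl -/P -/Sig -/a; congr (_ + _).
rewrite /dEg -/P -/a -scalemxAl dotmZl !mulmxDl dotmDl mulmxDr mulmxDl dotmDl.
rewrite dotmDl !mulmxA.
suff -> : dotm (Eg G *m dSg G D2) D = 2 * dotm (B^T *m dPg G D *m a *m Sig) D2 by ring.
apply/esym; have -> : 2 * dotm (B^T *m dPg G D *m a *m Sig) D2 =
    \tr (dPg G D *m (B *m D2 *m Sig *m a^T + a *m Sig *m (B *m D2)^T)).
  have sdP : (dPg G D)^T = dPg G D.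
    apply: lyap_sol_sym; first exact: schur_tr.
    by rewrite linearZ linearD /= !trmx_mul !trmxK addrC.
  rewrite mulmxDr mxtraceD; set W := \tr (_ *m (a *m _ *m _)).
  have -> : \tr (dPg G D *m (B *m D2 *m Sig *m a^T)) = W.
    rewrite /W -mxtrace_tr !trmx_mul !trmxK sdP sS mxtrace_mulC !mulmxA.
    by rewrite mxtrace_mulC !mulmxA.
  have -> : dotm (B^T *m dPg G D *m a *m Sig) D2 = W.
    rewrite -!mulmxA dotm_mull trmxK dotmC /dotm /W !trmx_mul mxtrace_mulC.
    by rewrite !mulmxA.
  by ring.
rewrite /dPg tr_adjoint // -/(dSg G D2).
have -> : (Eg G)^T *m D = (D^T *m Eg G)^T by rewrite trmx_mul trmxK.
rewrite tr_sym_half; last first.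
  apply: lyap_sol_sym => //.
  by rewrite linearD /= !trmx_mul !trmxK sS addrC !mulmxA.
by rewrite -mulmxA -[\tr _]/(dotm _ _) dotmC.
Qed.

Lemma hess_sym G D D2 : schur (acl G) -> dotm (hess G D) D2 = dotm D (hess G D2).
Proof.
move=> sG; rewrite [RHS]dotmC !hess_dotm //.
have -> : dotm ((Rm + B^T *m Pg G *m B) *m D *m Sg G) D2 =
    dotm ((Rm + B^T *m Pg G *m B) *m D2 *m Sg G) D.
  rewrite -mulmxA dotm_mull dotmC.
  have -> : (Rm + B^T *m Pg G *m B)^T = Rm + B^T *m Pg G *m B.
    by rewrite linearD /= !trmx_mul trmxK sR Pg_sym // mulmxA.
  by rewrite [RHS]dotm_mulr Sg_sym.
by ring.
Qed.

End QuadraticCost.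

(** * Coercivity of the cost on sublevel sets *)

Section Coercivity.
Context {R : realType} {nx nu : nat}.
Context (A : 'M[R]_nx) (B : 'M[R]_(nx, nu)) (Qt : 'M[R]_nx) (Rm : 'M[R]_nu) (N : 'M[R]_nx).
Hypotheses (pQ : psd Qt) (pR : pd Rm) (pN : pd N).
Local Notation acl := (acl A B).
Local Notation Sg := (Sg A B N).
Local Notation Pg := (Pg A B Qt Rm).
Local Notation Eg := (Eg A B Qt Rm).
Local Notation cost := (cost A B Qt Rm N).

Lemma tr_mul_mono n (M1 M2 X : 'M[R]_n) : M1^T = M1 -> M2^T = M2 -> psd X ->
  (forall x, qform M1 x <= qform M2 x) -> \tr (M1 *m X) <= \tr (M2 *m X).
Proof.
move=> s1 s2 pX h; rewrite -subr_ge0 -raddfB -mulmxBl; apply: psd_tr_mul_ge0 => //.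
split; first by rewrite linearB /= s1 s2.
by move=> x; rewrite qformB subr_ge0.
Qed.

Lemma Sg_psd G : schur (acl G) -> psd (Sg G).
Proof. by move=> h; apply: lyap_sol_psd => //; exact: pd_psd. Qed.

Lemma Pg_psd G : schur (acl G) -> psd (Pg G).
Proof.
move=> /schur_tr h; apply: lyap_sol_psd => //; apply: psdD => //.
by apply: psd_congr; exact: pd_psd.
Qed.

(** Completing the square around a stationary gain: [Eg Gs = 0] cancels the terms linear in
    [G - Gs], so the gap is exactly quadratic, weighted by the covariance of [G] itself. *)
Lemma cost_gap_quadratic G Gs : schur (acl G) -> schur (acl Gs) -> Eg Gs = 0 ->
  cost G - cost Gs =
  \tr ((G - Gs)^T *m (Rm + B^T *m Pg Gs *m B) *m (G - Gs) *m Sg G).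
Proof.
move=> sG sGs E0; have sP : (Pg Gs)^T = Pg Gs by apply: Pg_sym => //; [exact: pQ.1|exact: pR.1].
rewrite cost_Sg // /cost; set P := Pg Gs in sP *; set X := Sg G; set a := acl G.
have -> : N = X - a *m X *m a^T by apply/eqP; rewrite -subr_eq opprK -Sg_eq.
have -> : \tr (P *m (X - a *m X *m a^T)) = \tr ((P - a^T *m P *m a) *m X).
  rewrite mulmxBr mulmxBl !raddfB /=; congr (_ - _).
  by rewrite mulmxA mxtrace_mulC !mulmxA.
rewrite -raddfB -mulmxBl /=; congr (\tr (_ *m X)).
have [D GE] : exists D, G = Gs + D by exists (G - Gs); rewrite subrKC.
have -> : G - Gs = D by rewrite GE addrC addKr.
have aE : a = acl Gs + B *m D by rewrite /a GE /acl mulmxDr addrA.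
have H0 : Rm *m Gs + B^T *m P *m acl Gs = 0.
  have := E0; rewrite EgE => /eqP; rewrite scaler_eq0 pnatr_eq0 /= => /eqP; exact.
have PE : P = Qt + Gs^T *m Rm *m Gs + (acl Gs)^T *m P *m acl Gs by exact: Pg_eq.
rewrite [in X in _ - (X - _)]PE aE [in LHS]GE; move: (acl Gs) H0 PE => b H0 PE.
have H0t : Gs^T *m Rm + b^T *m P *m B = 0.
  have := congr1 trmx H0; rewrite trmx0 linearD /= !trmx_mul trmxK sP pR.1.
  by rewrite !mulmxA.
rewrite [(Gs + D)^T]linearD [(b + B *m D)^T]linearD /= trmx_mul !(mulmxDl, mulmxDr) !mulmxA.
have e1 : D^T *m Rm *m Gs + D^T *m B^T *m P *m b = 0.
  by rewrite -!mulmxA -mulmxDr !mulmxA H0 mulmx0.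
have e2 : Gs^T *m Rm *m D + b^T *m P *m B *m D = 0.
  by rewrite -mulmxDl H0t mul0mx.
move: e1 e2 => /eqP; rewrite addr_eq0 => /eqP -> /eqP; rewrite addr_eq0 => /eqP ->.
move: (D^T *m B^T *m P *m b) (b^T *m P *m B *m D) (b^T *m P *m b) => x1 x2 x3.
move: (Gs^T *m Rm *m Gs) (D^T *m Rm *m D) (D^T *m B^T *m P *m B *m D) => x4 x5 x6.
apply/matrixP => i j; rewrite !mxE; ring.
Qed.

Lemma qform_young n (Z : 'M[R]_n) e x y : psd Z -> 0 < e ->
  qform Z (x + y) <= (1 + e) * qform Z x + (1 + e^-1) * qform Z y.
Proof.
move=> pZ e0; rewrite qformDx ?pZ.1 //.
have := bform_CS2 (e *: x) y pZ; rewrite bformZl qformZx => h.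
have : 2 * bform Z x y <= e * qform Z x + e^-1 * qform Z y.
  rewrite -(ler_pM2l e0).
  have -> : e * (e * qform Z x + e^-1 * qform Z y) = e ^+ 2 * qform Z x + qform Z y.
    by field; rewrite gt_eqF.
  by apply: le_trans h; rewrite mulrCA ler_pM2l //; exact: ler_norm.
by lra.
Qed.

(** A Lyapunov function [Z] of the stationary loop [Gs] is tested on the loop of [G]. The two loops
    differ by [B D], which enters through [tr (D^T D Sg)], bounded by [K / cR] thanks to the gap;
    Young's inequality separates this part from the contraction. *)
Lemma Sg_bounded Gs K : schur (acl Gs) -> Eg Gs = 0 ->
  exists2 C, 0 <= C & forall G, schur (acl G) -> cost G - cost Gs <= K -> \tr (Sg G) <= C.
Proof.
move=> sGs E0; have [Z [r [sZ Z1 /andP[r0 r1] hr]]] := schur_lyap_cert sGs.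
have pZ : psd Z by split=> // x; apply: le_trans (Z1 x); exact: dotm_ge0.
have [cR cR0 hR] := pd_lower pR.
have [cB cB1 hB] := qform_le (B^T *m Z *m B).
(* This [e] gives [(1 + e) r <= (1 + r) / 2], so half of the contraction margin survives. *)
pose e := (1 - r) / 2; have e0 : 0 < e by rewrite divr_gt0 // subr_gt0.
pose k := (1 + e^-1) * cB; have k0 : 0 <= k.
  by rewrite mulr_ge0 ?addr_ge0 ?invr_ge0 ?(ltW e0) // (le_trans _ cB1).
exists (Num.max 0 ((\tr (Z *m N) + k * (K / cR)) / e)); first by rewrite le_max lexx.
move=> G sG hK; rewrite le_max; apply/orP; right.
have pX := Sg_psd sG; set X := Sg G in pX *; set D := G - Gs; set a := acl G.
have hD : \tr (D^T *m D *m X) <= K / cR.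
  rewrite ler_pdivlMr // mulrC; apply: le_trans hK; rewrite cost_gap_quadratic // -mxtraceZ.
  rewrite scalemxAl; apply: tr_mul_mono => //.
  - by rewrite linearZ /= trmx_mul trmxK.
  - have sM : (Rm + B^T *m Pg Gs *m B)^T = Rm + B^T *m Pg Gs *m B.
      by rewrite linearD /= !trmx_mul trmxK pR.1 (Pg_psd sGs).1 mulmxA.
    by rewrite !trmx_mul trmxK sM mulmxA.
  - move=> x; rewrite qformZ qform_tr_mul qform_congr qformD.
    apply: le_trans (hR _) _; rewrite lerDl qform_congr; exact: (Pg_psd sGs).2.
have tZ : \tr X <= \tr (Z *m X).
  rewrite -[X in \tr X <= _]mul1mx; apply: tr_mul_mono => //; first exact: trmx1.
  by move=> x; rewrite qform1.
have aE : a = acl Gs + B *m D by rewrite /a /acl /D mulmxBr -addrA subrKC.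
have tE : \tr (Z *m X) = \tr (Z *m N) + \tr (a^T *m Z *m a *m X).
  rewrite {1}/X Sg_eq // -/X -/a mulmxDr mxtraceD; congr (_ + _).
  by rewrite mulmxA mxtrace_mulC !mulmxA.
have ta : \tr (a^T *m Z *m a *m X) <= \tr ((((1 + r) / 2) *: Z + k *: (D^T *m D)) *m X).
  apply: tr_mul_mono => //.
  - by rewrite !trmx_mul trmxK sZ mulmxA.
  - by rewrite linearD !linearZ /= sZ trmx_mul trmxK.
  move=> x; rewrite qform_congr qformD !qformZ qform_tr_mul aE mulmxDl.
  apply: le_trans (qform_young _ _ pZ e0) _; apply: lerD.
    apply: le_trans (_ : (1 + e) * (r * qform Z x) <= _).
      by rewrite ler_wpM2l ?addr_ge0 ?(ltW e0).
    rewrite mulrA ler_wpM2r //; first exact: pZ.2.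
    rewrite /e; nra.
  rewrite /k -mulrA ler_wpM2l ?addr_ge0 ?invr_ge0 ?(ltW e0) //.
  rewrite -mulmxA -qform_congr; exact: le_trans (ler_norm _) (hB _).
rewrite ler_pdivlMr //; apply: le_trans (_ : e * \tr (Z *m X) <= _).
  by rewrite mulrC ler_wpM2l ?(ltW e0).
move: ta; rewrite mulmxDl mxtraceD -!scalemxAl !mxtraceZ => ta.
have : k * \tr (D^T *m D *m X) <= k * (K / cR) by rewrite ler_wpM2l.
rewrite /e; lra.
Qed.

(** The covariances of the nearby stable gains are certificates of trace at most [C] that dominate
    [N], uniformly in [s]; [schur_perturb] therefore reaches the limit gain. *)
Lemma sublevel_limit_schur Gs K G D t : schur (acl Gs) -> Eg Gs = 0 ->
  (forall e, 0 < e -> exists s, [/\ `|t - s| <= e, schur (acl (G + s *: D)) &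
     cost (G + s *: D) - cost Gs <= K]) ->
  schur (acl (G + t *: D)).
Proof.
move=> sGs E0 h; have [C C0 hC] := Sg_bounded K sGs E0.
have [c c0 hc] := pd_lower pN.
have [e0 e00 hp] := schur_perturb (acl (G + t *: D)) (B *m D) c0 C0.
have [s [ts sG hK]] := h _ e00.
have := hp (s - t) _ (Sg (G + s *: D)) (Sg_psd sG) (hC _ sG hK).
rewrite distrC => /(_ ts) [x|+ _].
  by apply: le_trans (hc x) _; apply: lyap_sol_ge => //; exact: pd_psd.
have -> : acl (G + t *: D) + (s - t) *: (B *m D) = acl (G + s *: D).
  by rewrite !acl_line -addrA -scalerDl subrKC.
apply=> x; rewrite {1}Sg_eq // addrK; exact: hc.
Qed.

End Coercivity.

(** * From a spectral-norm bound to a Frobenius-norm bound *)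

Section PowerMethod.
Context {R : realType}.

(* Power method: iterate the spectral-norm bound and compare with the
   log-convex sequence |H^k D|_F. *)
Lemma selfadjoint_specnorm_bound m n (H : 'M[R]_(m, n) -> 'M[R]_(m, n)) L : 0 <= L ->
  (forall D D2, dotm (H D) D2 = dotm D (H D2)) ->
  (forall D, specnorm (H D) <= L * specnorm D) ->
  forall D, dotm D (H D) <= L * dotm D D.
Proof.
move=> L0 sH bH D; have [->|D0] := eqVneq D 0; first by rewrite !dotm0l mulr0.
pose a k := dotm (iter k H D) (iter k H D).
have a00 : 0 < a 0%N by rewrite lt_def dotm_ge0 andbT; apply: contra_neq D0 => /dotm_eq0.
have lc k : a k.+1 ^+ 2 <= a k * a k.+2.
  by rewrite /a /= sH; exact: dotm_CS.
have ub k : a k <= n%:R * L ^+ 2 ^+ k * a 0%N.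
  apply: le_trans (dotm_le_specnorm _) _; rewrite -mulrA ler_wpM2l //.
  have hk : specnorm (iter k H D) <= L ^+ k * specnorm D.
    elim: k => [|k IH]; first by rewrite expr0 mul1r.
    by rewrite exprS -mulrA; apply: le_trans (bH _) _; rewrite ler_wpM2l.
  apply: le_trans (_ : (L ^+ k * specnorm D) ^+ 2 <= _).
    by rewrite ler_pXn2r ?nnegrE ?mulr_ge0 ?exprn_ge0 ?specnorm_ge0.
  rewrite exprMn exprAC ler_wpM2l ?exprn_ge0 //.
  by rewrite /a /= -frobnorm_sqr ler_pXn2r ?nnegrE ?specnorm_ge0 ?sqrtr_ge0 // specnorm_le_frob.
suff h1 : a 1%N <= L ^+ 2 * a 0%N.
  apply: le_trans (ler_norm _) _; rewrite -ler_sqr ?nnegrE ?mulr_ge0 ?dotm_ge0 //.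
  rewrite real_normK ?num_real //; apply: le_trans (dotm_CS _ _) _.
  by rewrite exprMn [dotm D D ^+ 2]expr2 mulrCA ler_wpM2l ?dotm_ge0.
rewrite leNgt; apply/negP => h1.
pose rho := a 1%N / a 0%N.
have rL : L ^+ 2 < rho by rewrite ltr_pdivlMr.
have rho0 : 0 < rho by apply: le_lt_trans rL; rewrite exprn_ge0.
have step k : 0 < a k /\ rho * a k <= a k.+1.
  elim: k => [|k [ak hk]]; first by rewrite /rho divfK ?gt_eqF.
  have ak1 : 0 < a k.+1 by apply: lt_le_trans hk; rewrite mulr_gt0.
  split=> //; rewrite -(ler_pM2l ak); apply: le_trans (lc k).
  by rewrite mulrCA expr2 mulrA ler_pM2r.
have low k : rho ^+ k * a 0%N <= a k.
  elim: k => [|k IH]; first by rewrite expr0 mul1r.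
  by apply: le_trans (step k).2; rewrite exprS -mulrA ler_pM2l.
pose th := L ^+ 2 / rho.
have th1 : `|th| < 1.
  have t0 : 0 <= th by apply: divr_ge0; rewrite ?exprn_ge0 ?(ltW rho0).
  by rewrite ger0_norm // /th ltr_pdivrMr // mul1r.
(* The dimension factor stays fixed while [th^k] tends to 0, which is the contradiction. *)
have key k : 1 <= n%:R * th ^+ k.
  rewrite expr_div_n mulrA ler_pdivlMr ?exprn_gt0 // mul1r -(ler_pM2r a00).
  exact: le_trans (low k) (ub k).
have tc : n%:R * th ^+ k @[k --> \oo] --> n%:R * (0 : R).
  by apply: cvgM; [exact: cvg_cst | exact: cvg_expr].
rewrite mulr0 in tc.
have [k _ hk] := cvgr0_norm_lt _ tc 1 ltr01.
by have := hk k (leqnn k); rewrite ltNge (le_trans (key k)) ?ler_norm.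
Qed.

End PowerMethod.

(** * Continuous induction along a segment *)

Section PathDescent.
Context {R : realType}.

(** Take the supremum of the [t] up to which [Q] holds throughout: the first hypothesis gives [Q]
    there, the second extends it beyond. *)
Lemma real_induction (Q : R -> Prop) (a : R) :
  (forall s, 0 <= s <= a -> (forall t, 0 <= t < s -> Q t) -> Q s) ->
  (forall s, 0 <= s < a -> (forall t, 0 <= t <= s -> Q t) ->
     exists2 e, 0 < e & forall t, s < t < s + e -> Q t) ->
  forall s, 0 <= s <= a -> Q s.
Proof.
move=> hl hr s0 /andP[s00 s0a]; apply: contrapT => nQ.
pose E := [set t : R | 0 <= t <= a /\ forall u, 0 <= u <= t -> Q u].
have Qp0 : Q 0.
  by apply: hl => [|t /andP[t1 t2]]; [rewrite lexx (le_trans s00) | move: (le_lt_trans t1 t2); rewrite ltxx].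
have E0 : E 0.
  split; first by rewrite lexx (le_trans s00).
  by move=> u /andP[u0 u1]; have -> : u = 0 by apply/eqP; rewrite eq_le u0 u1.
have ubE : ubound E s0.
  move=> t [_ ht]; rewrite leNgt; apply/negP => st; apply: nQ; apply: ht.
  by rewrite s00 ltW.
have hsE : has_sup E by split; [exists 0 | exists s0].
set m := sup E; have m0 : 0 <= m by exact: (ub_le_sup hsE.2 E0).
have ms0 : m <= s0 by apply: ge_sup => //; exists 0.
have below t : 0 <= t < m -> Q t.
  move=> /andP[t0 tm]; have [u [_ hu] tu] : exists2 u, E u & t < u.
    have e0 : 0 < m - t by rewrite subr_gt0.
    by have [u Eu] := sup_adherent e0 hsE; rewrite subKr; exists u.
  by apply: hu; rewrite t0 ltW.
have Qm : Q m by apply: hl => //; rewrite m0 (le_trans ms0).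
have Qle t : 0 <= t <= m -> Q t.
  by move=> /andP[t0]; rewrite le_eqVlt => /orP[/eqP -> //|tm]; apply: below; rewrite t0.
have msl : m < s0.
  by rewrite lt_neqAle ms0 andbT; apply: contra_not_neq nQ => <-.
have [|e e0 he] := hr m _ Qle; first by rewrite m0 (lt_le_trans msl).
pose v := Num.min (m + e / 2) s0.
have mv : m < v by rewrite lt_min msl ltrDl divr_gt0.
have : E v.
  split; first by rewrite (le_trans m0 (ltW mv)) (le_trans _ s0a) // ge_min lexx orbT.
  move=> u /andP[u0 uv]; have [um|mu] := leP u m; first by apply: Qle; rewrite u0.
  apply: he; rewrite mu /=; apply: le_lt_trans uv _.
  by rewrite gt_min ltrD2l ltr_pdivrMr // ltr_pMr // ltr1n.
by move=> /(ub_le_sup hsE.2); rewrite leNgt mv.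
Qed.

Lemma is_derive_slope (f : R -> R) t (d : R) : is_derive t (1 : R) f d ->
  exists2 g : R -> R, (forall z, f z - f t = g z * (z - t)) & {for t, continuous g} /\ g t = d.
Proof. by move=> /is_derive1_caratheodory [g [h1 h2 h3]]; exists g. Qed.

(** The Caratheodory slope is continuous with value [d] at [t]. This turns the Lipschitz bound on
    gradients into a bound on the Hessian. *)
Lemma is_derive_lipschitz (f : R -> R) t (d c : R) : is_derive t (1 : R) f d ->
  (\forall s \near t, `|f s - f t| <= c * `|s - t|) -> `|d| <= c.
Proof.
move=> /is_derive_slope [g hg [cg <-]] hc; rewrite leNgt; apply/negP => gc.
have cn : {for t, continuous (fun s => `|g s|)} by apply: continuous_comp => //; exact: norm_continuous.
have gn : \forall s \near t, c < `|g s| by exact: (cvgr_gt _ cn).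
have [e /= e0 he] : exists2 e : R, 0 < e & forall s, `|t - s| < e ->
    `|f s - f t| <= c * `|s - t| /\ c < `|g s|.
  have : \forall s \near t, `|f s - f t| <= c * `|s - t| /\ c < `|g s| by exact: filterI hc gn.
  by move=> /nbhs_ballP [e e0 he]; exists e => // s ts; exact: he.
have [|h1 h2] := he (t + e / 2).
  by rewrite opprD addNKr normrN gtr0_norm ?divr_gt0 // ltr_pdivrMr // ltr_pMr // ltr1n.
move: h1; rewrite hg addrAC subrr add0r normrM ler_pM2r ?normr_gt0 ?gt_eqF ?divr_gt0 //.
by rewrite leNgt h2.
Qed.

Lemma is_derive_lt0_right (f : R -> R) t (d : R) : is_derive t (1 : R) f d -> d < 0 ->
  exists2 e, 0 < e & forall s, t < s < t + e -> f s < f t.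
Proof.
move=> /is_derive_slope [g hg [cg gt0]] d0.
have gn : \forall s \near t, g s < 0 by apply: (cvgr_lt _ cg); rewrite gt0.
have /nbhs_ballP [e /= e0 he] := gn.
exists e => // s /andP[ts se]; rewrite -subr_lt0 hg nmulr_rlt0 ?subr_gt0 //.
by apply: he; rewrite /ball /= distrC ger0_norm ?subr_ge0 ?ltW // ltrBlDl.
Qed.

(** The bound on [f2] is asked on the open interval only, because in the continuous induction the
    endpoints may lie on the boundary of the sublevel set. *)
Lemma taylor2_le (f f1 f2 : R -> R) (M s : R) : 0 <= s ->
  (forall t, 0 <= t <= s -> is_derive t (1 : R) f (f1 t)) ->
  (forall t, 0 <= t <= s -> is_derive t (1 : R) f1 (f2 t)) ->
  (forall t, 0 < t < s -> f2 t <= M) ->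
  f s <= f 0 + s * f1 0 + M * s ^+ 2 / 2.
Proof.
move=> s0 d1 d2 hM; move: s0; rewrite le_eqVlt => /orP[/eqP <-|s0].
  by rewrite mul0r expr0n mulr0 mul0r !addr0.
have cont (h h' : R -> R) u : (forall t, 0 <= t <= s -> is_derive t (1 : R) h (h' t)) ->
    u <= s -> {within `[0, u], continuous h}.
  move=> dh us; apply: continuous_in_subspaceT => t; rewrite inE /= in_itv /= => /andP[t0 tu].
  by apply: drv_continuous; apply: is_derive_drv (dh t _); rewrite t0 (le_trans tu).
have first t : 0 < t <= s -> f1 t <= f1 0 + M * t.
  move=> /andP[t0 ts].
  have d2' x : x \in `]0, t[ -> is_derive x (1 : R) f1 (f2 x).
    by rewrite in_itv /= => /andP[c0 ct]; apply: d2; rewrite (ltW c0) (le_trans (ltW ct)).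
  have [c] := MVT t0 d2' (cont f1 f2 t d2 ts).
  rewrite in_itv /= => /andP[c0 ct]; rewrite subr0 => h.
  have : f2 c * t <= M * t by rewrite ler_pM2r // hM // c0 (lt_le_trans ct).
  lra.
(* The quadratic majorant is subtracted; [g] is nonincreasing by the first-order bound. *)
pose g t := f t - (f1 0 * t + M / 2 * (t * t)).
have dg t : 0 <= t <= s -> is_derive t (1 : R) g (f1 t - (f1 0 + M * t)).
  move=> hst; have df := d1 t hst.
  have dl : is_derive t (1 : R) (fun t : R => f1 0 * t) (0 * t + f1 0 * 1).
    exact: is_derive_mul (is_derive_cst _ _ _) (is_derive_id _ _).
  have dq : is_derive t (1 : R) (fun t : R => M / 2 * (t * t)) (0 * (t * t) + M / 2 * (1 * t + t * 1)).
    apply: is_derive_mul (is_derive_cst _ _ _) _.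
    exact: is_derive_mul (is_derive_id _ _) (is_derive_id _ _).
  have := is_deriveB df (is_deriveD dl dq).
  have -> // : f1 t - (0 * t + f1 0 * 1 + (0 * (t * t) + M / 2 * (1 * t + t * 1))) =
     f1 t - (f1 0 + M * t) by field.
have dg' x : x \in `]0, s[ -> is_derive x (1 : R) g (f1 x - (f1 0 + M * x)).
  by rewrite in_itv /= => /andP[c0 ct]; apply: dg; rewrite !ltW.
have [c] := MVT s0 dg' (cont g _ s dg (lexx s)).
rewrite in_itv /= => /andP[c0 cs]; rewrite subr0 => h.
have : (f1 c - (f1 0 + M * c)) * s <= 0.
  by rewrite pmulr_lle0 // subr_le0; apply: first; rewrite c0 ltW.
rewrite -h /g !mulr0 addr0 subr0 expr2 => h'.
have -> : M * (s * s) / 2 = M / 2 * (s * s) by field.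
by rewrite (mulrC s); lra.
Qed.

(** The curvature bound [M] holds only below [thr], which is what has to be maintained: the Taylor
    bound on [[0, s]] gives [f s < thr], openness carries this beyond [s], and the closedness of
    [st] along sublevel points handles limits. At time 0 equality with [thr] is allowed if [f]
    starts to decrease. *)
Lemma path_descent (st : R -> Prop) (f f1 f2 : R -> R) (thr M a : R) : 0 < a ->
  (forall t, st t -> \forall s \near t, st s) ->
  (forall t, st t -> is_derive t (1 : R) f (f1 t)) ->
  (forall t, st t -> is_derive t (1 : R) f1 (f2 t)) ->
  (forall t, st t -> f t < thr -> f2 t <= M) ->
  (forall t, (forall e, 0 < e -> exists s, [/\ `|t - s| <= e, st s & f s <= thr]) -> st t) ->
  st 0 -> f 0 <= thr -> (f 0 = thr -> f1 0 < 0) ->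
  (forall t, 0 < t <= a -> f 0 + t * f1 0 + M * t ^+ 2 / 2 < thr) ->
  st a /\ f a <= f 0 + a * f1 0 + M * a ^+ 2 / 2.
Proof.
move=> a0 ost d1 d2 hM cst st0 f0 f10 bd.
have near_right (t : R) : (\forall s \near t, st s /\ (f s < thr)) ->
    exists2 e, 0 < e & forall s, t < s < t + e -> st s /\ (0 < s -> f s < thr).
  move=> /nbhs_ballP [e1 /= e10 he]; exists e1 => // s /andP[ts se].
  have [|h1 h2] := he s; last by split.
  by rewrite /ball /= distrC ger0_norm ?subr_ge0 ?ltW // ltrBlDl.
have cf t : st t -> f t < thr -> \forall s \near t, st s /\ f s < thr.
  move=> stt ft; apply: filterI; first exact: ost.
  have := drv_continuous (is_derive_drv (d1 t stt)) => c; exact: (cvgr_lt _ c).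
have taylor s : 0 <= s -> (forall t, 0 <= t <= s -> st t) ->
    (forall t, 0 < t < s -> f t < thr) -> f s <= f 0 + s * f1 0 + M * s ^+ 2 / 2.
  move=> s0 hst hf; apply: (@taylor2_le f f1 f2 M s s0) => t ht.
  - exact: d1 (hst t ht).
  - exact: d2 (hst t ht).
  - apply: hM (hf t ht); apply: hst.
    by case/andP: ht => /ltW -> /ltW ->.
have all s : 0 <= s <= a -> st s /\ (0 < s -> f s < thr).
  apply: (real_induction (Q := fun s => st s /\ (0 < s -> f s < thr))) => {}s /andP[s0 sa] IH.
    have sts : st s.
      move: s0; rewrite le_eqVlt => /orP[/eqP <- //|s0].
      (* This point is positive, below [s] and within [e] of it, so the induction hypothesis applies
         with a value below [thr]. *)
      apply: cst => e e0; exists (Num.max (s - e) (s / 2)).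
      have m0 : 0 < Num.max (s - e) (s / 2) by rewrite lt_max orbC divr_gt0.
      have ms : Num.max (s - e) (s / 2) < s.
        by rewrite gt_max ltrBlDr ltrDl e0 ltr_pdivrMr // ltr_pMr // ltr1n.
      have [|h1 h2] := IH (Num.max (s - e) (s / 2)); first by rewrite ltW.
      split=> //; last exact/ltW/h2.
      rewrite ger0_norm; last by rewrite subr_ge0 ltW.
      by rewrite lerBlDr -lerBlDl le_max lexx.
    split=> // sgt; apply: le_lt_trans (bd s _); last by rewrite sgt.
    apply: taylor => // t /andP[t0 ts].
      by move: ts; rewrite le_eqVlt => /orP[/eqP -> //|ts]; apply: (IH t _).1; rewrite t0.
    by apply: (IH t _).2 => //; rewrite ltW.
  have [sts fs] := IH s ltac:(by rewrite s0 lexx).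
  have [sgt|sle] := ltP 0 s; first by apply: near_right; apply: cf => //; exact: fs.
  have sz : s = 0 by apply/eqP; rewrite eq_le s0 sle.
  move: (f0); rewrite le_eqVlt => /orP[/eqP fE|flt]; last first.
    by rewrite sz; apply: near_right; exact: cf.
  have [e1 e10 he1] := is_derive_lt0_right (d1 0 st0) (f10 fE).
  have /nbhs_ballP [e2 /= e20 he2] := ost 0 st0.
  exists (Num.min e1 e2); first by rewrite lt_min e10.
  move=> t; rewrite sz add0r lt_min => /andP[t0 /andP[t1 t2]]; split.
    by apply: he2; rewrite /ball /= sub0r normrN gtr0_norm.
  by move=> _; rewrite -fE; apply: he1; rewrite t0 add0r.
split; first by apply: (all a _).1; rewrite lexx ltW.
apply: taylor; first exact: ltW.
  by move=> t ht; exact: (all t ht).1.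
by move=> t /andP[t0 ta]; apply: (all t _).2 => //; rewrite !ltW.
Qed.

End PathDescent.

(** * Bisimulation bound and deviation from the average *)

Section Bisim.
Context {R : realType}.

(** With [s = sqrt (1 - lam)] the objective is [qform M nu / (1 - s)^2], and [F] contracts the
    seminorm of [M] by [s]; hence [|V| <= s |V| + |nu|] in this seminorm, while [M] dominates
    [C^T C]. *)
Lemma bisim_bound m n (F : 'M[R]_n) (C : 'M[R]_(m, n)) (M : 'M[R]_n) lam (nu V : 'cV[R]_n) :
  bisim_feasible F C M lam -> V = F *m V + nu ->
  dotm (C *m V) (C *m V) <= bisim_obj nu M lam.
Proof.
move=> [pM /andP[l0 l1] hC hF] hV; set s := Num.sqrt (1 - lam).
have ss : s ^+ 2 = 1 - lam by rewrite sqr_sqrtr // subr_ge0 ltW.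
have s0 : 0 < s by rewrite sqrtr_gt0 subr_gt0.
have s1 : s < 1 by rewrite -sqrtr1 ltr_sqrt // ltrBlDr ltrDl.
have ms0 : 0 < 1 - s by rewrite subr_gt0.
have objE : bisim_obj nu M lam = qform M nu / (1 - s) ^+ 2.
  rewrite /bisim_obj /bisim_eta -/s; have -> : lam = 1 - s ^+ 2 by rewrite ss subKr.
  field; rewrite !gt_eqF //=; have : 1 - s ^+ 2 - (1 - s) * s = 1 - s by ring.
  nra.
have le1 : dotm (C *m V) (C *m V) <= qform M V.
  by have := hC.2 V; rewrite qformB subr_ge0 qform_tr_mul.
apply: le_trans le1 _; rewrite objE ler_pdivlMr ?exprn_gt0 //.
have qF : qform M (F *m V) <= s ^+ 2 * qform M V.
  by have := hF.2 V; rewrite !(qformB, qformN, qformZ) qform_congr ss; lra.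
have qV0 := pM.2 V; have qn0 := pM.2 nu.
set p := Num.sqrt (qform M V); set k := Num.sqrt (qform M nu).
have pp : p ^+ 2 = qform M V by rewrite sqr_sqrtr.
have kk : k ^+ 2 = qform M nu by rewrite sqr_sqrtr.
have p0 : 0 <= p by exact: sqrtr_ge0.
have k0 : 0 <= k by exact: sqrtr_ge0.
have cross : bform M (F *m V) nu <= s * p * k.
  apply: le_trans (ler_norm _) _.
  rewrite -ler_sqr ?nnegrE ?mulr_ge0 ?(ltW s0) // real_normK ?num_real //.
  apply: le_trans (psd_CS _ _ pM) _; rewrite !exprMn pp kk.
  by rewrite ler_wpM2r.
have : p ^+ 2 <= (s * p + k) ^+ 2.
  have -> : (s * p + k) ^+ 2 = s ^+ 2 * p ^+ 2 + 2 * (s * p * k) + k ^+ 2 by ring.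
  rewrite pp kk {1}hV qformDx ?pM.1 //; lra.
rewrite ler_sqr ?nnegrE ?addr_ge0 ?mulr_ge0 ?(ltW s0) // => h.
rewrite -pp -kk -exprMn ler_sqr ?nnegrE ?mulr_ge0 ?(ltW ms0) //.
by rewrite mulrBr mulr1 lerBlDl mulrC.
Qed.

Lemma bisim_obj_ge0 m n (F : 'M[R]_n) (C : 'M[R]_(m, n)) (M : 'M[R]_n) lam nu :
  bisim_feasible F C M lam -> 0 <= bisim_obj nu M lam.
Proof.
move=> [pM /andP[l0 l1] _ _]; rewrite /bisim_obj /bisim_eta; set s := Num.sqrt (1 - lam).
have ss : s ^+ 2 = 1 - lam by rewrite sqr_sqrtr // subr_ge0 ltW.
have s0 : 0 < s by rewrite sqrtr_gt0 subr_gt0.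
have s1 : s < 1 by rewrite -sqrtr1 ltr_sqrt // ltrBlDr ltrDl.
have i1 : 1 <= s^-1 by rewrite invf_ge1 // ltW.
rewrite mulr_ge0 ?mulr_ge0 ?pM.2 ?addr_ge0 ?invr_ge0 ?subr_ge0 //.
have -> : (s^-1 - 1) * (1 - lam) = s - s ^+ 2.
  by rewrite -ss; field; rewrite gt_eqF.
have -> : lam = 1 - s ^+ 2 by rewrite ss subKr.
nra.
Qed.

Lemma dotm_sum_le m n (I : finType) (x : I -> 'M[R]_(m, n)) :
  dotm (\sum_i x i) (\sum_i x i) <= #|I|%:R * \sum_i dotm (x i) (x i).
Proof.
have h y z : dotm (y : 'M[R]_(m, n)) z <= 2^-1 * (dotm y y + dotm z z).
  have := dotm_ge0 (y - z); rewrite !(dotmBl, dotmBr) (dotmC z y); lra.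
rewrite dotm_sumr; under eq_bigr do rewrite dotmC dotm_sumr.
apply: le_trans (_ : \sum_i \sum_j 2^-1 * (dotm (x i) (x i) + dotm (x j) (x j)) <= _).
  by do 2![apply: ler_sum => ? _]; exact: h.
have sc (y : R) : \sum_(i : I) y = #|I|%:R * y by rewrite sumr_const mulr_natl.
under eq_bigr do rewrite -mulr_sumr big_split /= sc.
rewrite -mulr_sumr big_split /= sc -mulr_sumr.
set s := \sum_i dotm _ _; set c := #|I|%:R.
by have -> : 2^-1 * (c * s + c * s) = c * s by field.
Qed.

(** The [i]-th of the differences [g j - g i] vanishes, so convexity gives the sum of the others
    times [1 / N], and [1 / N <= 1 / (N - 1)]. *)
Lemma average_deviation m n N (g : 'I_N -> 'M[R]_(m, n)) (i : 'I_N) (e : 'I_N -> R) :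
  (forall j, j != i -> dotm (g i - g j) (g i - g j) <= e j) ->
  dotm (N%:R^-1 *: \sum_j g j - g i) (N%:R^-1 *: \sum_j g j - g i)
    <= (N.-1)%:R^-1 * \sum_(j | j != i) e j.
Proof.
move=> h; have N0 : (0 < N)%N by apply: leq_ltn_trans (ltn_ord i).
have Nr : N%:R != 0 :> R by rewrite pnatr_eq0 -lt0n.
have -> : N%:R^-1 *: \sum_j g j - g i = N%:R^-1 *: \sum_j (g j - g i).
  rewrite sumrB sumr_const card_ord scalerBr -[g i *+ N]scaler_nat scalerA mulVf //.
  by rewrite scale1r.
rewrite dotmZl dotmZr.
have := dotm_sum_le (fun j => g j - g i); rewrite card_ord => hs.
have e0 j : j != i -> 0 <= e j by move=> /h; apply: le_trans; exact: dotm_ge0.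
have hb : \sum_j dotm (g j - g i) (g j - g i) <= \sum_(j | j != i) e j.
  rewrite (bigD1 i) //= subrr dotm0l add0r; apply: ler_sum => j ji.
  by rewrite -opprB dotmNl dotmNr opprK; exact: h.
have se : 0 <= \sum_(j | j != i) e j by apply: sumr_ge0.
apply: le_trans (_ : N%:R^-1 * (N%:R^-1 * (N%:R * \sum_(j | j != i) e j)) <= _).
  rewrite !ler_wpM2l ?invr_ge0 ?ler0n //; apply: le_trans hs _.
  by rewrite ler_wpM2l ?ler0n.
rewrite mulKf //; case: N i g e h N0 Nr hs e0 hb se => [|[|N]] i g e h N0 Nr hs e0 hb se.
- by [].
(* For [N = 1] both sides vanish, the sum being empty. *)
- by rewrite big1 ?mulr0 // => j; rewrite (ord1 i) (ord1 j).
- by rewrite ler_wpM2r // lef_pV2 ?posrE ?ltr0n // ler_nat.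
Qed.

End Bisim.

(** * From lifted quantities to functions of the gain *)

Section TaskLink.
Context {R : realType} {nx nu ny q : nat}.
Variables (T : lqg_task R nx nu ny) (S : 'M[R]_(nx, q)).
Implicit Type K : 'M[R]_(nu, q).
Local Notation Y := (mp_pinv S).
Local Notation G := (gain_of S).
Local Notation acl := (acl (tA T) (tB T)).
Local Notation Sg := (Sg (tA T) (tB T) (Sigma_nu T)).
Local Notation Pg := (Pg (tA T) (tB T) (Qtilde T) (tR T)).
Local Notation Eg := (Eg (tA T) (tB T) (Qtilde T) (tR T)).

Lemma Kset_schur K : Kset T S K <-> schur (acl (G K)).
Proof. exact: schurP. Qed.

(** A solution exists, so [xget] returns one, and stability makes it unique. *)
Lemma Sigma_ofE K : Kset T S K -> Sigma_of T S K = Sg (G K).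
Proof.
move=> /Kset_schur sK; apply: lyap_solE => //.
have e : exists Sg0, Sg0 = Sigma_nu T + A_cl T S K *m Sg0 *m (A_cl T S K)^T.
  by exists (Sg (G K)); exact: Sg_eq.
exact: (xgetPex 0 e).
Qed.

Lemma P_ofE K : Kset T S K -> P_of T S K = Pg (G K).
Proof.
move=> /Kset_schur sK; apply: lyap_solE; first exact: schur_tr.
have e : exists P0, P0 = Qtilde T + Y^T *m K^T *m tR T *m K *m Y
    + (A_cl T S K)^T *m P0 *m A_cl T S K.
  exists (Pg (G K)); rewrite {1}Pg_eq // /gain_of trmx_mul !mulmxA //.
have := xgetPex 0 e; rewrite -/(P_of T S K) => {1}->.
by rewrite trmxK /gain_of trmx_mul !mulmxA.
Qed.

Lemma E_ofE K : Kset T S K -> E_of T S K = Eg (G K).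
Proof. by move=> hK; rewrite /E_of P_ofE // -[_ *m K *m _]mulmxA. Qed.

Lemma gradJE K : Kset T S K -> gradJ T S K = Eg (G K) *m Sg (G K) *m Y^T.
Proof. by move=> hK; rewrite /gradJ E_ofE // Sigma_ofE. Qed.

Lemma gain_line K D t : G (K + t *: D) = G K + t *: (D *m Y).
Proof. by rewrite /gain_of mulmxDl -scalemxAl. Qed.

Lemma vec_gradJ K : Kset T S K ->
  vec (gradJ T S K) = C_of T S K *m vec (Sigma_of T S K).
Proof. by move=> hK; rewrite /gradJ vec_mul trmxK. Qed.

Lemma vec_Sigma K : Kset T S K ->
  vec (Sigma_of T S K) = F_of T S K *m vec (Sigma_of T S K) + vec (Sigma_nu T).
Proof.
move=> hK; rewrite Sigma_ofE //.
have /(congr1 (@vec R nx nx)) := Sg_eq (Sigma_nu T) (iffLR (Kset_schur K) hK).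
by rewrite vecD vec_mul trmxK addrC.
Qed.

End TaskLink.

(** * A gradient step seen by one task *)

Section TaskDescent.
Context {R : realType} {nx nu ny q : nat}.
Variables (T : lqg_task R nx nu ny) (S : 'M[R]_(nx, q)).
Implicit Type K : 'M[R]_(nu, q).
Local Notation Y := (mp_pinv S).
Local Notation G := (gain_of S).
Local Notation acl := (acl (tA T) (tB T)).
Local Notation Sg := (Sg (tA T) (tB T) (Sigma_nu T)).
Local Notation Eg := (Eg (tA T) (tB T) (Qtilde T) (tR T)).
Hypotheses (pQ : psd (Qtilde T)) (pR : pd (tR T)) (pN : pd (Sigma_nu T)).
Hypothesis (SY : S *m Y = 1%:M).

Definition gcost K : R := cost (tA T) (tB T) (Qtilde T) (tR T) (Sigma_nu T) (G K).

Definition hessJ K D : 'M[R]_(nu, q) :=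
  hess (tA T) (tB T) (Qtilde T) (tR T) (Sigma_nu T) (G K) (D *m Y) *m Y^T.

Lemma Kset_near K D t : Kset T S (K + t *: D) -> \forall s \near t, Kset T S (K + s *: D).
Proof.
move=> /Kset_schur; rewrite gain_line => /schur_acl_near h.
by near=> s; apply/Kset_schur; rewrite gain_line; near: s.
Unshelve. all: by end_near.
Qed.

Lemma is_derive_gcost K D t : Kset T S (K + t *: D) ->
  is_derive t (1 : R) (fun s => gcost (K + s *: D) : R) (dotm (gradJ T S (K + t *: D)) D).
Proof.
move=> hK; rewrite gradJE // gain_line dotm_mulr trmxK.
have : schur (acl (G K + t *: (D *m Y))) by rewrite -gain_line; apply/Kset_schur.
move=> /(is_derive_cost pQ.1 pR.1 pN.1).
by under [in X in _ -> X]eq_fun do rewrite /gcost gain_line.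
Qed.

Lemma mderiv_gradJ K D t : Kset T S (K + t *: D) ->
  mderiv (fun s => gradJ T S (K + s *: D)) t (hessJ (K + t *: D) D).
Proof.
move=> hK; have : schur (acl (G K + t *: (D *m Y))) by rewrite -gain_line; apply/Kset_schur.
move=> /(mderiv_grad (Sigma_nu T) pQ.1 pR.1) /(mderiv_mulr Y^T).
rewrite -gain_line => h; apply: mderiv_near h; near=> s.
have hs : Kset T S (K + s *: D) by near: s; exact: Kset_near.
by rewrite (gradJE hs) gain_line.
Unshelve. all: by end_near.
Qed.

Lemma hessJ_sym K D D2 : Kset T S K -> dotm (hessJ K D) D2 = dotm D (hessJ K D2).
Proof.
move=> /Kset_schur hK; rewrite /hessJ dotm_mulr trmxK.
by rewrite (hess_sym pQ.1 pR.1 pN.1) // dotm_mulr.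
Qed.

(** For [|x| <= 1] and [y = hessJ K D x], the function [<gradJ (K + s D) x, y>] of [s] has
    derivative [|y|^2] at 0, and its increments there are at most [L |D| |y| |s|]. *)
Lemma hessJ_specnorm (Dom : set 'M[R]_(nu, q)) L K D : 0 <= L -> Kset T S K ->
  (forall X X', Dom X -> Dom X' ->
     specnorm (gradJ T S X - gradJ T S X') <= L * specnorm (X - X')) ->
  (\forall s \near (0 : R), Dom (K + s *: D)) ->
  specnorm (hessJ K D) <= L * specnorm D.
Proof.
move=> L0 hK lip nD; have DK : Dom K.
  by have := nbhs_singleton nD; rewrite scale0r addr0.
have c0 : 0 <= L * specnorm D by rewrite mulr_ge0 ?specnorm_ge0.
apply: specnorm_le => x x1; set y := hessJ K D *m x.
have hK0 : Kset T S (K + (0 : R) *: D) by rewrite scale0r addr0.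
have := mderiv_dotm y (mderiv_mulr x (mderiv_gradJ hK0)).
rewrite scale0r addr0 -/y => dv.
have : `|dotm y y| <= L * specnorm D * l2norm y.
  apply: is_derive_lipschitz dv _; near=> s; rewrite scale0r addr0 subr0 -dotmBl -mulmxBl.
  have Ds : Dom (K + s *: D) by near: s.
  have h := lip _ _ Ds DK.
  have e : K + s *: D - K = s *: D by rewrite addrC addKr.
  rewrite e in h.
  have hs : specnorm (s *: D) <= `|s| * specnorm D.
    apply: specnorm_le => z z1; rewrite -scalemxAl l2normZ ler_wpM2l //.
    exact: specnorm_ge_unit.
  set X := gradJ T S _ - _ in h *.
  have hx : l2norm (X *m x) <= L * specnorm D * `|s|.
    apply: le_trans (specnorm_ge_unit X x1) _; apply: le_trans h _.
    by rewrite -mulrA ler_wpM2l // mulrC.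
  apply: le_trans (_ : l2norm (X *m x) * l2norm y <= _).
    rewrite -ler_sqr ?nnegrE ?mulr_ge0 ?l2norm_ge0 // real_normK ?num_real //.
    by rewrite exprMn !l2norm_sqr; exact: dotm_CS.
  by rewrite mulrAC ler_wpM2r ?l2norm_ge0.
rewrite ger0_norm ?dotm_ge0 // -l2norm_sqr expr2.
have := l2norm_ge0 y; rewrite le_eqVlt => /orP[/eqP <- _ //|y0].
by rewrite ler_pM2r.
Unshelve. all: by end_near.
Qed.

(** The stable set is open along lines, so a small step against a nonzero gradient would stay stable
    and lower the cost. *)
Lemma minimizer_gradJ0 Ks : Kset T S Ks -> (forall K, Kset T S K -> gcost Ks <= gcost K) ->
  gradJ T S Ks = 0.
Proof.
move=> hK hmin; apply: dotm_eq0; apply/eqP; rewrite eq_le dotm_ge0 andbT leNgt; apply/negP => gt0.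
set D := - gradJ T S Ks.
have hK0 : Kset T S (Ks + (0 : R) *: D) by rewrite scale0r addr0.
have dv := is_derive_gcost hK0; rewrite scale0r addr0 in dv.
have lt0 : dotm (gradJ T S Ks) D < 0 by rewrite /D dotmNr oppr_lt0.
have [e e0 he] := is_derive_lt0_right dv lt0.
have /nbhs_ballP [e2 /= e20 he2] := Kset_near hK0.
pose s := Num.min e e2 / 2; have m0 : 0 < Num.min e e2 by rewrite lt_min e0.
have s0 : 0 < s by rewrite divr_gt0.
have sm : s < Num.min e e2 by rewrite ltr_pdivrMr // ltr_pMr // ltr1n.
have hs : Kset T S (Ks + s *: D).
  apply: he2; rewrite /ball /= sub0r normrN gtr0_norm //.
  by apply: lt_le_trans sm _; rewrite ge_min lexx orbT.
have := he s; rewrite s0 add0r (lt_le_trans sm) ?ge_min ?lexx // => /(_ isT).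
by rewrite scale0r addr0 ltNge hmin.
Qed.

(** [S S^+ = 1] lets [S^T] cancel the trailing factor of the gradient, and the covariance is
    invertible because [Sigma_nu] is positive definite. *)
Lemma gradJ0_Eg0 K : Kset T S K -> gradJ T S K = 0 -> Eg (G K) = 0.
Proof.
move=> hK; rewrite gradJE // => /(congr1 (mulmx^~ S^T)).
rewrite mul0mx -mulmxA -trmx_mul SY trmx1 mulmx1 => /(congr1 (mulmx^~ (invmx (Sg (G K))))).
rewrite mul0mx mulmxK //; apply/pd_unit/lyap_sol_pd => //; exact/Kset_schur.
Qed.

(** An instance of [path_descent] for an arbitrary direction [g], since the averaged gradient is not
    the gradient of the task. Coercivity supplies the closedness, the power method the curvature
    [L |g|^2]. *)
Lemma gradient_step Ks thr L K g alpha : Kset T S Ks ->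
  (forall X, Kset T S X -> gcost Ks <= gcost X) -> 0 <= L ->
  (forall X X', Kset T S X -> gcost X - gcost Ks <= thr ->
     Kset T S X' -> gcost X' - gcost Ks <= thr ->
     specnorm (gradJ T S X - gradJ T S X') <= L * specnorm (X - X')) ->
  Kset T S K -> gcost K - gcost Ks <= thr -> 0 < alpha ->
  (gcost K - gcost Ks = thr -> 0 < dotm (gradJ T S K) g) ->
  (forall t, 0 < t <= alpha ->
     gcost K - gcost Ks - t * dotm (gradJ T S K) g + L * dotm g g * t ^+ 2 / 2 < thr) ->
  Kset T S (K - alpha *: g) /\
  gcost (K - alpha *: g) - gcost Ks <=
    gcost K - gcost Ks - alpha * dotm (gradJ T S K) g + L * dotm g g * alpha ^+ 2 / 2.
Proof.
move=> hKs hmin L0 lip hK Kthr a0 bdry bd.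
pose Dom := [set X | Kset T S X /\ gcost X - gcost Ks <= thr].
have Eg0 := gradJ0_Eg0 hKs (minimizer_gradJ0 hKs hmin).
pose st t := Kset T S (K + t *: - g).
pose f t := gcost (K + t *: - g) - gcost Ks.
pose f1 t := dotm (gradJ T S (K + t *: - g)) (- g).
pose f2 t := dotm (hessJ (K + t *: - g) (- g)) (- g).
have z : K + (0 : R) *: - g = K by rewrite scale0r addr0.
have df t : st t -> is_derive t (1 : R) f (f1 t).
  move=> h; have := is_deriveB (is_derive_gcost h) (is_derive_cst (gcost Ks) t (1 : R)).
  by rewrite subr0.
have fth t : st t -> f t < thr -> forall D, \forall s \near (0 : R), Dom (K + t *: - g + s *: D).
  move=> stt ft D; pose K' := K + t *: - g.
  have h0 : Kset T S (K' + (0 : R) *: D) by rewrite scale0r addr0.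
  have c := drv_continuous (is_derive_drv (is_derive_gcost h0)).
  have lt1 : gcost (K' + (0 : R) *: D) < thr + gcost Ks.
    by rewrite scale0r addr0 -ltrBlDr.
  have n1 : \forall s \near (0 : R), gcost (K' + s *: D) < thr + gcost Ks by exact: (cvgr_lt _ c).
  have n2 := Kset_near h0.
  near=> s; split; first by near: s.
  by rewrite lerBlDr; apply/ltW; near: s.
have [] := @path_descent R st f f1 f2 thr (L * dotm g g) alpha a0.
- by move=> t; exact: Kset_near.
- by move=> t h; exact: mderiv_dotm (mderiv_gradJ h).
- move=> t stt ft; rewrite /f2 dotmC -[dotm g g]opprK -dotmNr -dotmNl.
  apply: selfadjoint_specnorm_bound => //.
    by move=> D D2; exact: hessJ_sym.
  move=> D; apply: (hessJ_specnorm (Dom := Dom)) => //; last exact: fth.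
  by move=> X X' [? ?] [? ?]; exact: lip.
- move=> t ht; apply/Kset_schur; rewrite gain_line.
  apply: (sublevel_limit_schur pQ pR pN (K := thr) (Gs := G Ks)) => //; first exact/Kset_schur.
  move=> e e0; have [s [h1 h2 h3]] := ht e e0; exists s; split=> //.
    by rewrite -gain_line; apply/Kset_schur.
  by rewrite -gain_line.
- by rewrite /st z.
- by rewrite /f z.
- by rewrite /f /f1 z dotmNr oppr_lt0.
- by move=> t ht; rewrite /f /f1 z dotmNr mulrN; exact: bd.
by rewrite /st /f /f1 z dotmNr mulrN scalerN.
Unshelve. all: by end_near.
Qed.

End TaskDescent.

(** * Second moment of a centred normal law *)

Section GaussianMoment.
Context {R : realType}.
Notation mu := (@lebesgue_measure R).

(** The Radon-Nikodym derivative of the normal law agrees almost everywhere with its density. *)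
Lemma integral_normal_prob (s : R) (f : R -> \bar R) : (forall x, (0 <= f x)%E) ->
  measurable_fun setT f ->
  (\int[normal_prob 0 s]_x f x = \int[mu]_x (f x * (normal_pdf 0 s x)%:E))%E.
Proof.
move=> f0 mf; have dom := normal_prob_dominates (0 : R) s.
rewrite -(Radon_Nikodym_SigmaFinite.change_of_variables dom) //.
have mp : measurable_fun setT (fun x => (normal_pdf 0 s x)%:E).
  by apply/measurable_EFinP; exact: measurable_normal_pdf.
have mRN := measurable_int _ (Radon_Nikodym_SigmaFinite.f_integrable dom).
apply: ae_eq_integral => //; [exact: emeasurable_funM|exact: emeasurable_funM|].
have : ae_eq mu setT (Radon_Nikodym_SigmaFinite.f (normal_prob 0 s) mu)
    (fun x => (normal_pdf 0 s x)%:E).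
  apply: integral_ae_eq => //; first exact: Radon_Nikodym_SigmaFinite.f_integrable.
  by move=> E _ mE; rewrite -Radon_Nikodym_SigmaFinite.f_integral.
by apply: filterS => x h Tx /=; rewrite (h Tx).
Qed.

Section Moment.
Variable s : R.
Hypothesis s0 : 0 < s.
Let p := normal_pdf (0 : R) s.
(** Integration by parts in the form [F' = h], with [F] vanishing at 0 and at infinity, equates the
    integrals of [x^2 p] and [s^2 p] on the half-line. Since [h] changes sign at [s], the half-line
    is cut there and each piece is written with nonnegative integrands. *)
Let F (x : R) := - (s ^+ 2 * (x * p x)).
Let h (x : R) := (x ^+ 2 - s ^+ 2) * p x.

Let sn0 : s != 0. Proof. by rewrite gt_eqF. Qed.

Let pE x : p x = normal_peak s * expR (- (2 * s ^+ 2)^-1 * (x * x)).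
Proof.
rewrite /p normal_pdfE // /normal_fun subr0; congr (_ * expR _).
by field; rewrite sn0.
Qed.

Let p0 x : 0 <= p x. Proof. exact: normal_pdf_ge0. Qed.

Let dp (x : R) : is_derive x (1 : R) p (- (s ^+ 2)^-1 * x * p x).
Proof.
have dq : is_derive x (1 : R) (fun x : R => - (2 * s ^+ 2)^-1 * (x * x))
    (0 * (x * x) + - (2 * s ^+ 2)^-1 * (1 * x + x * 1)).
  apply: is_derive_mul (is_derive_cst _ _ _) _.
  exact: is_derive_mul (is_derive_id _ _) (is_derive_id _ _).
have de := @is_derive1_comp R expR _ x _ _ (is_derive_expR _) dq.
have := is_derive_mul (is_derive_cst (normal_peak s) x (1 : R)) de.
have -> : (fun t => cst (normal_peak s) t * (expR \o (fun x : R => - (2 * s ^+ 2)^-1 * (x * x))) t) = p.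
  by apply/funext => t; rewrite /= pE.
congr (is_derive _ _ _ _); rewrite /= pE.
by field; rewrite sn0.
Qed.

Let dF (x : R) : is_derive x (1 : R) F (h x).
Proof.
have dx := is_derive_mul (is_derive_id x (1 : R)) (dp x).
have d2 := is_derive_mul (is_derive_cst (s ^+ 2) x (1 : R)) dx.
have := is_deriveN d2.
congr (is_derive _ _ _ _); rewrite /h /=.
by field; rewrite sn0.
Qed.

Let cp : continuous p.
Proof. exact: continuous_normal_pdf. Qed.

Let ch : continuous h.
Proof.
move=> x; apply: cvgM; last exact: cp.
by apply: cvgB; [exact: exprn_continuous | exact: cvg_cst].
Qed.

Let cF : continuous F.
Proof. by move=> x; exact: drv_continuous (is_derive_drv (dF x)). Qed.

Let F_lim : F x @[x --> +oo] --> (0 : R).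
Proof.
pose k := normal_peak s * (2 * s ^+ 2) * s ^+ 2.
have k0 : 0 <= k.
  by rewrite /k !mulr_ge0 ?normal_peak_ge0 ?exprn_ge0 ?ltW.
apply/cvgrPdist_le => /= e e0; near=> x.
have x0 : 0 < x by near: x; exact: nbhs_pinfty_gt.
rewrite sub0r /F opprK ger0_norm; last first.
  by rewrite mulr_ge0 ?exprn_ge0 ?ltW // mulr_gt0 // pE mulr_gt0 ?expR_gt0 ?normal_peak_gt0.
have c0 : 0 < 2 * s ^+ 2 by rewrite mulr_gt0 ?exprn_gt0.
(* [exp u >= 1 + u] gives [exp (- u) <= 1 / u], enough to bound [F] by a multiple of [1 / x]. *)
have hexp : expR (- (2 * s ^+ 2)^-1 * (x * x)) <= (2 * s ^+ 2) / (x * x).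
  rewrite mulNr expRN -[(2 * _) / _]invrK invf_div lef_pV2 ?posrE ?expR_gt0 ?divr_gt0 ?mulr_gt0 //.
  apply: le_trans (expR_ge1Dx _); rewrite mulrC; lra.
apply: le_trans (_ : k / x <= _).
  rewrite pE /k; have -> : normal_peak s * (2 * s ^+ 2) * s ^+ 2 / x =
      s ^+ 2 * (x * (normal_peak s * ((2 * s ^+ 2) / (x * x)))).
    by field; rewrite gt_eqF.
  rewrite ler_wpM2l ?exprn_ge0 ?(ltW s0) // ler_wpM2l ?(ltW x0) // ler_wpM2l //.
  exact: normal_peak_ge0.
rewrite ler_pdivrMr // -ler_pdivrMl // mulrC.
Unshelve. all: by end_near.
Qed.

Let F'E : F^`()%classic =1 h.
Proof. by move=> x; rewrite derive1E (derive_val (is_derive := dF x)). Qed.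

Let I1 : (\int[mu]_(x in `[s, +oo[) (h x)%:E = (- F s)%R%:E)%E.
Proof.
have h0 x : s <= x -> 0 <= h x.
  move=> sx; rewrite /h mulr_ge0 // subr_ge0 ler_pXn2r ?nnegrE ?(ltW s0) //.
  exact: le_trans (ltW s0) sx.
have dFx x : s < x -> derivable F x 1 by move=> _; have [] := dF x.
have cFs : F x @[x --> s^'+] --> F s by apply: cvg_at_right_filter; exact: cF.
have F' : {in `]s, +oo[, F^`()%classic =1 h} by move=> x _; exact: F'E.
have := ge0_continuous_FTC2y h0 (continuous_subspaceT ch) F_lim dFx cFs F'.
by rewrite sub0e.
Qed.

Let I2 : (\int[mu]_(x in `[0%R, s]) (- h x)%R%:E = (- F s)%R%:E)%E.
Proof.
have F0 : F 0 = 0 by rewrite /F mul0r mulr0 oppr0.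
have dN x : is_derive x (1 : R) (fun x => - F x) (- h x) by exact: is_deriveN.
rewrite (@continuous_FTC2 R (fun x => - h x) (fun x => - F x) 0 s s0).
- by rewrite F0 oppr0 sube0.
- by apply: continuous_subspaceT => x; apply: cvgN; exact: ch.
- split.
  + by move=> x _; have [] := dN x.
  + by apply: cvg_at_right_filter; apply: cvgN; exact: cF.
  + by apply: cvg_at_left_filter; apply: cvgN; exact: cF.
- by move=> x _; rewrite derive1E (derive_val (is_derive := dN x)).
Qed.

Let q (x : R) := x ^+ 2 * p x.

Let q0 x : 0 <= q x. Proof. by rewrite mulr_ge0 ?sqr_ge0. Qed.

Let mq : measurable_fun setT q.
Proof.
by apply: measurable_funM; [exact: measurable_funX | exact: measurable_normal_pdf].
Qed.

Let mp : measurable_fun setT p. Proof. exact: measurable_normal_pdf. Qed.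

Let mh : measurable_fun setT h.
Proof.
apply: measurable_funM => //; apply: measurable_funB => //; exact: measurable_funX.
Qed.

Let k := - F s.

Let right_part : (\int[mu]_(x in `[s, +oo[) (q x)%:E =
  k%:E + (s ^+ 2)%:E * \int[mu]_(x in `[s, +oo[) (p x)%:E)%E.
Proof.
rewrite -I1 -ge0_integralZl ?lee_fin ?exprn_ge0 ?(ltW s0) //; last 2 first.
- by apply/measurable_EFinP/measurable_funTS.
- by move=> x _; rewrite lee_fin.
rewrite -ge0_integralD //; last 4 first.
- move=> x /=; rewrite in_itv /= andbT => sx; rewrite lee_fin mulr_ge0 // subr_ge0.
  by rewrite ler_pXn2r ?nnegrE ?(ltW s0) // (le_trans (ltW s0)).
- by apply/measurable_EFinP/measurable_funTS.
- by move=> x _; rewrite -EFinM lee_fin mulr_ge0 ?exprn_ge0 ?(ltW s0).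
- apply: emeasurable_funM => //; apply/measurable_EFinP/measurable_funTS => //.
by apply: eq_integral => x _; rewrite -EFinM -EFinD /q /h; congr (_%:E); ring.
Qed.

Let left_part : ((s ^+ 2)%:E * \int[mu]_(x in `[0%R, s]) (p x)%:E =
  \int[mu]_(x in `[0%R, s]) (q x)%:E + k%:E)%E.
Proof.
rewrite -I2 -ge0_integralZl ?lee_fin ?exprn_ge0 ?(ltW s0) //; last 2 first.
- by apply/measurable_EFinP/measurable_funTS.
- by move=> x _; rewrite lee_fin.
rewrite -ge0_integralD //; last 4 first.
- by move=> x _; rewrite lee_fin.
- by apply/measurable_EFinP/measurable_funTS.
- move=> x /=; rewrite in_itv /= => /andP[x0 xs]; rewrite lee_fin -mulNr mulr_ge0 // opprB subr_ge0.
  by rewrite ler_pXn2r ?nnegrE ?(ltW s0).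
- by apply/measurable_EFinP/measurable_funTS; exact: measurableT_comp.
by apply: eq_integral => x _; rewrite -EFinM -EFinD /q /h; congr (_%:E); ring.
Qed.

Let split_half (f : R -> R) : (forall x, 0 <= f x) -> measurable_fun setT f ->
  (\int[mu]_(x in [set x | (0 <= x)%R]) (f x)%:E =
   \int[mu]_(x in `[0%R, s]) (f x)%:E + \int[mu]_(x in `[s, +oo[) (f x)%:E)%E.
Proof.
move=> f0 mf; have -> : [set x : R | (0 <= x)%R] = `[0%R, s] `|` `]s, +oo[.
  apply/seteqP; split=> x /=; rewrite !in_itv /= ?andbT.
    by move=> x0; have [xs|sx] := leP x s; [left; rewrite x0 | right].
  by move=> [/andP[] //|sx]; exact: ltW (lt_trans s0 sx).
rewrite ge0_integral_setU //.
- congr (_ + _)%E; apply: integral_itv_obnd_cbnd.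
  by apply/measurable_EFinP/measurable_funTS.
- by apply/measurable_EFinP/measurable_funTS.
- by move=> x _; rewrite lee_fin.
- apply/disj_setPS => x /= []; rewrite !in_itv /= andbT => /andP[_ xs] sx.
  by move: (lt_le_trans sx xs); rewrite ltxx.
Qed.

Let pN x : p (- x) = p x. Proof. by rewrite !pE mulrNN. Qed.

Lemma integral_sqr_normal_pdf : (\int[mu]_x (x ^+ 2 * normal_pdf 0 s x)%:E = (s ^+ 2)%:E)%E.
Proof.
rewrite -[LHS]/(\int[mu]_x (q x)%:E)%E ge0_symfun_integralT //; last 2 first.
- by move=> x; apply: cvgM; [exact: exprn_continuous | exact: cp].
- by move=> x; rewrite /= /q sqrrN pN.
have := integral_normal_pdf 0 s; rewrite -[X in X = _]/(\int[mu]_x (p x)%:E)%E.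
rewrite ge0_symfun_integralT //; last by move=> x /=; rewrite pN.
rewrite !split_half // right_part.
have := left_part.
set a := (\int[mu]_(x in `[0%R, s]) (q x)%:E)%E.
set a' := (\int[mu]_(x in `[0%R, s]) (p x)%:E)%E.
set b' := (\int[mu]_(x in `[s, +oo[) (p x)%:E)%E.
have a0 : (0 <= a)%E by apply: integral_ge0 => x _; rewrite lee_fin.
have a'0 : (0 <= a')%E by apply: integral_ge0 => x _; rewrite lee_fin.
have b'0 : (0 <= b')%E by apply: integral_ge0 => x _; rewrite lee_fin.
have two : (0 < 2%:E :> \bar R)%E by rewrite lte_fin.
(* Finiteness must precede any cancellation in the extended reals; it follows from the total mass 1
   of the density. *)
move=> hl hn; have fa' : a' \is a fin_num.
  rewrite ge0_fin_numE // ltey; apply/eqP => ay; move: hn.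
  by rewrite ay addye ?gt0_muley // gt_eqF // (lt_le_trans _ b'0) // ltNye.
have fb' : b' \is a fin_num.
  rewrite ge0_fin_numE // ltey; apply/eqP => ay; move: hn.
  by rewrite ay addey ?gt0_muley // gt_eqF // (lt_le_trans _ a'0) // ltNye.
have fa : a \is a fin_num.
  rewrite ge0_fin_numE // ltey; apply/eqP => ay; move: hl.
  by rewrite ay -(fineK fa') -EFinM.
move: hl hn; rewrite -(fineK fa) -(fineK fa') -(fineK fb').
rewrite -!(EFinM, EFinD) => -[h1] [h2]; congr (_%:E).
have -> : fine a = s ^+ 2 * fine a' - k by rewrite h1 addrK.
have -> : 2 * (s ^+ 2 * fine a' - k + (k + s ^+ 2 * fine b')) = s ^+ 2 * (2 * (fine a' + fine b')) by ring.
by rewrite h2 mulr1.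
Qed.

End Moment.

Lemma integral_sqr_normal_prob (s : R) : 0 < s ->
  (\int[normal_prob 0 s]_x (x ^+ 2)%:E = (s ^+ 2)%:E)%E.
Proof.
move=> s0; rewrite integral_normal_prob //.
- by rewrite -(integral_sqr_normal_pdf s0); apply: eq_integral => x _; rewrite -EFinM.
- by move=> x; rewrite lee_fin sqr_ge0.
- by apply/measurable_EFinP; exact: measurable_funX.
Qed.

End GaussianMoment.

(** * Square-integrable random variables *)

Section SecondMoments.
Context {R : realType} {d : measure_display} {Om : measurableType d}.
Variable P : probability Om R.
Implicit Types X Y Z : Om -> R.

Definition sqint X : Prop :=
  measurable_fun setT X /\ P.-integrable setT (EFin \o (fun om => X om ^+ 2)).

(** Integrability is carried along with the value, since [Rintegral] is total and returns a number
    in any case. *)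
Definition has_int X (v : R) : Prop :=
  P.-integrable setT (EFin \o X) /\ \int[P]_om X om = v.

Definition ip X Y : R := \int[P]_om (X om * Y om).

Lemma has_intD X Y u v : has_int X u -> has_int Y v -> has_int (fun om => X om + Y om) (u + v).
Proof.
move=> [iX <-] [iY <-]; split; last by rewrite RintegralD.
by have := integrableD measurableT iX iY.
Qed.

Lemma has_intZ a X u : has_int X u -> has_int (fun om => a * X om) (a * u).
Proof.
move=> [iX <-]; split; last by rewrite RintegralZl.
by have := integrableZl measurableT a iX.
Qed.

Lemma has_int0 : has_int (fun=> 0) 0.
Proof.
split; last by rewrite Rintegral_cst // mul0r.
exact: finite_measure_integrable_cst.
Qed.

Lemma has_int_sum (I : Type) (r : seq I) (X : I -> Om -> R) (u : I -> R) :
  (forall i, has_int (X i) (u i)) ->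
  has_int (fun om => \sum_(i <- r) X i om) (\sum_(i <- r) u i).
Proof.
move=> h; elim: r => [|i r IH].
  by under eq_fun do rewrite big_nil; rewrite big_nil; exact: has_int0.
by under eq_fun do rewrite big_cons; rewrite big_cons; exact: has_intD.
Qed.

Lemma has_int_expectation X v : has_int X v -> 'E_P[X]%E = v%:E.
Proof.
move=> [iX <-]; rewrite unlock /Rintegral fineK //.
by apply: integrable_fin_num.
Qed.

Lemma sqint_mul X Y : sqint X -> sqint Y -> has_int (fun om => X om * Y om) (ip X Y).
Proof.
move=> [mX iX] [mY iY]; split=> //.
have h := integrableD measurableT iX iY.
apply: le_integrable h => //; first by apply/measurable_EFinP; exact: measurable_funM.
move=> om _ /=; rewrite lee_fin normrM [X in _ <= X]ger0_norm ?addr_ge0 ?sqr_ge0 //.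
rewrite -(real_normK (num_real (X om))) -(real_normK (num_real (Y om))).
have := sqr_ge0 (`|X om| - `|Y om|); have := normr_ge0 (X om); have := normr_ge0 (Y om).
nra.
Qed.

Lemma sqintP X : measurable_fun setT X -> (\int[P]_om (X om ^+ 2)%:E < +oo)%E -> sqint X.
Proof.
move=> mX h; split=> //; apply/integrableP; split.
  by apply/measurable_EFinP; exact: measurable_funX.
by under eq_integral do rewrite /= ger0_norm ?sqr_ge0 //.
Qed.

Lemma sqint0 : sqint (fun=> 0).
Proof.
split=> //=; have -> : EFin \o (fun om : Om => (0 : R) ^+ 2) = EFin \o cst (0 : R).
  by apply/funext => om /=; rewrite expr0n.
exact: finite_measure_integrable_cst.
Qed.

Lemma sqintD X Y : sqint X -> sqint Y -> sqint (fun om => X om + Y om).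
Proof.
move=> sX sY; split; first by apply: measurable_funD; [exact: sX.1 | exact: sY.1].
have [h _] := has_intD (has_intD (sqint_mul sX sX) (has_intZ 2 (sqint_mul sX sY))) (sqint_mul sY sY).
move: h; congr (_.-integrable _ _); apply/funext => om /=; congr (_%:E).
by rewrite sqrrD -!expr2 mulr_natl.
Qed.

Lemma sqintZ a X : sqint X -> sqint (fun om => a * X om).
Proof.
move=> [mX iX]; split; first by apply: measurable_funM.
have := integrableZl measurableT (a ^+ 2) iX.
by congr (_.-integrable _ _); apply/funext => om /=; rewrite exprMn.
Qed.

Lemma sqint_sum (I : Type) (r : seq I) (X : I -> Om -> R) :
  (forall i, sqint (X i)) -> sqint (fun om => \sum_(i <- r) X i om).
Proof.
move=> h; elim: r => [|i r IH].
  by under eq_fun do rewrite big_nil; exact: sqint0.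
by under eq_fun do rewrite big_cons; exact: sqintD.
Qed.

Lemma ipC X Y : ip X Y = ip Y X.
Proof. by apply: eq_Rintegral => om _; rewrite mulrC. Qed.

Lemma has_int_eq X u v : has_int X u -> has_int X v -> u = v.
Proof. by move=> [_ <-] [_ <-]. Qed.

Lemma ipDl X Y Z : sqint X -> sqint Y -> sqint Z ->
  ip (fun om => X om + Y om) Z = ip X Z + ip Y Z.
Proof.
move=> sX sY sZ; apply: has_int_eq (sqint_mul (sqintD sX sY) sZ) _.
have := has_intD (sqint_mul sX sZ) (sqint_mul sY sZ).
by under eq_fun do rewrite -mulrDl.
Qed.

Lemma ipZl a X Y : sqint X -> sqint Y -> ip (fun om => a * X om) Y = a * ip X Y.
Proof.
move=> sX sY; apply: has_int_eq (sqint_mul (sqintZ a sX) sY) _.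
by have := has_intZ a (sqint_mul sX sY); under eq_fun do rewrite mulrA.
Qed.

Lemma ip0l Y : ip (fun=> 0) Y = 0.
Proof. by rewrite /ip; under eq_Rintegral do rewrite mul0r; rewrite Rintegral_cst // mul0r. Qed.

Lemma ip_suml (I : Type) (r : seq I) (X : I -> Om -> R) Y : (forall i, sqint (X i)) -> sqint Y ->
  ip (fun om => \sum_(i <- r) X i om) Y = \sum_(i <- r) ip (X i) Y.
Proof.
move=> sX sY; elim: r => [|i r IH].
  by rewrite big_nil; under [X in ip X _]eq_fun do rewrite big_nil; exact: ip0l.
rewrite big_cons; under [X in ip X _]eq_fun do rewrite big_cons.
by rewrite ipDl ?IH //; exact: sqint_sum.
Qed.

Lemma ip_ge0 X : 0 <= ip X X.
Proof. by apply: Rintegral_ge0 => om _; rewrite -expr2 sqr_ge0. Qed.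

Lemma ip_ae_eq0 X : sqint X -> {ae P, forall om, X om = 0} -> ip X X = 0.
Proof.
move=> sX h; rewrite /ip /Rintegral.
have -> : (\int[P]_om (X om * X om)%:E = \int[P]_om (cst 0 om))%E; last by rewrite integral0.
apply: ae_eq_integral => //.
- by have [/measurable_int] := sqint_mul sX sX.
- by apply: filterS h => om /= -> _; rewrite mulr0.
Qed.

Definition mfun_of d' (T' : measurableType d') (X : Om -> T') (mX : measurable_fun setT X) :
  {mfun Om >-> T'} := HB.pack X (isMeasurableFun.Build _ _ _ _ X mX).

Lemma gauss_second_moment X (s2 : R) : 0 <= s2 -> measurable_fun setT X ->
  (forall B, measurable B -> P (X @^-1` B) = centered_gauss s2 B) ->
  sqint X /\ ip X X = s2.
Proof.
move=> s20 mX law.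
have E2 : (\int[P]_om (X om ^+ 2)%:E = s2%:E)%E.
  pose Xm := @mfun_of _ (measurableTypeR R) X mX.
  have mf : measurable_fun [set: measurableTypeR R] (fun x : R => (x ^+ 2)%:E).
    by apply/measurable_EFinP; exact: measurable_funX.
  have f0 (y : R) : (0 <= (y ^+ 2)%:E)%E by rewrite lee_fin sqr_ge0.
  rewrite -[LHS]/(\int[P]_om ((fun x : R => (x ^+ 2)%:E) \o Xm) om)%E.
  rewrite -(ge0_integral_distribution Xm mf f0).
  move: law; rewrite /centered_gauss; have [-> law|sn0 law] := eqVneq s2 0.
    rewrite (eq_measure_integral (dirac (0 : measurableTypeR R))) => [|A mA _]; last exact: law.
    by rewrite integral_dirac //= diracT mul1e expr0n.
  rewrite (eq_measure_integral (normal_prob 0 (Num.sqrt s2))) => [|A mA _]; last exact: law.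
  by rewrite integral_sqr_normal_prob ?sqr_sqrtr // sqrtr_gt0 lt_def sn0.
have sX : sqint X by apply: sqintP => //; rewrite E2 ltry.
split=> //; rewrite /ip /Rintegral.
by under eq_integral do rewrite -expr2; rewrite E2.
Qed.

(* Independence makes (X, Y) and (X, -Y) equal in law, so E[XY] = -E[XY]. *)
Lemma indep_sym_ip0 X Y : sqint X -> sqint Y ->
  (forall A B, measurable A -> measurable B ->
     P (X @^-1` A `&` Y @^-1` B) = (P (X @^-1` A) * P (Y @^-1` B))%E) ->
  (forall B, measurable B -> P ((fun om => - Y om) @^-1` B) = P (Y @^-1` B)) ->
  ip X Y = 0.
Proof.
move=> sX sY ind sym; have mX := sX.1; have mY := sY.1.
have mNY : measurable_fun setT (fun om => - Y om) by exact: measurableT_comp.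
have mphi : measurable_fun setT (fun om => (X om, Y om) : R * R) by exact: measurable_fun_pair.
have mpsi : measurable_fun setT (fun om => (X om, - Y om) : R * R) by exact: measurable_fun_pair.
pose phi := mfun_of mphi; pose psi := mfun_of mpsi.
pose Xm := mfun_of mX; pose Ym := mfun_of mY.
have mN (B : set R) : measurable B -> measurable (-%R @^-1` B).
  by move=> mB; rewrite -[_ @^-1` _]setTI; exact: (@oppr_measurable R).
have e1 (C : set (R * R)) : measurable C ->
    (distribution P Xm \x distribution P Ym)%E C = distribution P phi C.
  by apply: product_measure_unique => A B mA mB; exact: ind.
have e2 (C : set (R * R)) : measurable C ->
    (distribution P Xm \x distribution P Ym)%E C = distribution P psi C.
  apply: product_measure_unique => A B mA mB.
  rewrite -[RHS]/(P (X @^-1` A) * P (Y @^-1` B))%E -(sym B mB).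
  by apply: (ind A (-%R @^-1` B)) => //; exact: mN.
have mf : measurable_fun [set: R * R] (fun z : R * R => (z.1 * z.2)%:E).
  by apply/measurable_EFinP; apply: measurable_funM.
have [iXY iE] := sqint_mul sX sY.
have sNY : sqint (fun om => - Y om).
  by have := sqintZ (-1) sY; under eq_fun do rewrite mulN1r.
have [iXN _] := sqint_mul sX sNY.
have i1 := integral_distribution mf (X := phi) iXY.
have i2 := integral_distribution mf (X := psi) iXN.
have : ip X Y = ip X (fun om => - Y om).
  rewrite /ip /Rintegral; congr fine.
  rewrite -[LHS]/(\int[P]_om ((fun z : R * R => (z.1 * z.2)%:E) \o phi) om)%E.
  rewrite -[RHS]/(\int[P]_om ((fun z : R * R => (z.1 * z.2)%:E) \o psi) om)%E.
  rewrite -i1 -i2; apply: eq_measure_integral => C mC _.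
  exact: etrans (esym (e1 C mC)) (e2 C mC).
rewrite [X in _ = X]ipC.
have -> : ip (fun om => - Y om) X = - ip X Y.
  by rewrite [ip X Y]ipC -mulN1r -ipZl //; apply: eq_Rintegral => om _; rewrite mulN1r.
lra.
Qed.

End SecondMoments.

(** * Second-moment matrices of random vectors *)

Section Covariance.
Context {R : realType} {d : measure_display} {Om : measurableType d}.
Variable P : probability Om R.

Definition vsq n (X : Om -> 'cV[R]_n) : Prop := forall k, sqint P (fun om => X om k 0).

(** Not centred: the quadratic cost needs second moments, and no mean is ever computed. *)
Definition cov m n (X : Om -> 'cV[R]_m) (Y : Om -> 'cV[R]_n) : 'M[R]_(m, n) :=
  \matrix_(i, j) ip P (fun om => X om i 0) (fun om => Y om j 0).

Lemma vsqD n (X Y : Om -> 'cV[R]_n) : vsq X -> vsq Y -> vsq (fun om => X om + Y om).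
Proof. by move=> sX sY k; under eq_fun do rewrite mxE; exact: sqintD. Qed.

Lemma vsq_mul m n (A : 'M[R]_(m, n)) (X : Om -> 'cV[R]_n) : vsq X -> vsq (fun om => A *m X om).
Proof.
move=> sX k; under eq_fun do rewrite mxE.
by apply: sqint_sum => j; exact: sqintZ.
Qed.

Lemma vsq0 n : vsq (fun=> (0 : 'cV[R]_n)).
Proof. by move=> k; under eq_fun do rewrite mxE; exact: sqint0. Qed.

Lemma cov_tr m n (X : Om -> 'cV[R]_m) (Y : Om -> 'cV[R]_n) : (cov X Y)^T = cov Y X.
Proof. by apply/matrixP => i j; rewrite !mxE ipC. Qed.

Lemma covDl m n (X X' : Om -> 'cV[R]_m) (Y : Om -> 'cV[R]_n) : vsq X -> vsq X' -> vsq Y ->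
  cov (fun om => X om + X' om) Y = cov X Y + cov X' Y.
Proof.
move=> sX sX' sY; apply/matrixP => i j; rewrite !mxE -ipDl //.
by congr (ip _ _ _); apply/funext => om; rewrite mxE.
Qed.

Lemma cov_mull p m n (A : 'M[R]_(p, m)) (X : Om -> 'cV[R]_m) (Y : Om -> 'cV[R]_n) :
  vsq X -> vsq Y -> cov (fun om => A *m X om) Y = A *m cov X Y.
Proof.
move=> sX sY; apply/matrixP => i j; rewrite !mxE.
under eq_bigr do rewrite mxE -ipZl //.
rewrite -ip_suml //; last by move=> k; exact: sqintZ.
by congr (ip _ _ _); apply/funext => om; rewrite mxE.
Qed.

Lemma covDr m n (X : Om -> 'cV[R]_m) (Y Y' : Om -> 'cV[R]_n) : vsq X -> vsq Y -> vsq Y' ->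
  cov X (fun om => Y om + Y' om) = cov X Y + cov X Y'.
Proof. by move=> *; rewrite -cov_tr covDl // linearD /= !cov_tr. Qed.

Lemma cov_mulr p m n (A : 'M[R]_(p, n)) (X : Om -> 'cV[R]_m) (Y : Om -> 'cV[R]_n) :
  vsq X -> vsq Y -> cov X (fun om => A *m Y om) = cov X Y *m A^T.
Proof. by move=> *; rewrite -cov_tr cov_mull // trmx_mul cov_tr. Qed.

Lemma cov0l m n (Y : Om -> 'cV[R]_n) : cov (fun=> (0 : 'cV[R]_m)) Y = 0.
Proof.
apply/matrixP => i j; rewrite !mxE; rewrite -[RHS](ip0l P (fun om => Y om j 0)).
by congr (ip _ _ _); apply/funext => om; rewrite mxE.
Qed.

Lemma cov_congr p m (A : 'M[R]_(p, m)) (X : Om -> 'cV[R]_m) : vsq X ->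
  cov (fun om => A *m X om) (fun om => A *m X om) = A *m cov X X *m A^T.
Proof. by move=> sX; rewrite cov_mull ?cov_mulr ?mulmxA //; exact: vsq_mul. Qed.

Lemma cov_add_uncorrelated n (X Y : Om -> 'cV[R]_n) : vsq X -> vsq Y -> cov X Y = 0 ->
  cov (fun om => X om + Y om) (fun om => X om + Y om) = cov X X + cov Y Y.
Proof.
move=> sX sY h; rewrite covDl ?covDr //; last exact: vsqD.
by rewrite h -[cov Y X]cov_tr h trmx0 addr0 add0r.
Qed.

Lemma cov_qform n (X : Om -> 'cV[R]_n) (a : 'cV[R]_n) : vsq X ->
  qform (cov X X) a = ip P (fun om => (a^T *m X om) 0 0) (fun om => (a^T *m X om) 0 0).
Proof. by move=> sX; rewrite /qform; have := cov_congr a^T sX; rewrite trmxK => <-; rewrite mxE. Qed.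

Lemma cov_psd n (X : Om -> 'cV[R]_n) : vsq X -> psd (cov X X).
Proof.
by move=> sX; split; [exact: cov_tr | move=> a; rewrite cov_qform // ip_ge0].
Qed.

Lemma has_int_qform n (Q : 'M[R]_n) (X : Om -> 'cV[R]_n) : vsq X ->
  has_int P (fun om => qform Q (X om)) (\tr (Q *m cov X X)).
Proof.
move=> sX; have h : has_int P (fun om => \sum_i \sum_j Q i j * (X om j 0 * X om i 0))
    (\sum_i \sum_j Q i j * ip P (fun om => X om j 0) (fun om => X om i 0)).
  by do 2![apply: has_int_sum => ?]; apply: has_intZ; exact: sqint_mul.
have -> : \tr (Q *m cov X X) = \sum_i \sum_j Q i j * ip P (fun om => X om j 0) (fun om => X om i 0).
  by apply: eq_bigr => i _; rewrite mxE; apply: eq_bigr => j _; rewrite mxE.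
suff -> : (fun om => qform Q (X om)) = fun om => \sum_i \sum_j Q i j * (X om j 0 * X om i 0) by [].
apply/funext => om; rewrite qformE dotmE; apply: eq_bigr => i _.
by rewrite big_ord1 mxE mulr_sumr; apply: eq_bigr => j _; ring.
Qed.

Lemma sym_qform_inj n (M M' : 'M[R]_n) : M^T = M -> M'^T = M' ->
  (forall x, qform M x = qform M' x) -> M = M'.
Proof.
move=> sM sM' h; have b x y : bform M x y = bform M' x y.
  have := h (x + y); rewrite !qformDx // !h; lra.
apply/matrixP => i j; have := b (delta_mx i 0) (delta_mx j 0).
by rewrite /bform !trmx_delta -!rowE -!colE !mxE.
Qed.

(** The hypothesis describes the laws of scalar projections; their second moments give the quadratic
    form of [cov X X], and polarization recovers the matrix. *)
Lemma gaussian_vector_cov n (V : 'M[R]_n) (X : Om -> 'cV[R]_n) : psd V ->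
  gaussian_vector P V X -> vsq X /\ cov X X = V.
Proof.
move=> pV [rX law].
have h a : sqint P (fun om => (a^T *m X om) 0 0) /\
    ip P (fun om => (a^T *m X om) 0 0) (fun om => (a^T *m X om) 0 0) = qform V a.
  apply: gauss_second_moment; first exact: pV.2.
    under eq_fun do rewrite mxE.
    by apply: measurable_sum => k; apply: measurable_funM.
  by move=> B mB; exact: law.
have sX : vsq X.
  move=> k; have [+ _] := h (delta_mx k 0).
  by congr (sqint _ _); apply/funext => om; rewrite trmx_delta -rowE mxE.
split=> //; apply: sym_qform_inj; [exact: cov_tr | exact: pV.1 |].
by move=> a; rewrite cov_qform // (h a).2.
Qed.

Lemma sigma_of_coord n (X : Om -> 'cV[R]_n) k (A : set R) : measurable A ->
  sigma_of X ((fun om => X om k 0) @^-1` A).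
Proof.
move=> mA; apply: sub_sigma_algebra; rewrite (bigD1 k) //=; left.
by exists A => //; rewrite setTI.
Qed.

Lemma mutually_independent_pair (I : choiceType) (F : I -> set (set Om)) k1 k2 E1 E2 :
  mutually_independent P F -> k1 != k2 -> F k1 E1 -> F k2 E2 ->
  P (E1 `&` E2) = (P E1 * P E2)%E.
Proof.
move=> ind k12 h1 h2.
pose E k := if k == k1 then E1 else E2.
have Ek1 : E k1 = E1 by rewrite /E eqxx.
have Ek2 : E k2 = E2 by rewrite /E eq_sym (negbTE k12).
have := ind [:: k1; k2] E; rewrite /= inE k12 => /(_ isT) h.
have {}h := h _; rewrite !big_cons big_nil mule1 Ek1 Ek2 in h; rewrite -h.
  congr (P _); apply/seteqP; split=> om /=.
    move=> [a1 a2] i /=; rewrite !inE => /orP[] /eqP ->; by rewrite ?Ek1 ?Ek2.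
  by move=> h'; rewrite -{1}Ek1 -Ek2; split; apply: h'; rewrite /= !inE eqxx ?orbT.
by move=> i; rewrite !inE => /orP[] /eqP ->; rewrite ?Ek1 ?Ek2.
Qed.

(** A coordinate of a centred Gaussian vector has a symmetric law, because [a] and [- a] give
    projections of equal variance; [indep_sym_ip0] then applies. *)
Lemma independent_gaussian_cov0 (I : choiceType) (F : I -> set (set Om)) k1 k2 m n
    (V1 : 'M[R]_m) (V2 : 'M[R]_n) (X : Om -> 'cV[R]_m) (Y : Om -> 'cV[R]_n) :
  mutually_independent P F -> k1 != k2 -> F k1 = sigma_of X -> F k2 = sigma_of Y ->
  psd V1 -> psd V2 -> gaussian_vector P V1 X -> gaussian_vector P V2 Y -> cov X Y = 0.
Proof.
move=> ind k12 e1 e2 p1 p2 gX gY.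
have [sX _] := gaussian_vector_cov p1 gX; have [sY _] := gaussian_vector_cov p2 gY.
apply/matrixP => i j; rewrite !mxE; apply: indep_sym_ip0 => //.
  move=> A B mA mB; apply: (mutually_independent_pair ind k12).
    by rewrite e1; exact: sigma_of_coord.
  by rewrite e2; exact: sigma_of_coord.
move=> B mB; have [_ law] := gY.
have l1 := law (- delta_mx j (0 : 'I_1)) B mB; have l2 := law (delta_mx j (0 : 'I_1)) B mB.
have q : qform V2 (- delta_mx j (0 : 'I_1)) = qform V2 (delta_mx j (0 : 'I_1)).
  by rewrite -scaleN1r qformZx sqrrN expr1n mul1r.
rewrite q -l2 in l1; move: l1.
have -> : [set om | B (((- delta_mx j (0 : 'I_1))^T *m Y om) 0 0)] = (fun om => - Y om j 0) @^-1` B.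
  apply/seteqP; split=> om /=; by rewrite linearN /= mulNmx trmx_delta -rowE !mxE.
suff -> : [set om | B (((delta_mx j (0 : 'I_1))^T *m Y om) 0 0)] = (fun om => Y om j 0) @^-1` B by [].
by apply/seteqP; split=> om /=; rewrite trmx_delta -rowE !mxE.
Qed.

(** The second-order content of the Gaussian assumptions; the expected cost is computed from these
    covariances alone. *)
Definition white_noise m n (W : 'M[R]_m) (V : 'M[R]_n)
    (w : nat -> Om -> 'cV[R]_m) (v : nat -> Om -> 'cV[R]_n) : Prop :=
  [/\ forall t, vsq (w t) /\ cov (w t) (w t) = W,
      forall t, vsq (v t) /\ cov (v t) (v t) = V,
      forall t s, t != s -> cov (w t) (w s) = 0 /\ cov (v t) (v s) = 0 &
      forall t s, cov (w t) (v s) = 0].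

Lemma task_noise_white nx nu ny N (T : 'I_N -> lqg_task R nx nu ny) w v i :
  task_noise T P w v -> psd (tW (T i)) -> psd (tV (T i)) ->
  white_noise (tW (T i)) (tV (T i)) (w i) (v i).
Proof.
move=> [gw gv ind] pW pV; split.
- by move=> t; exact: gaussian_vector_cov (gw i t).
- by move=> t; exact: gaussian_vector_cov (gv i t).
- move=> t s ts; split.
    apply: (independent_gaussian_cov0 (k1 := (i, t, true)) (k2 := (i, s, true)) ind _ _ _ pW pW (gw i t) (gw i s)) => //.
    by rewrite !xpair_eqE eqxx (negbTE ts).
  apply: (independent_gaussian_cov0 (k1 := (i, t, false)) (k2 := (i, s, false)) ind _ _ _ pV pV (gv i t) (gv i s)) => //.
  by rewrite !xpair_eqE eqxx (negbTE ts).
- move=> t s.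
  apply: (independent_gaussian_cov0 (k1 := (i, t, true)) (k2 := (i, s, false)) ind _ _ _ pW pV (gw i t) (gv i s)) => //.
  by rewrite !xpair_eqE andbF.
Qed.

End Covariance.

(** * Linear systems driven by white noise *)

Section LinearSystem.
Context {R : realType} {d : measure_display} {Om : measurableType d}.
Variable P : probability Om R.
Context {nx ny n : nat}.
Variables (W : 'M[R]_nx) (V : 'M[R]_ny).
Variables (w : nat -> Om -> 'cV[R]_nx) (v : nat -> Om -> 'cV[R]_ny).
Variables (F : 'M[R]_n) (Gw : 'M[R]_(n, nx)) (Gv : 'M[R]_(n, ny)).
Hypothesis white : white_noise P W V w v.

(** The step to time [t] uses [w] of time [t - 1] but [v] of time [t], because the Kalman update at
    time [t] has already seen [y_t]. *)
Fixpoint lin_state (t : nat) (om : Om) : 'cV[R]_n :=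
  if t is t'.+1 then F *m lin_state t' om + Gw *m w t' om + Gv *m v t om else 0.

Local Notation z := lin_state.
Local Notation cov := (cov P).
Local Notation vsq := (vsq P).

Lemma vsq_w t : vsq (w t).
Proof. by have [/(_ t) []] := white. Qed.

Lemma vsq_v t : vsq (v t).
Proof. by have [_ /(_ t) []] := white. Qed.

Lemma vsq_lin_state t : vsq (z t).
Proof.
elim: t => [|t IH] /=; first exact: vsq0.
by apply: vsqD; [apply: vsqD|]; apply: vsq_mul => //; [exact: vsq_w | exact: vsq_v].
Qed.

Lemma cov_lin_stateS m (Y : Om -> 'cV[R]_m) t : vsq Y ->
  cov (z t.+1) Y = F *m cov (z t) Y + Gw *m cov (w t) Y + Gv *m cov (v t.+1) Y.
Proof.
move=> sY; have sz := vsq_lin_state t; have sw := vsq_w t; have sv := vsq_v t.+1.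
rewrite /= !covDl ?cov_mull //; do ?[apply: vsqD]; exact: vsq_mul.
Qed.

Lemma cov_lin_state_w t s : (t <= s)%N -> cov (z t) (w s) = 0.
Proof.
elim: t => [|t IH] ts; first exact: cov0l.
have [_ _ h1 h2] := white; rewrite cov_lin_stateS ?IH 1?ltnW //; last exact: vsq_w.
have [-> _] : _ := h1 t s (negbT (ltn_eqF ts)).
by rewrite -[cov (v _) _]cov_tr h2 trmx0 !mulmx0 !addr0.
Qed.

Lemma cov_lin_state_v t s : (t < s)%N -> cov (z t) (v s) = 0.
Proof.
elim: t => [|t IH] ts; first exact: cov0l.
have [_ _ h1 h2] := white; rewrite cov_lin_stateS ?IH 1?ltnW //; last exact: vsq_v.
have [_ ->] : _ := h1 t.+1 s (negbT (ltn_eqF ts)).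
by rewrite h2 !mulmx0 !addr0.
Qed.

(** [z t] contains [Gv v_t] and may be correlated with [v_t]; an output matrix [H] that kills [Gv]
    leaves a dependence on [v] at earlier times only. *)
Lemma cov_lin_state_v_now m (H : 'M[R]_(m, n)) t : H *m Gv = 0 -> cov (fun om => H *m z t om) (v t) = 0.
Proof.
move=> HG; have sv := vsq_v t; rewrite cov_mull //; last exact: vsq_lin_state.
case: t sv => [|t] sv; first by rewrite cov0l mulmx0.
have [_ _ _ h2] := white.
rewrite cov_lin_stateS // cov_lin_state_v // h2 !mulmx0 !add0r mulmxA HG.
by rewrite mul0mx.
Qed.

Lemma cov_lin_state t :
  cov (z t.+1) (z t.+1) = F *m cov (z t) (z t) *m F^T + (Gw *m W *m Gw^T + Gv *m V *m Gv^T).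
Proof.
have sz := vsq_lin_state t; have sw := vsq_w t; have sv := vsq_v t.+1.
have sFz : vsq (fun om => F *m z t om) by exact: vsq_mul.
have sGw : vsq (fun om => Gw *m w t om) by exact: vsq_mul.
have sGv : vsq (fun om => Gv *m v t.+1 om) by exact: vsq_mul.
have [h1 h2 _ h4] := white.
rewrite /= cov_add_uncorrelated ?cov_add_uncorrelated ?cov_congr //; last 3 first.
- by rewrite cov_mull // cov_mulr // cov_lin_state_w // mul0mx mulmx0.
- exact: vsqD.
- rewrite cov_mulr //; last exact: vsqD.
  by rewrite covDl ?cov_mull // cov_lin_state_v // h4 !mulmx0 addr0 mul0mx.
by rewrite (h1 t).2 (h2 t.+1).2 addrA.
Qed.

(** The deviation from the stationary covariance evolves by congruence with powers of [F]. *)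
Lemma cov_lin_state_cvg Gam : schur F ->
  Gam = F *m Gam *m F^T + (Gw *m W *m Gw^T + Gv *m V *m Gv^T) ->
  mxcvg (fun t => cov (z t) (z t)) Gam.
Proof.
move=> sF eG; pose D t := cov (z t) (z t) - Gam.
have hD t : D t.+1 = F *m D t *m F^T.
  by rewrite /D cov_lin_state {1}eG mulmxBr mulmxBl opprD addrACA subrr addr0.
have := mxcvg_add (schur_congr_cvg0 (D 0) sF) (@mxcvg_cst R _ _ Gam); rewrite add0r.
congr mxcvg; apply/funext => t.
by rewrite -(iter_congr hD) subrK.
Qed.

End LinearSystem.

(** * Cesaro means *)

Section Cesaro.
Context {R : realType}.

Lemma cvg_limn_esup_EFin (u : nat -> R) l : u n @[n --> \oo] --> l ->
  limn_esup (fun n => (u n)%:E) = l%:E.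
Proof.
move=> h; have : (u n)%:E @[n --> \oo] --> l%:E by apply: cvg_EFin => //; exact: nearW.
by move=> /cvg_limn_einf_sup [].
Qed.

Lemma cesaro_mean (u : nat -> R) (l : R) : u n @[n --> \oo] --> l ->
  (fun n : nat => n%:R^-1 * \sum_(t < n) u t : R) @ \oo --> l.
Proof.
move=> /cesaro h; rewrite -cvg_shiftS.
suff -> : (fun n => n.+1%:R^-1 * \sum_(t < n.+1) u t) = arithmetic_mean u by [].
by apply/funext => n; rewrite /arithmetic_mean /series /= big_mkord.
Qed.

End Cesaro.

(** * Stationary covariance of the loop closed through the Kalman filter *)

Lemma col_mx_congr (R : comRingType) m1 m2 n (a : 'M[R]_(m1, n)) (b : 'M[R]_(m2, n)) (W : 'M[R]_n) :
  col_mx a b *m W *m (col_mx a b)^T =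
  block_mx (a *m W *m a^T) (a *m W *m b^T) (b *m W *m a^T) (b *m W *m b^T).
Proof. by rewrite mul_col_mx tr_col_mx mul_col_row. Qed.

(** In abstract letters: [St] is the prediction covariance, [X] the filtering covariance, [Y] stands
    for [1 - L C] and [Z] for the covariance of the estimate. The off-diagonal blocks cancel by
    [Y St C^T = L V]: the estimation error is uncorrelated with the estimate. *)
Lemma block_lyap_eq (R : comRingType) nx ny (A St X W Y N a Z : 'M[R]_nx) (L : 'M[R]_(nx, ny))
    (C : 'M[R]_(ny, nx)) (V : 'M[R]_ny) :
  St = A *m X *m A^T + W -> Y *m St *m Y^T + L *m V *m L^T = X ->
  Y *m St *m C^T = L *m V -> C *m St *m Y^T = V *m L^T ->
  Z = L *m (C *m St *m C^T + V) *m L^T + a *m Z *m a^T ->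
  let F := block_mx (Y *m A) 0 (L *m C *m A) a in
  block_mx X 0 0 Z = F *m block_mx X 0 0 Z *m F^T +
    (col_mx Y (L *m C) *m W *m (col_mx Y (L *m C))^T + col_mx (- L) L *m V *m (col_mx (- L) L)^T).
Proof.
move=> eS eX e1 e2 eZ F; rewrite /F.
have h1 := col_mx_congr Y (L *m C) W.
have h2 := col_mx_congr (- L) L V.
rewrite {}h1 {}h2 tr_block_mx !mulmx_block !add_block_mx.
rewrite !trmx0 !(mul0mx, mulmx0, addr0, add0r) linearN /= !(mulNmx, mulmxN) opprK.
rewrite !trmx_mul.
have e m n : forall (U : 'M[R]_(m, nx)) (U' : 'M[R]_(nx, n)),
    U *m A *m X *m (A^T *m U') + U *m W *m U' = U *m St *m U'.
  by move=> U U'; rewrite eS mulmxDr mulmxDl !mulmxA.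
rewrite !addrA; congr block_mx.
- by rewrite e eX.
- by rewrite e !mulmxA e1 subrr.
- by rewrite e -!mulmxA [C *m (_ *m _)]mulmxA e2 subrr.
- rewrite [X in X + _]addrAC e {1}eZ mulmxDr mulmxDl !mulmxA.
  by rewrite addrAC.
Qed.

Section Kalman.
Context {R : realType} {nx nu ny : nat}.
Variable T : lqg_task R nx nu ny.
Local Notation A := (tA T).
Local Notation B := (tB T).
Local Notation C := (tC T).
Local Notation St := (Sigma_tilde T).
Local Notation L := (kalman_gain T).
Hypothesis pV : pd (tV T).
Hypothesis hdare : stabilizing_dare_sol A^T C^T (tW T) (tV T) St.

Definition kalman_corr : 'M[R]_nx := 1%:M - L *m C.

Lemma innov_pd : pd (innov_cov T).
Proof. by apply: pd_addl pV; apply: psd_congr_tr; case: hdare. Qed.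

Lemma kalman_innov : L *m innov_cov T = St *m C^T.
Proof. by rewrite /kalman_gain mulmxKV //; exact: pd_unit innov_pd. Qed.

Lemma kalman_corr_obs : kalman_corr *m St *m C^T = L *m tV T.
Proof.
rewrite /kalman_corr !mulmxBl mul1mx -kalman_innov /innov_cov mulmxDr.
by rewrite -!mulmxA addrAC subrr add0r.
Qed.

Lemma kalman_corr_obs_tr : C *m St *m kalman_corr^T = tV T *m L^T.
Proof.
have [[sS _] _ _] := hdare; apply: trmx_inj.
by rewrite !trmx_mul !trmxK sS pV.1 mulmxA kalman_corr_obs.
Qed.

Lemma kalman_corr_dare : St = A *m (kalman_corr *m St) *m A^T + tW T.
Proof.
have [_ e _] := hdare; rewrite {1}e !trmxK -addrA addrC; congr (_ + _).
rewrite /kalman_corr mulmxBl mul1mx mulmxBr mulmxBl !mulmxA; congr (_ - _).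
by rewrite /kalman_gain /innov_cov [tV T + _]addrC.
Qed.

(** The Joseph form of the covariance update. *)
Lemma kalman_corr_joseph :
  kalman_corr *m St *m kalman_corr^T + L *m tV T *m L^T = kalman_corr *m St.
Proof.
rewrite {2}/kalman_corr linearB /= trmx1 trmx_mul mulmxBr mulmx1 mulmxA kalman_corr_obs.
by rewrite subrK.
Qed.

(** Up to transposition the Riccati equation stabilizes the predictor matrix [A (1 - L C)], whereas
    the filter error evolves with [(1 - L C) A]. *)
Lemma schur_kalman_corr : schur (kalman_corr *m A).
Proof.
have [[sS _] _ /schurP /schur_tr h] := hdare; apply: schur_cyclic.
move: h; congr schur; rewrite linearD /= trmxK trmx_mul trmxK /dare_gain linearN /= mulNmx.
rewrite /kalman_corr mulmxBr mulmx1; congr (_ - _).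
rewrite !trmx_mul !trmxK sS trmx_inv !mulmxA; do 2!congr (_ *m _).
rewrite linearD /= !trmx_mul !trmxK sS pV.1 /kalman_gain /innov_cov [tV T + _]addrC.
by rewrite !mulmxA.
Qed.

Lemma Sigma_nu_psd : psd (Sigma_nu T).
Proof. by apply: psd_congr_tr; exact: pd_psd innov_pd. Qed.

Section Loop.
Variable K : 'M[R]_(nu, nx).
Local Notation acl := (acl A B K).

(* The pair (estimation error, estimate) is an autonomous linear system
   whose matrix is block triangular. *)
Definition loop_F : 'M[R]_(nx + nx) :=
  block_mx (kalman_corr *m A) 0 (L *m C *m A) acl.

Definition loop_Gw : 'M[R]_(nx + nx, nx) := col_mx kalman_corr (L *m C).

Definition loop_Gv : 'M[R]_(nx + nx, ny) := col_mx (- L) L.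

Definition loop_cov : 'M[R]_(nx + nx) :=
  block_mx (kalman_corr *m St) 0 0 (Sg A B (Sigma_nu T) K).

Lemma loop_F_schur : schur acl -> schur loop_F.
Proof. by move=> h; apply: schur_block_triangular => //; exact: schur_kalman_corr. Qed.

Lemma loop_cov_eq : schur acl -> loop_cov = loop_F *m loop_cov *m loop_F^T
  + (loop_Gw *m tW T *m loop_Gw^T + loop_Gv *m tV T *m loop_Gv^T).
Proof.
move=> sK; apply: (@block_lyap_eq R nx ny A St _ _ kalman_corr (Sigma_nu T) acl).
- exact: kalman_corr_dare.
- exact: kalman_corr_joseph.
- exact: kalman_corr_obs.
- exact: kalman_corr_obs_tr.
- by rewrite {1}Sg_eq.
Qed.
End Loop.
End Kalman.

(** * Long-run average cost of a gain *)

Section LQGCost.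
Context {R : realType} {d : measure_display} {Om : measurableType d}.
Variable P : probability Om R.
Context {nx nu ny : nat}.
Variable T : lqg_task R nx nu ny.
Local Notation A := (tA T).
Local Notation B := (tB T).
Local Notation C := (tC T).
Local Notation L := (kalman_gain T).
Variables (w : nat -> Om -> 'cV[R]_nx) (v : nat -> Om -> 'cV[R]_ny).
Hypothesis pV : pd (tV T).
Hypothesis hdare : stabilizing_dare_sol A^T C^T (tW T) (tV T) (Sigma_tilde T).
Hypothesis white : white_noise P (tW T) (tV T) w v.

(** The blocks are (error, estimate), and the plant state is their sum. *)
Definition sel_state : 'M[R]_(nx, nx + nx) := row_mx 1%:M 1%:M.

Definition sel_est : 'M[R]_(nx, nx + nx) := row_mx 0 1%:M.

Section Gain.
Variable K : 'M[R]_(nu, nx).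
Local Notation acl := (acl A B K).
Local Notation z := (lin_state w v (loop_F T K) (loop_Gw T) (loop_Gv T)).

Lemma loop_stateE t om :
  loop_state T (w ^~ om) (v ^~ om) K t = (sel_state *m z t om, sel_est *m z t om).
Proof.
elim: t => [|t IH] /=; first by rewrite !mulmx0.
rewrite {}IH -[z t om]vsubmxK; set e := usubmx _; set h := dsubmx _.
rewrite /loop_F /loop_Gw /loop_Gv /sel_state /sel_est mul_block_col !mul_col_mx !add_col_mx.
rewrite !mul_row_col !mul1mx !mul0mx !add0r /kalman_corr.
set wt := w t om; set vt := v _ om.
rewrite !(mulmxBl, mulmxBr, mulmxDl, mulmxDr, mul1mx, mulNmx, mulmxN) !mulmxA.
congr (_, _); apply/colP => k; rewrite !mxE; ring.
Qed.

Lemma vsq_loop t : vsq P (z t).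
Proof. exact: vsq_lin_state white t. Qed.

Lemma has_int_stage_cost t :
  has_int P (fun om => stage_cost T (w ^~ om) (v ^~ om) K t)
    (\tr (tQ T *m (C *m (sel_state *m cov P (z t) (z t) *m sel_state^T) *m C^T + tV T))
     + \tr (tR T *m (K *m (sel_est *m cov P (z t) (z t) *m sel_est^T) *m K^T))).
Proof.
have sz := vsq_loop t; have [_ hv _ _] := white.
have -> : (fun om => stage_cost T (w ^~ om) (v ^~ om) K t) = fun om =>
    qform (tQ T) (C *m sel_state *m z t om + v t om) + qform (tR T) (K *m sel_est *m z t om).
  by apply/funext => om; rewrite /stage_cost /loop_y /loop_u /loop_x /loop_xhat loop_stateE !mulmxA.
have sx : vsq P (fun om => C *m sel_state *m z t om) by exact: vsq_mul.
have su : vsq P (fun om => K *m sel_est *m z t om) by exact: vsq_mul.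
have e1 : cov P (fun om => C *m sel_state *m z t om + v t om)
    (fun om => C *m sel_state *m z t om + v t om)
  = C *m (sel_state *m cov P (z t) (z t) *m sel_state^T) *m C^T + tV T.
  rewrite cov_add_uncorrelated ?(hv t).2 ?cov_congr ?trmx_mul ?mulmxA //; first exact: (hv t).1.
  apply: cov_lin_state_v_now white _ _ _ _.
  by rewrite /sel_state /loop_Gv -mulmxA mul_row_col !mul1mx addNr mulmx0.
have e2 : cov P (fun om => K *m sel_est *m z t om) (fun om => K *m sel_est *m z t om)
  = K *m (sel_est *m cov P (z t) (z t) *m sel_est^T) *m K^T.
  by rewrite cov_congr // trmx_mul !mulmxA.
rewrite -e1 -e2; apply: has_intD; apply: has_int_qform => //.
by apply: vsqD => //; exact: (hv t).1.
Qed.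

(** The expected stage cost is an affine function of the covariance of (error, estimate), which
    converges; Cesaro averaging preserves the limit. The error block is independent of [K] and
    contributes to the constant. *)
Lemma lqg_costE : schur acl -> lqg_cost T P w v K =
  (\tr (tQ T *m (C *m (kalman_corr T *m Sigma_tilde T) *m C^T + tV T))
   + cost A B (Qtilde T) (tR T) (Sigma_nu T) K)%:E.
Proof.
move=> sK; rewrite cost_Sg //; set Sgm := Sg _ _ _ _.
have cv : mxcvg (fun t => cov P (z t) (z t)) (loop_cov T K).
  by apply: (cov_lin_state_cvg white); [exact: loop_F_schur | exact: loop_cov_eq].
set l := _ + _; rewrite /lqg_cost.
pose c t := \tr (tQ T *m (C *m (sel_state *m cov P (z t) (z t) *m sel_state^T) *m C^T + tV T))
     + \tr (tR T *m (K *m (sel_est *m cov P (z t) (z t) *m sel_est^T) *m K^T)).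
have cl : c t @[t --> \oo] --> l.
  have -> : l = \tr (tQ T *m (C *m (sel_state *m loop_cov T K *m sel_state^T) *m C^T + tV T))
     + \tr (tR T *m (K *m (sel_est *m loop_cov T K *m sel_est^T) *m K^T)).
    rewrite /loop_cov /sel_state /sel_est !mul_row_block !mulmx0 !mul0mx !addr0 !add0r !mul1mx.
    rewrite !tr_row_mx !trmx1 trmx0 !mul_row_col !mulmx1 !mulmx0 ?addr0 ?add0r -/Sgm.
    rewrite -/Sgm /l /Qtilde; set G1 := kalman_corr T *m Sigma_tilde T; move: (G1) => {}G1.
    rewrite !(mulmxDr, mulmxDl) !linearD /=.
    have -> : \tr (C^T *m tQ T *m C *m Sgm) = \tr (tQ T *m (C *m Sgm *m C^T)).
      by rewrite -!mulmxA mxtrace_mulC !mulmxA.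
    have -> : \tr (K^T *m tR T *m K *m Sgm) = \tr (tR T *m (K *m Sgm *m K^T)).
      by rewrite -!mulmxA mxtrace_mulC !mulmxA.
    ring.
  have sc m p (U : 'M[R]_(m, nx + nx)) (U' : 'M[R]_(nx + nx, p)) :=
    mxcvg_mul (mxcvg_mul (@mxcvg_cst R _ _ U) cv) (@mxcvg_cst R _ _ U').
  have cst m p (U : 'M[R]_(m, p)) := @mxcvg_cst R _ _ U.
  have h1 := mxcvg_trace (mxcvg_mul (cst _ _ (tQ T))
    (mxcvg_add (mxcvg_mul (mxcvg_mul (cst _ _ C) (sc _ _ sel_state sel_state^T)) (cst _ _ C^T)) (cst _ _ (tV T)))).
  have h2 := mxcvg_trace (mxcvg_mul (cst _ _ (tR T))
    (mxcvg_mul (mxcvg_mul (cst _ _ K) (sc _ _ sel_est sel_est^T)) (cst _ _ K^T))).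
  exact: (cvgD h1 h2).
rewrite -(cvg_limn_esup_EFin (cesaro_mean cl)); congr limn_esup; apply/funext => n.
rewrite EFinM; congr (_ * _)%E.
apply: has_int_expectation; apply: has_int_sum => t.
exact: has_int_stage_cost.
Qed.

End Gain.
End LQGCost.

(** * Nondegeneracy extracted from a nonzero smallest eigenvalue *)

Section LambdaMin.
Context {R : realType}.

(** A singular positive semidefinite matrix has 0 as an eigenvalue and no negative one. The
    contrapositive turns a nonzero [lambda_min] into definiteness. *)
Lemma lambda_min_singular n (M : 'M[R]_n) : psd M -> M \notin unitmx -> lambda_min M = 0.
Proof.
move=> pM; rewrite -row_free_unit -kermx_eq0 => /rowV0Pn [x /sub_kermxP xM x0].
have e0 : eigenvalue M 0 by apply/eigenvalueP; exists x => //; rewrite xM scale0r.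
have lb : lbound [set a | eigenvalue M a] 0.
  move=> a /eigenvalueP [y yM y0].
  have := pM.2 y^T; rewrite /qform trmxK yM -scalemxAl mxE.
  have -> : (y *m y^T) 0 0 = dotm y^T y^T by rewrite /dotm trmxK trace_mx11.
  rewrite pmulr_lge0 // lt_neqAle dotm_ge0 andbT eq_sym.
  by apply: contra y0 => /eqP /dotm_eq0 /(congr1 trmx); rewrite trmxK trmx0 => ->.
apply/eqP; rewrite eq_le; apply/andP; split; first by apply: ge_inf => //; exists 0.
by apply: lb_le_inf => //; exists 0.
Qed.

Lemma lambda_min_pd n (M : 'M[R]_n) : psd M -> lambda_min M != 0 -> pd M.
Proof.
move=> pM h; apply: psd_unit_pd => //.
by apply: contraNT h => /(lambda_min_singular pM) ->.
Qed.

Lemma lambda_min_mx0 n : lambda_min (0 : 'M[R]_n) = 0.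
Proof.
case: n => [|n].
  (* In dimension 0 there are no eigenvalues, and [inf] of the empty set is 0. *)
  rewrite /lambda_min (_ : [set _ | _] = set0) ?inf0 //; apply/seteqP; split=> a //=.
  by move=> /eigenvalueP [x _]; rewrite [x]thinmx0 eqxx.
apply: lambda_min_singular; last by rewrite unitmxE det0 unitr0.
by split=> [|x]; rewrite ?trmx0 // /qform mulmx0 mul0mx mxE.
Qed.

(** If no stabilizing solution existed, [dare] would take its default value 0, and the Kalman gain
    and [Sigma_nu] would vanish with it. *)
Lemma Sigma_tilde_dare nx nu ny (T : lqg_task R nx nu ny) : lambda_min (Sigma_nu T) != 0 ->
  stabilizing_dare_sol (tA T)^T (tC T)^T (tW T) (tV T) (Sigma_tilde T).
Proof.
have [e _|ne] := pselect (exists X, stabilizing_dare_sol (tA T)^T (tC T)^T (tW T) (tV T) X).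
  exact: (xgetPex 0 e).
have -> : Sigma_nu T = 0; last by rewrite lambda_min_mx0 eqxx.
rewrite /Sigma_nu /kalman_gain; have -> : Sigma_tilde T = 0.
  by apply: xgetPN => X hX; apply: ne; exists X.
by rewrite !mul0mx.
Qed.

End LambdaMin.

(** * Full row rank of the lifting matrix *)

Section FullRank.
Context {R : realType} {d : measure_display} {Om : measurableType d}.
Variable P : probability Om R.
Context {nx nu ny p : nat}.
Variable T : lqg_task R nx nu ny.
Variables (w : nat -> Om -> 'cV[R]_nx) (v : nat -> Om -> 'cV[R]_ny).
Variable S : 'M[R]_(nx, p * nu + p * ny).

(* The innovation term [L v_t] of the estimate has covariance [L V L^T], which
   has the kernel of [Sigma_nu]: a functional killing [S] would kill it. *)
Lemma lifting_matrix_pinv : psd (tW T) -> pd (tV T) ->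
  stabilizing_dare_sol (tA T)^T (tC T)^T (tW T) (tV T) (Sigma_tilde T) ->
  white_noise P (tW T) (tV T) w v -> pd (Sigma_nu T) ->
  lifting_matrix T P w v S -> S *m mp_pinv S = 1%:M.
Proof.
move=> pW pV hd white pN hS; apply: mp_pinv_full_row => a Sa.
pose K := lqg_gain T; pose z := lin_state w v (loop_F T K) (loop_Gw T) (loop_Gv T).
have sz t : vsq P (z t) by exact: vsq_lin_state white t.
have xE t om : loop_xhat T (w ^~ om) (v ^~ om) K t = sel_est *m z t om.
  by rewrite /loop_xhat (loop_stateE T w v K).
have sh : vsq P (fun om => sel_est *m z p.+1 om) by exact: vsq_mul.
have : qform (cov P (fun om => sel_est *m z p.+1 om) (fun om => sel_est *m z p.+1 om)) a = 0.
  rewrite cov_qform //; apply: ip_ae_eq0; first exact: (vsq_mul a^T sh 0).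
  (* Time [p + 1] has a filled window and is a successor, so that the state recursion exhibits the
     fresh noise. *)
  apply: filterS (hS p.+1 (leqnSn p)) => om; rewrite xE => ->.
  by rewrite mulmxA -[S]trmxK -trmx_mul Sa trmx0 mul0mx mxE.
rewrite cov_congr // (cov_lin_state _ _ _ white) qform_congr_tr !qformD !qform_congr_tr.
set b := sel_est^T *m a.
have h1 := (cov_psd (sz p)).2 ((loop_F T K)^T *m b).
have h2 := pW.2 ((loop_Gw T)^T *m b).
have -> : (loop_Gv T)^T *m b = (kalman_gain T)^T *m a.
  by rewrite /b mulmxA -trmx_mul /sel_est /loop_Gv mul_row_col mul0mx mul1mx add0r.
have h3 := (pd_psd pV).2 ((kalman_gain T)^T *m a) => h.
have qL : qform (tV T) ((kalman_gain T)^T *m a) = 0.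
  by apply/eqP; rewrite eq_le h3 andbT -h addrA lerDr addr_ge0.
have La : (kalman_gain T)^T *m a = 0.
  by apply/eqP; apply: contraT => /pV.2; rewrite qL ltxx.
apply/eqP; apply: contraT => /pN.2.
by rewrite /Sigma_nu qform_congr_tr La /qform mulmx0 mxE ltxx.
Qed.

End FullRank.

(** * Limit superior of an affine recursion *)

Section Limsup.
Context {R : realType}.

Lemma limn_esup_le_near (u : nat -> \bar R) c : (\forall n \near \oo, (u n <= c)%E) -> (limn_esup u <= c)%E.
Proof.
move=> h; apply: le_trans (_ : (ereal_sup (u @` [set n | (u n <= c)%E]) <= c)%E).
  by apply: ereal_inf_lbound; exists [set n | (u n <= c)%E].
by apply: ge_ereal_sup => _ /= [n hn <-].
Qed.

Lemma limn_esup_lt_near (u : nat -> \bar R) c : (limn_esup u < c)%E -> \forall n \near \oo, (u n <= c)%E.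
Proof.
move=> /ereal_inf_lt [_ /= [V hV <-] hc]; apply: filterS hV => n Vn.
by apply: le_trans (ltW hc); apply: ereal_sup_ubound; exists n.
Qed.

(** Any real [r] above the limit superior of [u] eventually bounds [u], and becomes the fixed point
    of the recursion. The two infinite values are treated apart. *)
Lemma affine_recursion_limn_esup (a u : nat -> R) c : 0 < c <= 1 ->
  (forall n, a n.+1 <= (1 - c) * a n + c * u n) ->
  (limn_esup (fun n => (a n)%:E) <= limn_esup (fun n => (u n)%:E))%E.
Proof.
move=> /andP[c0 c1] h; apply/lee_addgt0Pr => e e0.
have : forall r : R, (limn_esup (fun n => (u n)%:E) < r%:E)%E ->
    (limn_esup (fun n => (a n)%:E) <= (r + e / 2)%:E)%E.
  move=> r /limn_esup_lt_near [N _ hN]; apply: limn_esup_le_near.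
  under eq_near do rewrite lee_fin.
  apply: (@affine_recursion_limit _ _ (1 - c) _ _ N); rewrite ?divr_gt0 //.
    by rewrite subr_ge0 c1 ltrBlDr ltrDl c0.
  move=> t Nt; apply: le_trans (h t) _; rewrite lerD2l subKr ler_wpM2l ?(ltW c0) //.
  by have := hN t Nt; rewrite /= lee_fin.
case: (limn_esup (fun n => (u n)%:E)) => [l| |] hr; last first.
- rewrite addNye (_ : limn_esup _ = -oo%E) //; apply: eq_ninfty => A.
  have := hr (A - e / 2) (ltNyr _); by rewrite subrK.
- by rewrite addye // leey.
- have := hr (l + e / 2); rewrite lte_fin ltrDl divr_gt0 // => /(_ isT).
  by rewrite -addrA -splitr EFinD.
Qed.

End Limsup.

Section DotmSquare.
Context {R : realType} {m n : nat}.
Implicit Types u v : 'M[R]_(m, n).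

Lemma dotm_sqD u v : dotm (u + v) (u + v) = dotm u u + 2 * dotm u v + dotm v v.
Proof. by rewrite dotmDl !dotmDr (dotmC v u); ring. Qed.

Lemma dotm_sqB u v : dotm (u - v) (u - v) = dotm u u - 2 * dotm u v + dotm v v.
Proof. by rewrite dotm_sqD dotmNl !dotmNr opprK; ring. Qed.

End DotmSquare.

(** * The gradient recursion for abstract gaps and gradients *)

Section PolicyGradient.
Context {R : realType} {m n N : nat}.
Implicit Type K : 'M[R]_(m, n).
Variables (D : 'I_N -> set 'M[R]_(m, n)) (f : 'I_N -> 'M[R]_(m, n) -> R).
Variables (h : 'I_N -> 'M[R]_(m, n) -> 'M[R]_(m, n)) (g : 'M[R]_(m, n) -> 'M[R]_(m, n)).
Variables (b : 'I_N -> 'M[R]_(m, n) -> R) (gam thr gap0 : 'I_N -> R) (alpha Lm : R).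

(* [f i] is the suboptimality gap of task [i], [h i] its gradient and [g] the
   averaged gradient. *)
Definition common_sublevel : set 'M[R]_(m, n) := [set K | forall i, D i K /\ f i K <= thr i].

Hypothesis f_ge0 : forall i K, D i K -> 0 <= f i K.
Hypothesis h_stat : forall i K, D i K -> f i K = 0 -> h i K = 0.
Hypothesis gam_gt0 : forall i, 0 < gam i.
Hypothesis gap0_ge0 : forall i, 0 <= gap0 i.
Hypothesis gap0_thr : forall i, gap0 i <= thr i.
Hypothesis thr0 : forall i, gap0 i = 0 -> thr i = 0.
Hypothesis dominance : forall i K, D i K -> f i K <= thr i -> gam i * f i K <= dotm (h i K) (h i K).
Hypothesis deviation : forall i K, common_sublevel K -> dotm (g K - h i K) (g K - h i K) <= b i K.
Hypothesis b_le : forall i K, common_sublevel K -> b i K <= gam i / 6 * gap0 i.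
Hypothesis alpha_gt0 : 0 < alpha.
Hypothesis alpha_Lm : alpha * Lm <= 1 / 4.
Hypothesis alpha_gam : forall i, alpha * gam i < 4.
Hypothesis step : forall i K, D i K -> f i K <= thr i -> 0 < thr i ->
  (f i K = thr i -> 0 < dotm (h i K) (g K)) ->
  (forall t : R, 0 < t <= alpha ->
     f i K - t * dotm (h i K) (g K) + Lm * dotm (g K) (g K) * t ^+ 2 / 2 < thr i) ->
  D i (K - alpha *: g K) /\
  f i (K - alpha *: g K) <=
    f i K - alpha * dotm (h i K) (g K) + Lm * dotm (g K) (g K) * alpha ^+ 2 / 2.

Lemma step_decrease i K (t : R) : common_sublevel K -> 0 < t <= alpha ->
  f i K - t * dotm (h i K) (g K) + Lm * dotm (g K) (g K) * t ^+ 2 / 2 <=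
  (1 - t * gam i / 4) * f i K + t * gam i / 4 * (2 * (b i K / gam i)).
Proof.
move=> KS /andP[t0 ta]; have [DK fK] := KS i.
have := deviation i KS; set e := g K - h i K => he.
have gE : g K = h i K + e by rewrite /e addrC subrK.
have hd := dominance DK fK; have f0 := f_ge0 DK; have gi := gam_gt0 i.
have -> : t * gam i / 4 * (2 * (b i K / gam i)) = t * b i K / 2.
  by field; rewrite gt_eqF.
rewrite gE dotmDr; set hh := dotm (h i K) (h i K) in hd *; set x := dotm (h i K) e.
have eE : dotm (h i K + e) (h i K + e) = hh + 2 * x + dotm e e.
  exact: dotm_sqD.
rewrite eE; set ee := dotm e e in he eE *.
have s1 : 0 <= hh + 2 * x + ee by rewrite -eE dotm_ge0.
have s2 : 0 <= hh - 2 * x + ee.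
  have -> : hh - 2 * x + ee = dotm (h i K - e) (h i K - e).
    by rewrite dotm_sqB.
  exact: dotm_ge0.
have tL : Lm * (hh + 2 * x + ee) * t ^+ 2 / 2 <= t * (hh + 2 * x + ee) / 8.
  have tL0 : t * Lm <= 1 / 4.
    have [L0|L0] := leP 0 Lm; first by apply: le_trans alpha_Lm; rewrite ler_wpM2r.
    by apply: le_trans (_ : 0 <= _); [rewrite nmulr_lle0 // ltW | ].
  have -> : Lm * (hh + 2 * x + ee) * t ^+ 2 / 2 = (t * Lm) * (t * (hh + 2 * x + ee)) / 2 by field.
  have := ler_wpM2r (mulr_ge0 (ltW t0) s1) tL0; lra.
(* Exactly, [<h, g> - |g|^2 / 8 = |h|^2 / 2 - |e|^2 / 2 + 3 |g|^2 / 8]; dominance and the deviation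
   bound do the rest. *)
have key : hh + x - (hh + 2 * x + ee) / 8 >= gam i / 2 * f i K - b i K / 2 by lra.
(* Half of the decrease [t gam f / 2] is given away; the remaining rate [t gam / 4] is below 1 for
   admissible step sizes. *)
have := ler_wpM2l (ltW t0) key; have : 0 <= t * (gam i * f i K) by rewrite !mulr_ge0 // ltW.
lra.
Qed.

Lemma pg_step_sublevel K : common_sublevel K ->
  common_sublevel (K - alpha *: g K) /\
  forall i, f i (K - alpha *: g K) <=
    (1 - alpha * gam i / 4) * f i K + alpha * gam i / 4 * (2 * (b i K / gam i)).
Proof.
move=> KS; have [[k k0]|npos] := pselect (exists k, gap0 k = 0).
  have gK : g K = 0.
    have [DK fK] := KS k; have hk : h k K = 0.
      by apply: h_stat => //; apply/eqP; rewrite eq_le f_ge0 // andbT -(thr0 k0).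
    have := le_trans (deviation k KS) (b_le k KS); rewrite k0 mulr0 hk subr0 => g0.
    by apply: dotm_eq0; apply/eqP; rewrite eq_le g0 dotm_ge0.
  rewrite gK scaler0 subr0; split=> // i.
  have := step_decrease i KS (t := alpha); rewrite alpha_gt0 lexx => /(_ isT).
  by rewrite gK dotm0r dotm0l !(mulr0, mul0r) subr0 addr0.
have gap_gt0 i : 0 < gap0 i.
  by rewrite lt_neqAle gap0_ge0 andbT eq_sym; apply/eqP => e; apply: npos; exists i.
have dec i (t : R) : 0 < t <= alpha ->
    f i K - t * dotm (h i K) (g K) + Lm * dotm (g K) (g K) * t ^+ 2 / 2 < thr i.
  move=> ht; apply: le_lt_trans (step_decrease i KS ht) _; move/andP: ht => [t0 ta].
  have [DK fK] := KS i; have gi := gam_gt0 i.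
  have c0 : 0 < t * gam i / 4 by rewrite divr_gt0 ?mulr_gt0.
  have c1 : t * gam i / 4 < 1.
    by rewrite ltr_pdivrMr // mul1r; apply: le_lt_trans (alpha_gam i); rewrite ler_wpM2r // ltW.
  (* The constant 6 in the heterogeneity bound puts the fixed point at or below one third of the
     initial gap, strictly inside the threshold. *)
  have bl : 2 * (b i K / gam i) <= gap0 i / 3.
    have : b i K / gam i <= gap0 i / 6.
      rewrite ler_pdivrMr //; apply: le_trans (b_le i KS) _.
      by rewrite le_eqVlt; apply/orP; left; apply/eqP; ring.
    lra.
  have := ler_wpM2l (ltW c0) bl; have g0 := gap_gt0 i; have gt := gap0_thr i.
  have : (1 - t * gam i / 4) * f i K <= (1 - t * gam i / 4) * thr i by rewrite ler_wpM2l // subr_ge0 ltW.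
  have : t * gam i / 4 * (gap0 i / 3) < t * gam i / 4 * thr i by rewrite ltr_pM2l //; lra.
  lra.
have st i : D i (K - alpha *: g K) /\ f i (K - alpha *: g K) <=
    f i K - alpha * dotm (h i K) (g K) + Lm * dotm (g K) (g K) * alpha ^+ 2 / 2.
  have [DK fK] := KS i; have gi := gam_gt0 i; have g0 := gap_gt0 i; have gt := gap0_thr i.
  apply: step => //; first exact: lt_le_trans gt.
    (* On the boundary [|h|^2 >= gam thr >= gam gap0] while [|e|^2 <= gam gap0 / 6], so
       [<h, g> >= (|h|^2 - |e|^2) / 2 > 0]. *)
    move=> fe; have := le_trans (deviation i KS) (b_le i KS).
    have := dominance DK fK; rewrite fe; set e := g K - h i K => hd he.
    have gE : g K = h i K + e by rewrite /e addrC subrK.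
    rewrite gE; have s := dotm_ge0 (h i K + e).
    rewrite dotm_sqD in s; rewrite dotmDr.
    have : gam i * gap0 i <= gam i * thr i by rewrite ler_pM2l.
    have : 0 < gam i * gap0 i by rewrite mulr_gt0.
    lra.
  by move=> t; exact: dec.
have al : 0 < alpha <= alpha by rewrite alpha_gt0 lexx.
split=> i; have [s1 s2] := st i.
  by split=> //; apply: le_trans s2 _; apply: ltW; exact: dec.
by apply: le_trans s2 _; exact: step_decrease.
Qed.

End PolicyGradient.

(** * Gradient difference of two tasks *)

Lemma block_diag_fixpoint (R : pzRingType) n1 n2 (F1 : 'M[R]_n1) (F2 : 'M[R]_n2) (V1 b1 : 'cV[R]_n1)
    (V2 b2 : 'cV[R]_n2) : V1 = F1 *m V1 + b1 -> V2 = F2 *m V2 + b2 ->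
  col_mx V1 V2 = block_mx F1 0 0 F2 *m col_mx V1 V2 + col_mx b1 b2.
Proof.
by move=> h1 h2; rewrite mul_block_col !mul0mx addr0 add0r add_col_mx -h1 -h2.
Qed.

Lemma mul_row_colN (R : pzRingType) m n1 n2 (C1 : 'M[R]_(m, n1)) (C2 : 'M[R]_(m, n2)) (V1 : 'cV[R]_n1)
    (V2 : 'cV[R]_n2) : row_mx C1 (- C2) *m col_mx V1 V2 = C1 *m V1 - C2 *m V2.
Proof. by rewrite mul_row_col mulNmx. Qed.

Section Heterogeneous.
Context {R : realType} {nx nu ny N q : nat}.
Variables (T : 'I_N -> lqg_task R nx nu ny) (S : 'I_N -> 'M[R]_(nx, q)).

(** The stacked covariances are a fixed point of the block-diagonal system, and its output there is
    the vectorized difference of the gradients. *)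
Lemma grad_bisim_bound i j (K : 'M[R]_(nu, q)) M lam :
  Kset (T i) (S i) K -> Kset (T j) (S j) K ->
  bisim_feasible (F_pair T S i j K) (C_pair T S i j K) M lam ->
  dotm (gradJ (T i) (S i) K - gradJ (T j) (S j) K) (gradJ (T i) (S i) K - gradJ (T j) (S j) K)
    <= bisim_obj (nu_pair T i j) M lam.
Proof.
move=> hi hj fe.
have := bisim_bound fe (block_diag_fixpoint (vec_Sigma hi) (vec_Sigma hj)).
have e : C_pair T S i j K *m col_mx (vec (Sigma_of (T i) (S i) K)) (vec (Sigma_of (T j) (S j) K))
    = vec (gradJ (T i) (S i) K - gradJ (T j) (S j) K).
  by rewrite vecB (vec_gradJ hi) (vec_gradJ hj); exact: mul_row_colN.
by rewrite e dotm_vec.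
Qed.

End Heterogeneous.

(** * Step-size conditions and the multitask recursion *)

Section StepSize.
Context {R : realType}.

(** The case [x = 0], where the quotient is not a real number, is immediate from [0 < c]. *)
Lemma lte_div_EFin (a c x : R) : 0 < c -> 0 <= x -> (a%:E < c%:E / x%:E)%E -> 0 < a -> a * x < c.
Proof.
move=> c0; rewrite le_eqVlt => /orP[/eqP <-|x0]; first by rewrite mulr0.
by rewrite inver gt_eqF // -EFinM lte_fin ltr_pdivlMr.
Qed.

End StepSize.

Lemma EFin_gap (R : numDomainType) (c x y : R) : ((c + x)%:E - (c + y)%:E)%E = (x - y)%:E.
Proof. by rewrite -EFinB opprD addrACA subrr add0r. Qed.

(** Free of probability: the costs enter through the identity [J = c + gcost] on stable gains, and
    [gam] is any positive family satisfying dominance. *)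
Lemma policy_gradient_multitask (R : realType) (nx nu ny N q : nat)
    (T : 'I_N -> lqg_task R nx nu ny) (S : 'I_N -> 'M[R]_(nx, q))
    (J : 'I_N -> 'M[R]_(nu, q) -> \bar R) (c : 'I_N -> R) (Kstar : 'I_N -> 'M[R]_(nu, q))
    (K0 : 'M[R]_(nu, q)) (beta L gam : 'I_N -> R)
    (M : 'I_N -> 'I_N -> 'M[R]_(nu, q) -> 'M[R]_(nx * nx + nx * nx))
    (lam : 'I_N -> 'I_N -> 'M[R]_(nu, q) -> R) (alpha : R) :
  let f := fun i => gcost (T i) (S i) in
  let grad := fun i => gradJ (T i) (S i) in
  let KS := Kstab T S J Kstar K0 beta in
  let KSS := KstabS T S J Kstar K0 beta in
  let b := b_task T M lam in
  (forall i, psd (Qtilde (T i))) -> (forall i, pd (tR (T i))) ->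
  (forall i, pd (Sigma_nu (T i))) -> (forall i, S i *m mp_pinv (S i) = 1%:M) ->
  (forall i X, Kset (T i) (S i) X -> J i X = (c i + f i X)%:E) ->
  (forall i, Kset (T i) (S i) (Kstar i)) ->
  (forall i X, Kset (T i) (S i) X -> (J i (Kstar i) <= J i X)%E) ->
  (forall i, 1 <= beta i) -> KSS K0 ->
  (forall i X X', KS i X -> KS i X' ->
     specnorm (grad i X - grad i X') <= L i * specnorm (X - X')) ->
  (forall i, 0 < gam i) ->
  (forall i X, KS i X ->
     (J i X - J i (Kstar i) <= ((gam i)^-1 * frobnorm (grad i X) ^+ 2)%:E)%E) ->
  (forall i j X, i != j -> KSS X ->
     bisim_feasible (F_pair T S i j X) (C_pair T S i j X) (M i j X) (lam i j X)) ->
  0 < alpha ->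
  (alpha%:E < Order.min (1 / (4 * \big[Num.max/0]_(i < N) L i)%:E)
                        (4 / (\big[Num.max/0]_(i < N) gam i)%:E))%E ->
  (forall i, (ereal_sup [set (b i X)%:E | X in KSS]
     <= (gam i / 6)%:E * (J i K0 - J i (Kstar i)))%E) ->
  let K := pg_iter T S alpha K0 in
  (forall n, KSS (K n)) /\
  (forall i, (limn_esup (fun n : nat => J i (K n) - J i (Kstar i))
     <= limn_esup (fun n : nat => (3 * (b i (K n) / gam i))%:E))%E).
Proof.
move=> f grad KS KSS b pQ pR pN SY JE hs hmin hbeta hK0 hsmooth hgam hdom hfeas halpha hstep hb K.
pose gp i X := f i X - f i (Kstar i).
have gapE i X : Kset (T i) (S i) X -> (J i X - J i (Kstar i))%E = (gp i X)%:E.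
  by move=> hX; rewrite (JE i X hX) (JE i _ (hs i)); exact: EFin_gap.
have fmin i X : Kset (T i) (S i) X -> f i (Kstar i) <= f i X.
  by move=> hX; have := hmin i X hX; rewrite (JE i X hX) (JE i _ (hs i)) lee_fin lerD2l.
have gp_ge0 i X : Kset (T i) (S i) X -> 0 <= gp i X by move=> hX; rewrite subr_ge0; exact: fmin.
have hK0s i : Kset (T i) (S i) K0 by have [] := hK0 i I.
pose thr i := beta i * gp i K0.
have KSE i X : KS i X <-> Kset (T i) (S i) X /\ gp i X <= thr i.
  split=> -[hX].
    rewrite /gap (gapE i X hX) (gapE i K0 (hK0s i)) -EFinM lee_fin => hg.
    exact: (conj hX hg).
  move=> hg.
  by split; [exact: hX | rewrite /gap (gapE i X hX) (gapE i K0 (hK0s i)) -EFinM lee_fin].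
pose D i := Kset (T i) (S i).
have KSSE X : KSS X <-> common_sublevel D gp thr X.
  split=> h i; first by apply/KSE; exact: h.
  by move=> _; apply/KSE; exact: h.
pose g X := N%:R^-1 *: \sum_i grad i X.
have stepE X : pg_step T S alpha X = X - alpha *: g X by rewrite /pg_step /g scalerA.
pose Lm := \big[Num.max/0]_(i < N) L i.
(* The maximum starts from 0, hence is nonnegative whatever the signs of the [L i]. *)
have Lm0 : 0 <= Lm by exact: bigmax_ge_id.
have LLm i : L i <= Lm by exact: le_bigmax.
move: hstep; rewrite lt_min => /andP[hstep1 hstep2].
have alpha_Lm : alpha * Lm <= 1 / 4.
  have := lte_div_EFin ltr01 (mulr_ge0 (ler0n R 4) Lm0) hstep1 halpha; lra.
have alpha_gam i : alpha * gam i < 4.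
  have gm : gam i <= \big[Num.max/0]_(i < N) gam i by exact: le_bigmax.
  apply: le_lt_trans (_ : alpha * \big[Num.max/0]_(i < N) gam i < 4).
    by rewrite ler_wpM2l // ltW.
  apply: lte_div_EFin hstep2 halpha; first by rewrite ltr0n.
  exact: le_trans (ltW (hgam i)) gm.
have b_ge0 i X : KSS X -> 0 <= b i X.
  move=> hX; rewrite mulr_ge0 ?invr_ge0 ?ler0n // sumr_ge0 // => j ji.
  have ji' : i != j by rewrite eq_sym.
  have fe := hfeas i j X ji' hX.
  exact: bisim_obj_ge0 fe.
have one X : KSS X -> KSS (pg_step T S alpha X) /\ forall i, gp i (pg_step T S alpha X) <=
    (1 - alpha * gam i / 4) * gp i X + alpha * gam i / 4 * (2 * (b i X / gam i)).
  move=> hX; rewrite stepE.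
  have hfb i Y : common_sublevel D gp thr Y -> dotm (g Y - grad i Y) (g Y - grad i Y) <= b i Y.
    move=> /KSSE hY; have hp j : j != i ->
        dotm (grad i Y - grad j Y) (grad i Y - grad j Y) <= b_pair T M lam i j Y.
      move=> ji; have ij : i != j by rewrite eq_sym.
      have [hi _] := iffLR (KSE i Y) (hY i I); have [hj _] := iffLR (KSE j Y) (hY j I).
      exact: (grad_bisim_bound hi hj (hfeas i j Y ij hY)).
    exact: (@average_deviation R _ _ N (fun j => grad j Y) i (fun j => b_pair T M lam i j Y) hp).
  have hbe i Y : common_sublevel D gp thr Y -> b i Y <= gam i / 6 * gp i K0.
    move=> /KSSE hY; have := hb i; rewrite (gapE i K0 (hK0s i)) -EFinM => h.
    rewrite -lee_fin; apply: le_trans h.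
    by apply: ereal_sup_ubound; exists Y.
  have hd i Y : D i Y -> gp i Y <= thr i -> gam i * gp i Y <= dotm (grad i Y) (grad i Y).
    move=> hY hY2; have hKS : KS i Y by apply/KSE.
    have := hdom i Y hKS; rewrite (gapE i Y hY) lee_fin frobnorm_sqr.
    by rewrite -ler_pdivlMl ?invr_gt0 // invrK.
  have := @pg_step_sublevel R _ _ N D gp grad g b gam thr (fun i => gp i K0) alpha Lm
      gp_ge0 _ hgam (fun i => gp_ge0 i K0 (hK0s i)) _ _ hd hfb hbe halpha alpha_Lm alpha_gam _ X (iffLR (KSSE X) hX).
  move=> [].
  - move=> i Y hY gY; apply: (minimizer_gradJ0 (pQ i) (pR i) (pN i) hY) => Z hZ.
    have -> : gcost (T i) (S i) Y = f i (Kstar i) by apply/eqP; rewrite -subr_eq0; exact/eqP.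
    exact: fmin.
  - by move=> i; rewrite ler_peMl //; exact: gp_ge0 (hK0s i).
  - by move=> i e; rewrite /thr e mulr0.
  - move=> i Y hY hY2 thr_gt0 hbd hpath.
    have lip Z Z' : D i Z -> f i Z - f i (Kstar i) <= thr i -> D i Z' -> f i Z' - f i (Kstar i) <= thr i ->
        specnorm (gradJ (T i) (S i) Z - gradJ (T i) (S i) Z') <= Lm * specnorm (Z - Z').
      move=> z1 z2 z3 z4; apply: le_trans (hsmooth i Z Z' (iffRL (KSE i Z) (conj z1 z2))
        (iffRL (KSE i Z') (conj z3 z4))) _.
      by rewrite ler_wpM2r ?specnorm_ge0.
    exact: (gradient_step (pQ i) (pR i) (pN i) (SY i) (hs i) (fmin i) Lm0 lip hY hY2 halpha hbd hpath).
  by move=> h1 h2; split; [apply/KSSE | exact: h2].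
have KS_n t : KSS (K t).
  by elim: t => [|t IH]; [exact: hK0 | have [] := one _ IH].
split=> // i.
have -> : (fun n => J i (K n) - J i (Kstar i))%E = fun n => (gp i (K n))%:E.
  by apply/funext => n; apply: gapE; have [] := iffLR (KSE i (K n)) (KS_n n i I).
have c01 : 0 < alpha * gam i / 4 <= 1.
  by rewrite divr_gt0 ?mulr_gt0 //= ler_pdivrMr // mul1r ltW.
apply: (affine_recursion_limn_esup c01) => t.
have [_ /(_ i)] := one _ (KS_n t); move=> h; apply: le_trans h _.
rewrite lerD2l ler_wpM2l //; first by case/andP: c01 => /ltW.
(* The recursion has fixed point [2 b / gam]; as [b] is nonnegative, the factor 2 may be relaxed to
   3. *)
by rewrite ler_wpM2r ?ler_nat // divr_ge0 ?b_ge0 // ltW.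
Qed.

Theorem theoremV2 (R : realType) (nx nu ny N p : nat) (hN : (0 < N)%N)
  (T : 'I_N -> lqg_task R nx nu ny)
  (hT : forall i, admissible_task (T i))
  (d : measure_display) (Om : measurableType d) (P : probability Om R)
  (w : 'I_N -> nat -> Om -> 'cV[R]_nx) (v : 'I_N -> nat -> Om -> 'cV[R]_ny)
  (hnoise : task_noise T P w v)
  (S : 'I_N -> 'M[R]_(nx, p * nu + p * ny))
  (hS : forall i, lifting_matrix (T i) P (w i) (v i) (S i)) :
  let J := fun i => lifted_cost (T i) (S i) P (w i) (v i) in
  let grad := fun i => gradJ (T i) (S i) in
  forall (Kstar : 'I_N -> 'M[R]_(nu, p * nu + p * ny))
    (hKstar : forall i, Kset (T i) (S i) (Kstar i) /\
      forall K, Kset (T i) (S i) K -> (J i (Kstar i) <= J i K)%E)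
    (K0 : 'M[R]_(nu, p * nu + p * ny)) (beta : 'I_N -> R)
    (hbeta : forall i, 1 <= beta i),
  let KS := Kstab T S J Kstar K0 beta in
  let KSS := KstabS T S J Kstar K0 beta in
  let gam := fun i => gamma_of (T i) (S i) (Kstar i) in
  forall (hK0 : KSS K0)
    (L : 'I_N -> R)
    (hsmooth : forall i K K', KS i K -> KS i K' ->
      specnorm (grad i K - grad i K') <= L i * specnorm (K - K'))
    (Jbar : 'I_N -> R)
    (hbound : forall i K, KS i K -> (J i K <= (Jbar i)%:E)%E)
    (hgam : forall i, 0 < gam i)
    (hdom : forall i K, KS i K ->
      (J i K - J i (Kstar i) <= ((gam i)^-1 * frobnorm (grad i K) ^+ 2)%:E)%E)
    (M : 'I_N -> 'I_N -> 'M[R]_(nu, p * nu + p * ny) -> 'M[R]_(nx * nx + nx * nx))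
    (lam : 'I_N -> 'I_N -> 'M[R]_(nu, p * nu + p * ny) -> R)
    (hmin : forall i j K, i != j -> KSS K ->
      bisim_minimizer (F_pair T S i j K) (C_pair T S i j K) (nu_pair T i j)
        (M i j K) (lam i j K)),
  let b := b_task T M lam in
  forall (alpha : R) (halpha : 0 < alpha)
    (hstep : (alpha%:E < Order.min
       (1 / (4 * \big[Num.max/0]_(i < N) L i)%:E)
       (4 / (\big[Num.max/0]_(i < N) gam i)%:E))%E)
    (hb : forall i, (ereal_sup [set (b i K)%:E | K in KSS]
       <= (gam i / 6)%:E * (J i K0 - J i (Kstar i)))%E),
  let K := pg_iter T S alpha K0 in
  (forall n, KSS (K n)) /\
  (forall i, (limn_esup (fun n : nat => J i (K n) - J i (Kstar i))
     <= limn_esup (fun n : nat =>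
          (3 * specnorm (S i) * specnorm (Sigma_of (T i) (S i) (Kstar i)) * b i (K n)
           / (4 * lambda_min (Sigma_nu (T i)) ^+ 2 * lambda_min (tR (T i))))%R%:E))%E).
Proof.
move=> J grad Kstar hKstar K0 beta hbeta KS KSS gam hK0 L hsmooth Jbar hbound hgam hdom M lam hmin b
  alpha halpha hstep hb K.
(* A vanishing [lambda_min] would make the numerator of [gamma_of] vanish. *)
have lam0 i : lambda_min (Sigma_nu (T i)) != 0.
  by apply: contraTneq (hgam i) => e; rewrite /gam /gamma_of e expr0n /= !(mulr0, mul0r) ltxx.
have hdare i := Sigma_tilde_dare (lam0 i).
have pW i : psd (tW (T i)) by have [[]] := hT i.
have pV i : pd (tV (T i)) by have [[]] := hT i.
have pQ i : psd (Qtilde (T i)) by have [[_ _ h _] _] := hT i; exact: psd_congr.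
have pR i : pd (tR (T i)) by have [[]] := hT i.
have pN i : pd (Sigma_nu (T i)) := lambda_min_pd (Sigma_nu_psd (pV i) (hdare i)) (lam0 i).
have white i := task_noise_white hnoise (pW i) (pd_psd (pV i)).
have SY i := lifting_matrix_pinv (pW i) (pV i) (hdare i) (white i) (pN i) (hS i).
have [c JE] : exists c : 'I_N -> R, forall i X, Kset (T i) (S i) X ->
    J i X = (c i + gcost (T i) (S i) X)%:E.
  (* The constant is left to unification: it is the filter contribution in [lqg_costE], the same for
     all gains. *)
  eexists=> i X hX; apply: (lqg_costE (pV i) (hdare i) (white i)).
  exact/Kset_schur.
have [h1 h2] := policy_gradient_multitask pQ pR pN SY JE (fun i => (hKstar i).1)
  (fun i => (hKstar i).2) hbeta hK0 hsmooth hgam hdom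
  (fun i j X ij hX => (hmin i j X ij hX).1) halpha hstep hb.
split=> // i; move: (h2 i); congr (_ <= limn_esup _)%E; apply/funext => n; congr (_%:E).
rewrite /gam /gamma_of invf_div /b /K; ring.
Qed.
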